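(* Let $\underline\lambda$ be a block column Schubert problem on $G(a,b)$ and $\underline\rho$ a Schubert problem on $G(c,d)$ (written as $\underline\rho=(\underline\alpha,\underline\beta,\underline\gamma)$ with $\underline\alpha$ of length $2$ and $\underline\beta$ of length $p+q$, so that it can be composed with $\underline\lambda$ via the composable partition with $\underline a=(a_1,a_2)$, $\underline b=(m_1,\dots,m_p,n_1,\dots,n_q)$). Then the composed Schubert problem $\underline\lambda\circ\underline\rho$ on $G(a+c,b+d)$ is fibered over $\underline\lambda$ with fiber $\underline\rho$.
   Context: Partitions are weakly decreasing finite sequences of positive integers (empty allowed); $\Box_{a,b}$ is the partition with $a$ parts equal to $b$; $\mu+\nu$ has $k$-th part $\mu_k+\nu_k$; $(\mu,\nu)$ is the decreasing rearrangement of the concatenated parts. For a vector space $V$, $\mathrm{Gr}(a,V)$ is the Grassmannian of $a$-dimensional subspaces, $G(a,b)=\mathrm{Gr}(a,\mathbb{C}^{a+b})$. For a complete flag $F_\bullet$ ($\dim F_i=i$) and $\lambda\subseteq\Box_{a,b}$, $\Omega_\lambda F_\bullet=\{H:\dim H\cap F_{b+i-\lambda_i}\ge i,\ i=1,\dots,a\}$. A Schubert problem on $G(a,b)$ is a list $\underline\lambda=(\lambda^1,\dots,\lambda^r)$ of partitions in $\Box_{a,b}$ with $\sum|\lambda^i|=ab$; an instance is given by flags $\mathcal F_\bullet=(F^1_\bullet,\dots,F^r_\bullet)$ and its solution set is $\Omega_{\underline\lambda}\mathcal F_\bullet=\bigcap_i\Omega_{\lambda^i}F^i_\bullet$. A block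 column Schubert problem on $G(a,b)$ is $\underline\lambda=(\underline\mu,\underline\nu)$ with $\underline\mu=(\Box_{a_1,b_1},\Box_{a_2,b_2})$, $a=a_1+a_2$, $b=b_1+b_2$, $\underline\nu=(\Box_{a_2,m_1},\dots,\Box_{a_2,m_p},\Box_{a_1,n_1},\dots,\Box_{a_1,n_q})$, $\sum m_i=b_1$, $\sum n_j=b_2$. For a composable partition $\underline\mu=(\mu^1,\dots,\mu^r)$, $\underline\nu=(\nu^1,\dots,\nu^s)$, $\underline a$, $\underline b$ (with $\sum a_i=a$, $\sum b_j=b$, $a_i\ge\ell(\mu^i)$, $b_j\ge\nu^j_1$) and a Schubert problem $\underline\rho=(\underline\alpha,\underline\beta,\underline\gamma)$ on $G(c,d)$ split into lists of lengths $r,s,t$, the composition $\underline\lambda\circ\underline\rho$ is the list $(\Box_{a_i,d}+\mu^i,\alpha^i)$ ($i\le r$), $(\Box_{c,b_j},\nu^j)+\beta^j$ ($j\le s$), $\gamma^k$ ($k\le t$), a Schubert problem on $G(a+c,b+d)$. Fibration: a Schubert problem $\underline\kappa$ on $G(a+c,b+d)$ is fibered over $\underline\lambda$ (on $G(a,b)$) with fiber $\underline\rho$ (on $G(c,d)$) if: (1) for every general instance $\mathcal F_\bullet$ of $\underline\kappa$ there are a subspace $V\subset\mathbb{C}^{a+b+c+d}$ of dimension $a+b$ and an instance $\mathcal E_\bullet$ of $\underline\lambda$ in $\mathrm{Gr}(a,V)$ such that $H\cap V\in\Omega_{\underline\lambda}\mathcal E_\bullet$ for every $H\in\Omega_{\underline\kappa}\mathcal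 F_\bullet$; (2) with $W:=\mathbb{C}^{a+b+c+d}/V$, for every $h\in\Omega_{\underline\lambda}\mathcal E_\bullet$ there is an instance $\mathcal F_\bullet(h)$ of $\underline\rho$ in $\mathrm{Gr}(c,W)$ such that whenever $H\in\Omega_{\underline\kappa}\mathcal F_\bullet$ with $H\cap V=h$, $H/h$ (identified with a $c$-dimensional subspace of $W$) lies in $\Omega_{\underline\rho}\mathcal F_\bullet(h)$; (3) $H\mapsto(H\cap V,H/(H\cap V))$ is a bijection between $\Omega_{\underline\kappa}\mathcal F_\bullet$ and the set of pairs $(h,K)$ with $h\in\Omega_{\underline\lambda}\mathcal E_\bullet$ and $K\in\Omega_{\underline\rho}\mathcal F_\bullet(h)$; (4) for a given $V$ all general instances $\mathcal E_\bullet$ of $\underline\lambda$ in $\mathrm{Gr}(a,V)$ arise in (1), and for general $\mathcal E_\bullet$ and $h\in\Omega_{\underline\lambda}\mathcal E_\bullet$ the instances $\mathcal F_\bullet(h)$ of $\underline\rho$ that arise are general. *)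

(* Defs.v *)
From HB Require Import structures.
From mathcomp Require Import all_boot all_order all_algebra.
Set Implicit Arguments. Unset Strict Implicit. Unset Printing Implicit Defensive.
Import GRing.Theory.

Definition is_partition (l : seq nat) : bool :=
  sorted geq l && all (fun x => 0 < x) l.

Definition box (a b : nat) : seq nat := nseq a b.

Definition padd (mu nu : seq nat) : seq nat :=
  mkseq (fun k => nth 0 mu k + nth 0 nu k) (maxn (size mu) (size nu)).

Definition pconc (mu nu : seq nat) : seq nat := sort geq (mu ++ nu).

Definition in_box (a b : nat) (l : seq nat) : bool :=
  [&& is_partition l, size l <= a & all (fun x => x <= b) l].

Definition schubert_problem (a b : nat) (L : seq (seq nat)) : bool :=
  all (in_box a b) L && (sumn (map sumn L) == a * b).

Definition block_column (a1 a2 b1 b2 : nat) (ms ns : seq nat) : seq (seq nat) :=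
  [:: box a1 b1; box a2 b2] ++ map (box a2) ms ++ map (box a1) ns.

Definition compose (c d : nat) (mus nus : seq (seq nat)) (as_ bs : seq nat)
  (alphas betas gammas : seq (seq nat)) : seq (seq nat) :=
  [seq pconc (padd (box (nth 0 as_ i) d) (nth [::] mus i)) (nth [::] alphas i)
     | i <- iota 0 (size mus)]
  ++ [seq padd (pconc (box c (nth 0 bs j)) (nth [::] nus j)) (nth [::] betas j)
     | j <- iota 0 (size nus)]
  ++ gammas.

(* Linear algebra.  Subspaces of F^N are row spaces of N x N matrices.
   A "relative space" S/U (U <= S) models: U = 0, S = V for a subspace V,
   and U = V, S = F^N for the quotient W = F^N / V (subspaces of W are
   identified with subspaces of F^N containing V).                     *)

Section LinAlg.
Variable F : fieldType.
Variable N : nat.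

Local Open Scope ring_scope.

Definition nulflag : nat -> 'M[F]_N := fun _ => 0.

Definition is_flag (U S : 'M[F]_N) (f : nat -> 'M[F]_N) : bool :=
  let m := (\rank S - \rank U)%N in
  [forall j : 'I_m.+1,
      [&& (U <= f j)%MS, (f j <= S)%MS & \rank (f j) == (\rank U + j)%N]]
  && [forall j : 'I_m, (f j <= f j.+1)%MS].

Definition is_inst (U S : 'M[F]_N) (L : seq (seq nat))
  (Fs : seq (nat -> 'M[F]_N)) : bool :=
  (size Fs == size L) && all (is_flag U S) Fs.

Definition in_gr (U S : 'M[F]_N) (k : nat) (X : 'M[F]_N) : bool :=
  [&& (U <= X)%MS, (X <= S)%MS & \rank X == (\rank U + k)%N].

(* X in Omega_lam f  (with b = dim(S/U) - k):
   dim (X cap f_{b+i-lam_i}) >= i (relative dimensions), i = 1..k *)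
Definition in_schubert (U S : 'M[F]_N) (k : nat) (lam : seq nat)
  (f : nat -> 'M[F]_N) (X : 'M[F]_N) : bool :=
  in_gr U S k X &&
  [forall i : 'I_k,
     (\rank U + i.+1 <=
      \rank (X :&: f ((\rank S - \rank U - k) + i.+1 - nth 0 lam i)%N)%MS)%N].

Definition in_omega (U S : 'M[F]_N) (k : nat) (L : seq (seq nat))
  (Fs : seq (nat -> 'M[F]_N)) (X : 'M[F]_N) : bool :=
  in_gr U S k X &&
  [forall i : 'I_(size L), in_schubert U S k (nth [::] L i) (nth nulflag Fs i) X].

Definition flags_eq (m : nat) (Fs Gs : seq (nat -> 'M[F]_N)) : Prop :=
  size Fs = size Gs /\
  forall i j, (j <= m)%N -> (nth nulflag Fs i j == nth nulflag Gs i j)%MS.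

End LinAlg.

Inductive pexpr (R : Type) (m : nat) : Type :=
| PConst of R
| PVar of nat & 'I_m & 'I_m
| PAdd of pexpr R m & pexpr R m
| PMul of pexpr R m & pexpr R m.

Fixpoint peval (R : fieldType) (m : nat) (gs : seq 'M[R]_m) (e : pexpr R m) : R :=
  match e with
  | PConst c => c
  | PVar i j k => (nth 0%R gs i) j k
  | PAdd e1 e2 => (peval gs e1 + peval gs e2)%R
  | PMul e1 e2 => (peval gs e1 * peval gs e2)%R
  end.

Section Generic.
Variable F : fieldType.
Variable N : nat.
Local Open Scope ring_scope.

(* the flag in S/U determined by an invertible g : 'M_m and an embedding
   B : 'M_(m,N) of F^m onto a complement of U in S:
   i-th subspace = (span of the first i rows of g) * B + U            *)
Definition flag_of_rel (m : nat) (U : 'M[F]_N) (B : 'M[F]_(m, N)) (g : 'M[F]_m)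
  : nat -> 'M[F]_N :=
  fun i => <<((pid_mx i : 'M[F]_m) *m g *m B + U)%MS>>%MS.

Definition std_flag (g : 'M[F]_N) : nat -> 'M[F]_N :=
  flag_of_rel (0 : 'M[F]_N) (1%:M : 'M[F]_N) g.

(* P holds for general r-tuples of flags in S/U (parametrized via B):
   on a nonempty Zariski open subset of GL_m^r                         *)
Definition generic_rel (m : nat) (U : 'M[F]_N) (B : 'M[F]_(m, N)) (r : nat)
  (P : seq (nat -> 'M[F]_N) -> Prop) : Prop :=
  exists p : pexpr F m,
    (exists gs : seq 'M[F]_m,
        [/\ size gs = r, all (fun g => g \in unitmx) gs & peval gs p != 0]) /\
    forall gs : seq 'M[F]_m, size gs = r -> all (fun g => g \in unitmx) gs ->
      peval gs p != 0 -> P (map (flag_of_rel U B) gs).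

Definition general_in_sub (V : 'M[F]_N) (r : nat)
  (P : seq (nat -> 'M[F]_N) -> Prop) : Prop :=
  forall B : 'M[F]_(\rank V, N), (B == V)%MS -> generic_rel 0 B r P.

Definition general_in_quot (V : 'M[F]_N) (r : nat)
  (P : seq (nat -> 'M[F]_N) -> Prop) : Prop :=
  forall B : 'M[F]_(N - \rank V, N), (B + V == 1%:M)%MS -> generic_rel V B r P.

End Generic.

(* kappa on G(a+c, b+d) is fibered over lam (on G(a,b)) with fiber rho
   (on G(c,d)).  The "general instances" of kappa are those in a nonempty
   Zariski open set O (given by p); V, E, F(h) are chosen as functions of
   the instance.                                                        *)
Definition fibered (F : fieldType) (a b c d : nat)
  (kappa lam rho : seq (seq nat)) : Prop :=
  let N := (a + b + c + d)%N in
  exists (p : pexpr F N)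
         (Vf : seq (nat -> 'M[F]_N) -> 'M[F]_N)
         (Ef : seq (nat -> 'M[F]_N) -> seq (nat -> 'M[F]_N))
         (Ff : seq (nat -> 'M[F]_N) -> 'M[F]_N -> seq (nat -> 'M[F]_N)),
    let O (gs : seq 'M[F]_N) : Prop :=
      [/\ size gs = size kappa, all (fun g => g \in unitmx) gs & peval gs p != 0%R] in
    let Fl (gs : seq 'M[F]_N) := map (@std_flag F N) gs in
    let Z : 'M[F]_N := 0%R in
    let I : 'M[F]_N := 1%:M%R in
    (exists gs, O gs) /\
    (forall gs, O gs ->
       let Fs := Fl gs in let V := Vf Fs in let E := Ef Fs in
       [/\ \rank V = (a + b)%N, is_inst Z V lam E &
           forall H, in_omega Z I (a + c) kappa Fs H ->
                     in_omega Z V a lam E (H :&: V)%MS] /\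
       (forall h, in_omega Z V a lam E h ->
          is_inst V I rho (Ff Fs h) /\
          forall H, in_omega Z I (a + c) kappa Fs H -> (H :&: V == h)%MS ->
                    in_omega V I c rho (Ff Fs h) (H + V)%MS) /\
       (* (3) : H |-> (H cap V, H/(H cap V) ~ (H+V)/V) is a bijection *)
       (forall H1 H2, in_omega Z I (a + c) kappa Fs H1 ->
          in_omega Z I (a + c) kappa Fs H2 ->
          (H1 :&: V == H2 :&: V)%MS -> (H1 + V == H2 + V)%MS -> (H1 == H2)%MS) /\
       (forall h K, in_omega Z V a lam E h -> in_omega V I c rho (Ff Fs h) K ->
          exists H, [/\ in_omega Z I (a + c) kappa Fs H,
                        (H :&: V == h)%MS & (H + V == K)%MS])) /\
    (forall gs, O gs ->
       let V := Vf (Fl gs) in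
       general_in_sub V (size lam)
         (fun E => exists gs', O gs' /\ (Vf (Fl gs') == V)%MS /\
                               flags_eq (\rank V) E (Ef (Fl gs'))) /\
       general_in_sub V (size lam)
         (fun E => forall h, in_omega Z V a lam E h ->
            general_in_quot V (size rho)
              (fun G => exists gs', [/\ O gs', (Vf (Fl gs') == V)%MS,
                          flags_eq (\rank V) E (Ef (Fl gs')) &
                          flags_eq (N - \rank V) G (Ff (Fl gs') h)]))).

(* Main.v *)
Require Import Defs.
From Stdlib Require Import FunctionalExtensionality.
From HB Require Import structures.
From mathcomp Require Import all_boot all_order all_algebra.
From mathcomp Require Import all_fingroup zify.
Set Implicit Arguments. Unset Strict Implicit. Unset Printing Implicit Defensive.
Import GRing.Theory Num.Theory.

(** Write [N = a + b + c + d], and let [V1], [V2] be the steps of dimensions [a1 + b2] and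
    [a2 + b1] of the first two flags and [V] their sum. Every other flag [l] carries a pair
    [(s, w)], namely [(a2, m_j)], [(a1, n_j)], or [(0, 0)] for the flags of the [gamma]s, and a
    step [M_l] of codimension [a - s + w]. The conditions on [H] force
    [dim (H cap V_i) >= a_i] and [dim (H cap M_l) >= s + c], so [H] contains [h] in [Gr(a, V)]
    with [dim (h cap M_l) >= s]. For general flags and every such [h], one has [H cap V = h],
    [H] lies in [Lambda := cap_l (h + M_l)], [Lambda cap V = h] and [Lambda + V] is everything.
    Thus [Lambda / h] is identified with [W]; the flags of the fiber are those that the given
    flags induce on it, and [H = Lambda cap K] inverts [H |-> (h, K)].

    All the genericity that is used is a dimension count: the bad tuples of flags are covered by
    finitely many polynomial maps from affine spaces of dimension less than that of the space of
    all tuples, and the image of such a map lies in a hypersurface, by counting monomials.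
    For the last clause of the definition of a fibration, flags are moved by automorphisms that
    act on [V] (resp. on a complement of [V] contained in [Lambda]) and fix a complement of
    [V] (resp. [V]); they depend polynomially on the prescribed flags. *)

(** The numbers balance exactly. The pairs of subspaces of dimensions [a1], [a2] of [V1], [V2] form
    a family of dimension [a1 * b2 + a2 * b1], and meeting [M_l] in dimension [s] costs [s * w];
    these costs have the same sum, because the [m_j] sum to [b1] and the [n_j] to [b2]. So one
    further condition already empties the family for general flags. The main thing to exclude is an
    extra vector: some [y] outside [h] such that [h + y] meets every [M_l] in dimension at least
    [s + 1]. Raising [s] by one costs [w] for each [l], in total [b], while [y] modulo [h] has
    [b - 1] projective parameters if it is confined to [V] or to a suitable step of one of the first
    two flags; for a step of another flag both numbers drop by its [w]. A vector of [H cap V] or of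
    [Lambda] outside [h] is always extra, which yields the equalities of dimensions. The obstacle is
    that [V] and [h] move with the flags, so choices are counted one after another, each relative to
    the earlier ones: covers are built over a base that grows by one matrix at a time. *)

Local Open Scope ring_scope.

(** * Polynomial functions and dimension counting *)

Section PolyFun.
Variable F : numFieldType.

(** Polynomiality is relative to a set of coordinate functions, so that one notion serves
    parameters, matrices, families of matrices and products of these. *)
Class coords (X : Type) := coordfn : (X -> F) -> Prop.

Inductive polyfun {X : Type} {cX : coords X} : (X -> F) -> Prop :=
| polyfun_const c : polyfun (fun _ => c)
| polyfun_coord f : coordfn f -> polyfun f
| polyfun_add f g : polyfun f -> polyfun g -> polyfun (fun x => f x + g x)
| polyfun_mul f g : polyfun f -> polyfun g -> polyfun (fun x => f x * g x)
| polyfun_ext f g : f =1 g -> polyfun f -> polyfun g.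

(* A stream of which only the first [k] entries count as coordinates. *)
Definition env (k : nat) := nat -> F.
Definition fam (N : nat) := nat -> 'M[F]_N.

#[export] Instance coords_unit : coords unit := fun _ => False.
#[export] Instance coords_env k : coords (env k) :=
  fun f => exists2 i, (i < k)%N & f = fun u => u i.
#[export] Instance coords_mx m n : coords 'M[F]_(m, n) :=
  fun f => exists i j, f = fun A => A i j.
#[export] Instance coords_fam N : coords (fam N) :=
  fun f => exists l i j, f = fun g => g l i j.
#[export] Instance coords_prod X Y (cX : coords X) (cY : coords Y) : coords (X * Y) :=
  fun f => (exists2 g, @coordfn X cX g & f = fun x => g x.1) \/
           (exists2 g, @coordfn Y cY g & f = fun x => g x.2).

Definition polymap {X Y : Type} {cX : coords X} {cY : coords Y} (phi : X -> Y) :=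
  forall f, @coordfn Y cY f -> polyfun (fun x => f (phi x)).

Lemma polyfun_comp X Y (cX : coords X) (cY : coords Y) (phi : X -> Y) f :
  polymap phi -> polyfun f -> polyfun (fun x => f (phi x)).
Proof.
move=> Hphi; elim=> [c|g /Hphi//|g h _ IHg _ IHh|g h _ IHg _ IHh|g h Egh _ IHg].
- exact: polyfun_const.
- exact: polyfun_add.
- exact: polyfun_mul.
- by apply: polyfun_ext IHg => x; rewrite Egh.
Qed.

Lemma polymap_comp X Y Z (cX : coords X) (cY : coords Y) (cZ : coords Z)
  (phi : X -> Y) (psi : Y -> Z) : polymap phi -> polymap psi -> polymap (fun x => psi (phi x)).
Proof. by move=> H1 H2 f /H2; apply: (polyfun_comp (f := fun y => f (psi y))). Qed.

Lemma polymap_id X (cX : coords X) : polymap (fun x : X => x).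
Proof. by move=> f Hf; apply: polyfun_coord. Qed.

Lemma polymap_fst X Y Z (cX : coords X) (cY : coords Y) (cZ : coords Z) (phi : X -> Y * Z) :
  polymap phi -> polymap (fun x => (phi x).1).
Proof. by move=> H f Hf; apply: (H (fun x => f x.1)); left; exists f. Qed.

Lemma polymap_snd X Y Z (cX : coords X) (cY : coords Y) (cZ : coords Z) (phi : X -> Y * Z) :
  polymap phi -> polymap (fun x => (phi x).2).
Proof. by move=> H f Hf; apply: (H (fun x => f x.2)); right; exists f. Qed.

Lemma polymap_pair X Y Z (cX : coords X) (cY : coords Y) (cZ : coords Z)
  (phi : X -> Y) (psi : X -> Z) : polymap phi -> polymap psi -> polymap (fun x => (phi x, psi x)).
Proof. by move=> H1 H2 f [[g Hg ->]|[g Hg ->]]; [apply: H1|apply: H2]. Qed.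

Section Matrices.
Variables (X : Type) (cX : coords X).

Lemma polyfun_sum (I : Type) (r : seq I) (P : pred I) (f : I -> X -> F) :
  (forall i, P i -> polyfun (f i)) -> polyfun (fun x => \sum_(i <- r | P i) f i x).
Proof.
move=> H; elim: r => [|i r IH].
  by apply: polyfun_ext (polyfun_const 0) => x; rewrite big_nil.
case Pi: (P i); last by apply: polyfun_ext IH => x; rewrite big_cons Pi.
by apply: polyfun_ext (polyfun_add (H i Pi) IH) => x; rewrite big_cons Pi.
Qed.

Lemma polyfun_prod (I : Type) (r : seq I) (P : pred I) (f : I -> X -> F) :
  (forall i, P i -> polyfun (f i)) -> polyfun (fun x => \prod_(i <- r | P i) f i x).
Proof.
move=> H; elim: r => [|i r IH].
  by apply: polyfun_ext (polyfun_const 1) => x; rewrite big_nil.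
case Pi: (P i); last by apply: polyfun_ext IH => x; rewrite big_cons Pi.
by apply: polyfun_ext (polyfun_mul (H i Pi) IH) => x; rewrite big_cons Pi.
Qed.

Lemma polyfun_exp f n : polyfun f -> polyfun (fun x : X => f x ^+ n).
Proof.
move=> H; elim: n => [|n IH]; first exact: polyfun_const.
by apply: polyfun_ext (polyfun_mul H IH) => x; rewrite exprS.
Qed.

Lemma polymap_mx m n (A : X -> 'M[F]_(m, n)) :
  (forall i j, polyfun (fun x => A x i j)) -> polymap A.
Proof. by move=> H f [i [j ->]]. Qed.

Lemma polymap_entry m n (A : X -> 'M[F]_(m, n)) i j : polymap A -> polyfun (fun x => A x i j).
Proof. by move=> H; apply: (H (fun B => B i j)); exists i, j. Qed.

Lemma polymap_const m n (A : 'M[F]_(m, n)) : polymap (fun _ : X => A).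
Proof. by apply: polymap_mx => i j; apply: polyfun_const. Qed.

Lemma polymap_add m n (A B : X -> 'M[F]_(m, n)) :
  polymap A -> polymap B -> polymap (fun x => A x + B x).
Proof.
move=> HA HB; apply: polymap_mx => i j.
by apply: polyfun_ext (polyfun_add (polymap_entry i j HA) (polymap_entry i j HB)) => x; rewrite mxE.
Qed.

Lemma polymap_opp m n (A : X -> 'M[F]_(m, n)) : polymap A -> polymap (fun x => - A x).
Proof.
move=> HA; apply: polymap_mx => i j.
apply: polyfun_ext (polyfun_mul (polyfun_const (-1)) (polymap_entry i j HA)) => x.
by rewrite mxE mulN1r.
Qed.

Lemma polymap_mul m n p (A : X -> 'M[F]_(m, n)) (B : X -> 'M[F]_(n, p)) :
  polymap A -> polymap B -> polymap (fun x => A x *m B x).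
Proof.
move=> HA HB; apply: polymap_mx => i j.
apply: polyfun_ext (polyfun_sum (index_enum 'I_n) (P := xpredT)
  (f := fun k x => A x i k * B x k j) _) => [x|k _]; first by rewrite mxE.
by apply: polyfun_mul; apply: polymap_entry.
Qed.

Lemma polymap_col m1 m2 n (A : X -> 'M[F]_(m1, n)) (B : X -> 'M[F]_(m2, n)) :
  polymap A -> polymap B -> polymap (fun x => col_mx (A x) (B x)).
Proof.
move=> HA HB; apply: polymap_mx => i j; case: (split_ordP i) => k ->.
  by apply: polyfun_ext (polymap_entry k j HA) => x; rewrite col_mxEu.
by apply: polyfun_ext (polymap_entry k j HB) => x; rewrite col_mxEd.
Qed.

Lemma polymap_row m n1 n2 (A : X -> 'M[F]_(m, n1)) (B : X -> 'M[F]_(m, n2)) :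
  polymap A -> polymap B -> polymap (fun x => row_mx (A x) (B x)).
Proof.
move=> HA HB; apply: polymap_mx => i j; case: (split_ordP j) => k ->.
  by apply: polyfun_ext (polymap_entry i k HA) => x; rewrite row_mxEl.
by apply: polyfun_ext (polymap_entry i k HB) => x; rewrite row_mxEr.
Qed.

Lemma polymap_fam N (g : X -> fam N) l : polymap g -> polymap (fun x => g x l).
Proof. by move=> H f [i [j ->]]; apply: (H (fun g => g l i j)); exists l, i, j. Qed.

Lemma polymap_to_fam N (g : X -> fam N) : (forall l, polymap (fun x => g x l)) -> polymap g.
Proof. by move=> H f [l [i [j ->]]]; apply: polymap_entry. Qed.

Lemma polyfun_det n (A : X -> 'M[F]_n) : polymap A -> polyfun (fun x => \det (A x)).
Proof.
move=> HA; apply: polyfun_sum => s _; apply: polyfun_mul; first exact: polyfun_const.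
by apply: polyfun_prod => i _; apply: polymap_entry.
Qed.

End Matrices.

Lemma polyfun_line N (f : fam N -> F) (g h : fam N) : polyfun f ->
  exists q : {poly F}, forall t, f (fun l => (1 - t) *: g l + t *: h l) = q.[t].
Proof.
elim=> [c|_ [l [i [j ->]]]|f1 f2 _ [q1 H1] _ [q2 H2]|f1 f2 _ [q1 H1] _ [q2 H2]|f1 f2 E _ [q H]].
- by exists c%:P => t; rewrite hornerC.
- exists ((1 - 'X) * (g l i j)%:P + 'X * (h l i j)%:P) => t.
  by rewrite !mxE !hornerE.
- by exists (q1 + q2) => t; rewrite hornerD H1 H2.
- by exists (q1 * q2) => t; rewrite hornerM H1 H2.
- by exists q => t; rewrite -E H.
Qed.

Lemma poly_nonroot (q : {poly F}) : q != 0 -> exists t, q.[t] != 0.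
Proof.
move=> q0; pose s := [seq (i%:R : F) | i <- iota 0 (size q)].
case: (altP (@allP _ (root q) s)) => [Hs|/allPn[t _ Ht]]; last by exists t.
have /(max_poly_roots q0) : all (root q) s by apply/allP.
have -> : uniq s by rewrite map_inj_uniq ?iota_uniq // => i j /eqP; rewrite eqr_nat => /eqP.
by move=> /(_ isT); rewrite size_map size_iota ltnn.
Qed.

(** On the line through a nonzero of [f] and a nonzero of [g], both become nonzero polynomials in
    one variable, and their product has a non-root because the field is infinite. *)
Lemma polyfun_mul_nonvanish N (f g : fam N -> F) : polyfun f -> polyfun g ->
  (exists x, f x != 0) -> (exists x, g x != 0) -> exists x, f x * g x != 0.
Proof.
move=> Hf Hg [x fx] [y gy].
have [q Hq] := polyfun_line x y Hf; have [r Hr] := polyfun_line x y Hg.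
have q0 : q != 0.
  apply: contraNneq fx => q0; move: (Hq 0); rewrite q0 horner0.
  have -> // : (fun l => (1 - 0) *: x l + 0 *: y l) = x.
    by apply: functional_extensionality => l; rewrite subr0 scale1r scale0r addr0.
  by move=> ->.
have r0 : r != 0.
  apply: contraNneq gy => r0; move: (Hr 1); rewrite r0 horner0.
  have -> // : (fun l => (1 - 1) *: x l + 1 *: y l) = y.
    by apply: functional_extensionality => l; rewrite subrr scale1r scale0r add0r.
  by move=> ->.
have [t] := poly_nonroot (mulf_neq0 q0 r0).
by rewrite hornerM -Hq -Hr => Ht; eexists; exact: Ht.
Qed.

(** * Algebraic dependence of more polynomials than variables *)

Definition upd (u : nat -> F) (i : nat) (x : F) : nat -> F :=
  fun j => if j == i then x else u j.

(** A degree bound in each variable separately: [e.+1] values per variable are then enough to detect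
    vanishing. *)
Definition sdeg (e : nat) (f : (nat -> F) -> F) :=
  forall u i, exists2 q : {poly F}, (size q <= e.+1)%N & forall x, f (upd u i x) = q.[x].

Lemma sdeg_le e e' f : (e <= e')%N -> sdeg e f -> sdeg e' f.
Proof.
by move=> le_e H u i; have [q sq Hq] := H u i; exists q => //; apply: leq_trans sq _.
Qed.

Lemma sdeg_const e c : sdeg e (fun _ => c).
Proof.
move=> u i; exists c%:P; first by rewrite size_polyC; case: (c == 0).
by move=> x; rewrite hornerC.
Qed.

Lemma sdeg_add e f g : sdeg e f -> sdeg e g -> sdeg e (fun u => f u + g u).
Proof.
move=> Hf Hg u i; have [q sq Hq] := Hf u i; have [r sr Hr] := Hg u i.
exists (q + r); last by move=> x; rewrite hornerD Hq Hr.
by apply: leq_trans (size_polyD _ _) _; rewrite geq_max sq.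
Qed.

Lemma sdeg_mul e e' f g : sdeg e f -> sdeg e' g -> sdeg (e + e') (fun u => f u * g u).
Proof.
move=> Hf Hg u i; have [q sq Hq] := Hf u i; have [r sr Hr] := Hg u i.
exists (q * r); last by move=> x; rewrite hornerM Hq Hr.
by apply: leq_trans (size_polyMleq _ _) _; lia.
Qed.

Lemma sdeg_exp e f n : sdeg e f -> sdeg (n * e) (fun u => f u ^+ n).
Proof.
move=> H; elim: n => [|n IH].
  by move=> u i; have [q sq Hq] := sdeg_const 0 1 u i; exists q.
move=> u i; have [q sq Hq] := sdeg_mul H IH u i.
by exists q => // x; rewrite exprS Hq.
Qed.

Lemma sdeg_prod (I : Type) (r : seq I) e (f : I -> (nat -> F) -> F) :
  (forall i, sdeg e (f i)) -> sdeg (size r * e) (fun u => \prod_(i <- r) f i u).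
Proof.
move=> H; elim: r => [|j r IH] u i.
  by have [q sq Hq] := sdeg_const 0 1 u i; exists q => // x; rewrite big_nil -(Hq x).
have [q sq Hq] := sdeg_mul (H j) IH u i.
by exists q => // x; rewrite big_cons Hq.
Qed.

Lemma sdeg_sum (I : Type) (r : seq I) e (f : I -> (nat -> F) -> F) :
  (forall i, sdeg e (f i)) -> sdeg e (fun u => \sum_(i <- r) f i u).
Proof.
move=> H; elim: r => [|j r IH] u i.
  by have [q sq Hq] := sdeg_const e 0 u i; exists q => // x; rewrite big_nil -(Hq x).
have [q sq Hq] := sdeg_add (H j) IH u i.
by exists q => // x; rewrite big_cons Hq.
Qed.

Lemma polyfun_sdeg k (f : env k -> F) : polyfun f -> exists e, sdeg e f.
Proof.
elim=> [c|_ [j _ ->]|f1 f2 _ [e1 H1] _ [e2 H2]|f1 f2 _ [e1 H1] _ [e2 H2]|f1 f2 E _ [e H]].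
- by exists 0%N; apply: sdeg_const.
- exists 1%N => u i; rewrite /upd; case: (j == i); first by exists 'X; rewrite ?size_polyX // => x; rewrite hornerX.
  by exists (u j)%:P; [rewrite size_polyC; case: (_ == _)|move=> x; rewrite hornerC].
- exists (maxn e1 e2); apply: sdeg_add.
    by apply: sdeg_le H1; rewrite leq_maxl.
  by apply: sdeg_le H2; rewrite leq_maxr.
- by exists (e1 + e2)%N; apply: sdeg_mul.
- by exists e => u i; have [q sq Hq] := H u i; exists q => // x; rewrite -E.
Qed.

Lemma polyfun_env_dep k (f : env k -> F) (u v : nat -> F) :
  polyfun f -> (forall i, (i < k)%N -> u i = v i) -> f u = f v.
Proof.
move=> H E; elim: H => [//|_ [j /E Ej ->]//|f1 f2 _ H1 _ H2|f1 f2 _ H1 _ H2|f1 f2 Ef _ H].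
- by rewrite H1 H2.
- by rewrite H1 H2.
- by rewrite -!Ef.
Qed.

Lemma poly_vanish_nat (q : {poly F}) n :
  (size q <= n)%N -> (forall i, (i < n)%N -> q.[i%:R] = 0) -> q = 0.
Proof.
move=> sq Hq; apply/eqP; apply: contraT => q0.
pose s := [seq (i%:R : F) | i <- iota 0 n].
have Hs : all (root q) s.
  by apply/allP => x /mapP[i]; rewrite mem_iota => /= Hi ->; apply/rootP/Hq.
have : uniq s by rewrite map_inj_uniq ?iota_uniq // => i j /eqP; rewrite eqr_nat => /eqP.
by move=> /(max_poly_roots q0 Hs); rewrite size_map size_iota ltnNge sq.
Qed.

Lemma grid_vanish k e (f : (nat -> F) -> F) : sdeg e f ->
  (forall u v, (forall i, (i < k)%N -> u i = v i) -> f u = f v) ->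
  (forall g : {ffun 'I_k -> 'I_e.+1},
     f (fun i => if insub i is Some j then (g j : nat)%:R else 0) = 0) ->
  forall u, f u = 0.
Proof.
move=> Hdeg Hdep Hgrid.
(* The coordinates below [j] are arbitrary and those from [j] on are grid values; each induction
   step frees one coordinate by counting roots. *)
suff H j : (j <= k)%N -> forall u, (forall i, (j <= i < k)%N ->
    exists2 x, (x < e.+1)%N & u i = x%:R) -> f u = 0.
  by move=> u; apply: (H k) => // i; lia.
elim: j => [|j IH] jk u Hu.
  have /fin_all_exists[g Hg] : forall i : 'I_k, exists x : 'I_e.+1, u i = (x : nat)%:R.
    by move=> i; have [x xe ->] := Hu i (ltn_ord i); exists (Ordinal xe).
  rewrite -(Hgrid (finfun g)); apply: Hdep => i ik.
  by rewrite insubT ffunE -Hg.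
have [q sq Hq] := Hdeg u j.
have q0 : q = 0.
  apply: (poly_vanish_nat sq) => x xe; rewrite -Hq; apply: IH; first exact: ltnW.
  move=> i /andP[ji ik]; rewrite /upd; case: eqP => [_|/eqP neij]; first by exists x.
  by apply: Hu; rewrite ltn_neqAle eq_sym neij ji.
have -> : f u = f (upd u j (u j)).
  by apply: Hdep => i _; rewrite /upd; case: eqP => [->|].
by rewrite Hq q0 horner0.
Qed.

Lemma digits_inj n D (d d' : {ffun 'I_n -> 'I_D}) :
  (\sum_(i < n) d i * D ^ i = \sum_(i < n) d' i * D ^ i)%N -> d = d'.
Proof.
suff H (x y : 'I_n -> nat) : (forall i, x i < D)%N -> (forall i, y i < D)%N ->
    (\sum_(i < n) x i * D ^ i = \sum_(i < n) y i * D ^ i)%N -> x =1 y.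
  move=> E; apply/ffunP => i; apply: val_inj.
  by apply: (H (fun i => d i) (fun i => d' i)) => // j; apply: ltn_ord.
elim: n x y {d d'} => [|n IH] x y Hx Hy; first by move=> _ [].
rewrite !big_ord_recl !expn0 !muln1.
have S (z : 'I_n.+1 -> nat) : (\sum_(i < n) z (lift ord0 i) * D ^ lift ord0 i =
    (\sum_(i < n) z (lift ord0 i) * D ^ i) * D)%N.
  by rewrite big_distrl /=; apply: eq_bigr => i _; rewrite expnSr mulnA.
rewrite !S => E.
have D0 : (0 < D)%N by apply: leq_ltn_trans (Hx ord0).
have E0 : x ord0 = y ord0.
  have := congr1 (modn^~ D) E.
  by rewrite /= ![(_ ord0 + _)%N]addnC !modnMDl !modn_small.
have E1 := IH (fun i => x (lift ord0 i)) (fun i => y (lift ord0 i))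
  (fun i => Hx _) (fun i => Hy _).
move: E; rewrite E0 => /addnI /eqP; rewrite eqn_pmul2r // => /eqP /E1 E' i.
by case: (unliftP ord0 i) => [j ->|->].
Qed.

(** Kronecker substitution: [v i = t ^+ (D ^ i)] sends distinct exponent vectors with entries below
    [D] to distinct powers of [t]. *)
Lemma monomial_sum_nonvanish n D (c : {ffun 'I_n -> 'I_D} -> F) d0 : c d0 != 0 ->
  exists v : 'I_n -> F, \sum_d c d * \prod_i v i ^+ d i != 0.
Proof.
move=> c0; pose w (d : {ffun 'I_n -> 'I_D}) := (\sum_(i < n) d i * D ^ i)%N.
pose q := \sum_d c d *: 'X^(w d) : {poly F}.
have q0 : q != 0.
  apply: contraNneq c0 => q0; move: (congr1 (fun p : {poly F} => p`_(w d0)) q0).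
  rewrite coef0 coef_sum (bigD1 d0) //= coefZ coefXn eqxx mulr1 big1 ?addr0; first by move->.
  move=> d dd0; rewrite coefZ coefXn; case: eqP => [/digits_inj E|]; last by rewrite mulr0.
  by rewrite E eqxx in dd0.
have [t qt] := poly_nonroot q0.
exists (fun i => t ^+ (D ^ i)); apply: contraNneq qt => E.
rewrite -E horner_sum; apply/eqP; apply: eq_bigr => d _; rewrite hornerZ hornerXn /w.
congr (_ * _); rewrite -prodrXr; apply: eq_bigr => i _.
by rewrite -exprM mulnC.
Qed.

(* Comparing the [D ^ n] monomials in the [f i] with the [B ^ k] points of a grid
   that detects vanishing. *)
Lemma alg_dep k n (f : 'I_n -> env k -> F) : (forall i, polyfun (f i)) -> (k < n)%N ->
  exists D (c : {ffun 'I_n -> 'I_D} -> F),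
    (exists d0, c d0 != 0) /\ forall u, \sum_d c d * \prod_i f i u ^+ d i = 0.
Proof.
move=> Hf kn; have /fin_all_exists[e He] : forall i, exists e, sdeg e (f i).
  by move=> i; apply: polyfun_sdeg.
(* A monomial in the [f i] with exponents below [D] has degree at most [n * (D * m)] in each
   variable, so [B] values per variable suffice. Moreover [B <= D * (n * m).+1], and [D] exceeds
   [(n * m).+1 ^ k]; hence [B ^ k < D ^ k.+1 <= D ^ n]. *)
pose m := (\max_i e i)%N; pose D := ((n * m).+1 ^ k).+1.
pose B := (n * (D * m)).+1.
have Hm i : sdeg m (f i) by apply: sdeg_le (He i); apply: leq_bigmax.
have lt_card : (#|{ffun 'I_k -> 'I_B}| < #|{ffun 'I_n -> 'I_D}|)%N.
  rewrite !card_ffun !card_ord.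
  apply: (@leq_trans (D ^ k.+1)); last by rewrite leq_pexp2l.
  apply: (@leq_ltn_trans ((D * (n * m).+1) ^ k)); last first.
    by rewrite expnMn expnSr ltn_pmul2l ?expn_gt0.
  case: (posnP k) => [->//|k0]; rewrite leq_exp2r // /B.
  by rewrite mulnS mulnCA; have : (0 < D)%N; lia.
pose pt (g : {ffun 'I_k -> 'I_B}) : nat -> F :=
  fun i => if insub i is Some j then (g j : nat)%:R else 0.
pose M := \matrix_(x < #|{ffun 'I_n -> 'I_D}|, y < #|{ffun 'I_k -> 'I_B}|)
  \prod_i f i (pt (enum_val y)) ^+ (enum_val x : {ffun 'I_n -> 'I_D}) i.
have kM : kermx M != 0.
  rewrite kermx_eq0 -row_leq_rank -ltnNge; apply: leq_ltn_trans lt_card.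
  exact: rank_leq_col.
have /rowV0Pn[v /sub_kermxP vM v0] := kM.
exists D, (fun d => v 0 (enum_rank d)); split.
  by have /rV0Pn[x vx] := v0; exists (enum_val x); rewrite enum_valK.
apply: (@grid_vanish k (n * (D * m))).
- apply: sdeg_sum => d; apply: (@sdeg_mul 0); first exact: sdeg_const.
  have := @sdeg_prod _ (index_enum 'I_n) (D * m) (fun i u => f i u ^+ d i).
  rewrite /index_enum -enumT size_enum_ord; apply => i.
  apply: sdeg_le (sdeg_exp (d i) (Hm i)).
  by rewrite leq_mul2r (ltnW (ltn_ord _)) orbT.
- move=> u u' E; apply: eq_bigr => d _; congr (_ * _); apply: eq_bigr => i _.
  by rewrite (polyfun_env_dep (Hf i) E).
move=> g; rewrite -[fun i : nat => _]/(pt g).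
move/rowP/(_ (enum_rank g)): vM; rewrite !mxE => E.
rewrite -[RHS]E (reindex (@enum_val _ {ffun 'I_n -> 'I_D})) /=.
  by apply: eq_bigr => x _; rewrite !mxE enum_valK enum_rankK.
by exists enum_rank => x _; [apply: enum_valK | apply: enum_rankK].
Qed.

(* [S] lies in a finite union of images of polynomial maps in [k] variables. *)
Definition cov {X : Type} {cX : coords X} (k : nat) (S : X -> Prop) :=
  exists (T : finType) (phi : T -> env k -> X),
    (forall t, polymap (phi t)) /\ forall x, S x -> exists t u, x = phi t u.

Lemma cov_sub X (cX : coords X) k (S S' : X -> Prop) :
  (forall x, S' x -> S x) -> cov k S -> cov k S'.
Proof. by move=> H [T [phi [P C]]]; exists T, phi; split=> // x /H /C. Qed.

Lemma cov_le X (cX : coords X) k k' (S : X -> Prop) : (k <= k')%N -> cov k S -> cov k' S.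
Proof.
move=> le_k [T [phi [P C]]]; exists T, phi; split=> // t f /(P t) H.
apply: (@polyfun_comp (env k') (env k) _ _ id _ _ H) => g [i ik ->].
by apply: polyfun_coord; exists i => //; apply: leq_trans le_k.
Qed.

Lemma cov_empty X (cX : coords X) k (S : X -> Prop) : (forall x, ~ S x) -> cov k S.
Proof.
move=> H; exists void, (fun t : void => match t with end); split; first by case.
by move=> x /H.
Qed.

Lemma cov_unit : cov 0 (fun _ : unit => True).
Proof.
exists unit, (fun _ _ => tt); split; first by move=> t f [].
by case=> _; exists tt, (fun=> 0).
Qed.

Lemma cov_map X Y (cX : coords X) (cY : coords Y) k (S : X -> Prop) (T : finType)
  (psi : T -> X -> Y) : (forall t, polymap (psi t)) -> cov k S ->
  cov k (fun y => exists t x, S x /\ y = psi t x).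
Proof.
move=> Hpsi [T' [phi [P C]]]; exists (T * T')%type, (fun t u => psi t.1 (phi t.2 u)).
split; first by move=> t; apply: polymap_comp.
by move=> y [t [x [/C[t' [u ->]] ->]]]; exists (t, t'), u.
Qed.

Lemma cov_map1 X Y (cX : coords X) (cY : coords Y) k (S : X -> Prop)
  (psi : X -> Y) : polymap psi -> cov k S ->
  cov k (fun y => exists2 x, S x & y = psi x).
Proof.
move=> Hpsi HS; apply: cov_sub (cov_map (T := unit) (fun _ => Hpsi) HS).
by move=> y [x Sx ->]; exists tt, x.
Qed.

Lemma cov_free X (cX : coords X) k (S : X -> Prop) m n : cov k S ->
  cov (k + m * n) (fun y : X * 'M[F]_(m, n) => S y.1).
Proof.
move=> [T [phi [P C]]]; exists T.
(* The first [m * n] parameters are the entries of the new matrix; the old parameters are shifted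
   behind them. *)
exists (fun t u => (phi t (fun i => u (m * n + i)%N),
                    \matrix_(i, j) u (mxvec_index i j))); split.
  move=> t; apply: polymap_pair.
    apply: (@polymap_comp _ (env k) _ _ _ _ _ (phi t)) => // f [i ik ->].
    by apply: polyfun_coord; exists (m * n + i)%N => //; rewrite addnC ltn_add2r.
  apply: polymap_mx => i j; apply: (@polyfun_ext (env _) _ (fun u => u (mxvec_index i j))).
    by move=> u; rewrite mxE.
  apply: polyfun_coord; exists (mxvec_index i j) => //.
  exact: leq_trans (ltn_ord _) (leq_addl _ _).
move=> [x A] /= /C[t [u ->]]; exists t.
exists (fun q => if insub q is Some j then mxvec A 0 j else u (q - m * n)%N).
congr (_, _); last first.
  by apply/matrixP => i j; rewrite mxE (valK (mxvec_index i j)) mxvecE.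
congr (phi t _); apply: functional_extensionality => i.
by rewrite insubF ?addKn // ltnNge leq_addr.
Qed.

Lemma polyfun_pexpr N (f : fam N -> F) : polyfun f ->
  exists e : pexpr F N, forall gs, peval gs e = f (nth 0 gs).
Proof.
elim=> [c|_ [l [i [j ->]]]|f1 f2 _ [q1 H1] _ [q2 H2]|f1 f2 _ [q1 H1] _ [q2 H2]|f1 f2 E _ [q H]].
- by exists (PConst _ c).
- by exists (PVar _ l i j).
- by exists (PAdd q1 q2) => gs /=; rewrite H1 H2.
- by exists (PMul q1 q2) => gs /=; rewrite H1 H2.
- by exists q => gs; rewrite -E H.
Qed.

Lemma pexpr_polyfun N (e : pexpr F N) :
  exists2 f : fam N -> F, polyfun f & forall gs, peval gs e = f (nth 0 gs).
Proof.
elim: e => [c|l i j|e1 [f1 P1 H1] e2 [f2 P2 H2]|e1 [f1 P1 H1] e2 [f2 P2 H2]].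
- by exists (fun=> c) => //; apply: polyfun_const.
- by exists (fun g => g l i j) => //; apply: polyfun_coord; exists l, i, j.
- by exists (fun g => f1 g + f2 g); [apply: polyfun_add|move=> gs /=; rewrite H1 H2].
- by exists (fun g => f1 g * f2 g); [apply: polyfun_mul|move=> gs /=; rewrite H1 H2].
Qed.

(** * Properties of general families of matrices *)

Definition generic N (Q : fam N -> Prop) :=
  exists2 P : fam N -> F, polyfun P /\ (exists g, P g != 0) & forall g, P g != 0 -> Q g.

Lemma generic_sub N (Q Q' : fam N -> Prop) : (forall g, Q g -> Q' g) -> generic Q -> generic Q'.
Proof. by move=> H [P HP HQ]; exists P => // g /HQ /H. Qed.

Lemma generic_true N (Q : fam N -> Prop) : (forall g, Q g) -> generic Q.
Proof.
move=> H; exists (fun=> 1) => //; split; first exact: polyfun_const.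
by exists (fun=> 0); rewrite oner_neq0.
Qed.

Lemma generic_and N (Q Q' : fam N -> Prop) :
  generic Q -> generic Q' -> generic (fun g => Q g /\ Q' g).
Proof.
move=> [P [P1 P2] H] [P' [P1' P2'] H'].
exists (fun g => P g * P' g); first by split; [apply: polyfun_mul|apply: polyfun_mul_nonvanish].
by move=> g; rewrite mulf_eq0 negb_or => /andP[/H ? /H'].
Qed.

Lemma generic_all N (T : eqType) (s : seq T) (Q : T -> fam N -> Prop) :
  (forall t, t \in s -> generic (Q t)) -> generic (fun g => forall t, t \in s -> Q t g).
Proof.
elim: s => [|t s IH] H; first by apply: generic_true => g t; rewrite in_nil.
have H1 := H t (mem_head t s).
have H2 : generic (fun g => forall t, t \in s -> Q t g).
  by apply: IH => t' ts; apply: H; rewrite in_cons ts orbT.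
apply: generic_sub (generic_and H1 H2) => g [Q1 Q2] t'.
by rewrite in_cons => /predU1P[->|/Q2].
Qed.

(** On each piece of the cover, the [r * (N * N)] entries of the first [r] matrices are polynomials
    in fewer parameters and so satisfy a nontrivial relation. The product of these relations over
    the finitely many pieces defines the open set. *)
Lemma generic_cov N r X (cX : coords X) (proj : X -> fam N) k (S : X -> Prop) :
  polymap proj -> cov k S -> (k < r * (N * N))%N ->
  generic (fun g => forall x, S x -> (forall l, (l < r)%N -> proj x l = g l) -> False).
Proof.
move=> Hproj [T [phi [P C]]] k_lt.
pose J : finType := ('I_r * ('I_N * 'I_N))%type.
have cJ : #|J| = (r * (N * N))%N by rewrite !card_prod !card_ord.
pose co (g : fam N) (e : 'I_#|J|) : F :=
  g (enum_val e).1 (enum_val e).2.1 (enum_val e).2.2.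
have pco e : polyfun (co^~ e) by apply: polyfun_coord; do 3!eexists.
suff H t : generic (fun g => forall u, (forall l, (l < r)%N -> proj (phi t u) l = g l) -> False).
  have := @generic_all N T (enum T) _ (fun t _ => H t).
  apply: generic_sub => g Hg x /C[t [u ->]] E.
  by apply: (Hg t _ u); rewrite ?mem_enum.
have [e|//|D [c [[d0 c0] Hc]]] := @alg_dep k #|J| (fun e u => co (proj (phi t u)) e).
- have H : polymap (fun u => proj (phi t u)) by apply: polymap_comp.
  exact: (polyfun_comp H (pco e)).
- by rewrite cJ.
exists (fun g => \sum_d c d * \prod_e co g e ^+ d e).
  split.
    apply: polyfun_sum => d _; apply: polyfun_mul; first exact: polyfun_const.
    by apply: polyfun_prod => e _; apply: polyfun_exp.
  have [v Hv] := monomial_sum_nonvanish c0.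
  exists (fun l => \matrix_(i, j) if insub l is Some l' then v (enum_rank (l', (i, j))) else 0).
  apply: contraNneq Hv => E; rewrite -[X in _ == X]E; apply/eqP.
  apply: eq_bigr => d _; congr (_ * _).
  apply: eq_bigr => e _; congr (_ ^+ _); rewrite /co mxE (valK (enum_val e).1).
  by case Ee: (enum_val e) => [l [i j]] /=; rewrite -Ee enum_valK.
move=> g Hg u E; case/eqP: Hg; rewrite -[RHS](Hc u).
apply: eq_bigr => d _; congr (_ * _); apply: eq_bigr => e _; congr (_ ^+ _).
by rewrite /co E.
Qed.

End PolyFun.

(** * Parametrizing matrices by rank conditions *)

Ltac pm := repeat first [ assumption | apply: polymap_id | apply: polymap_const
  | apply: polymap_pair | apply: polymap_col | apply: polymap_row | apply: polymap_mul
  | apply: polymap_add | apply: polymap_opp | apply: polymap_fst | apply: polymap_snd ].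

Section Echelon.
Variable F : fieldType.

Lemma perm_extend s l (f : 'I_s -> 'I_(s + l)) : injective f ->
  exists p : 'S_(s + l), forall i, p (lshift l i) = f i.
Proof.
move=> inj_f; suff H j : (j <= s)%N -> exists p : 'S_(s + l),
    forall i : 'I_s, (i < j)%N -> p (lshift l i) = f i.
  by have [p Hp] := H s (leqnn s); exists p => i; apply: Hp.
elim: j => [_|j IH js]; first by exists 1%g.
have [p Hp] := IH (ltnW js); pose i0 := Ordinal js.
exists (p * tperm (p (lshift l i0)) (f i0))%g => i.
rewrite ltnS leq_eqVlt permM => /orP[/eqP ij|ij].
  have -> : i = i0 by apply: val_inj.
  by rewrite tpermL.
rewrite (Hp i ij) tpermD //.
  rewrite -(Hp i ij) (inj_eq perm_inj) (inj_eq (@lshift_inj _ _)).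
  by apply: contraTneq ij => <-; rewrite ltnn.
by rewrite (inj_eq inj_f); apply: contraTneq ij => <-; rewrite ltnn.
Qed.

(** Some [s] independent columns are moved to the front and inverted. The permutation is the only
    discrete choice, which is why covers are indexed by a finite type. *)
Lemma echelon s l (Z : 'M[F]_(s, s + l)) : row_free Z ->
  exists U Y (p : 'S_(s + l)), U \in unitmx /\ U *m Z = row_mx 1%:M Y *m perm_mx p.
Proof.
move=> Zfree; have Zr : \rank Z^T = s by rewrite mxrank_tr; apply/eqP.
pose f (i : 'I_s) : 'I_(s + l) := maxrankfun Z^T (cast_ord (esym Zr) i).
have inj_f : injective f by move=> i j /maxrankfun_inj /cast_ord_inj.
have [p Hp] := perm_extend inj_f.
pose L := lsubmx (col_perm p Z).
have EL : L^T = rowsub f Z^T by apply/matrixP => i j; rewrite !mxE Hp.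
have UL : L \in unitmx.
  rewrite -unitmx_tr -row_free_unit EL /row_free -[X in _ == X]Zr.
  have -> : \rank (rowsub f Z^T) = \rank (rowsub (maxrankfun Z^T) Z^T).
    apply/eqmx_rank/andP; split; apply/row_subP => i.
      have -> : row i (rowsub f Z^T) =
         row (cast_ord (esym Zr) i) (rowsub (maxrankfun Z^T) Z^T).
        by apply/rowP => j; rewrite !mxE.
      exact: row_sub.
    have -> : row i (rowsub (maxrankfun Z^T) Z^T) = row (cast_ord Zr i) (rowsub f Z^T).
      by apply/rowP => j; rewrite !mxE /f cast_ordK.
    exact: row_sub.
  by rewrite -[_ == _]/(row_free _) maxrowsub_free.
exists (invmx L), (invmx L *m rsubmx (col_perm p Z)), p; split; first by rewrite unitmx_inv.
rewrite -{1}(mulVmx UL) -mul_mx_row hsubmxK col_permE -!mulmxA -perm_mxM mulVg.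
by rewrite perm_mx1 mulmx1.
Qed.

Lemma sub_of_rank m N (D : 'M[F]_(m, N)) s : (s <= \rank D)%N ->
  exists2 T : 'M[F]_(s, N), row_free T & (T <= D)%MS.
Proof.
move=> sD; exists ((pid_mx s : 'M_(s, \rank D)) *m row_base D).
  rewrite /row_free mxrankMfree ?row_base_free //.
  by rewrite rank_pid_mx.
by rewrite (submx_trans (submxMl _ _)) // eq_row_base.
Qed.

End Echelon.

Section FirstRows.
Variable F : fieldType.

(** Zero rows replace the omitted ones, as in [flag_of_rel], so that all steps of a flag have the
    same type. *)
Definition frows n N r (g : 'M[F]_(n, N)) : 'M[F]_(n, N) := (pid_mx r : 'M[F]_n) *m g.

Lemma frows_full n N r (g : 'M[F]_(n, N)) : (n <= r)%N -> frows r g = g.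
Proof. by move=> nr; rewrite /frows -pid_mx_minv (minn_idPl nr) pid_mx_1 mul1mx. Qed.

Lemma frows_le n N r r' (g : 'M[F]_(n, N)) : (r <= r')%N -> (frows r g <= frows r' g)%MS.
Proof.
move=> le_r; rewrite /frows.
have -> : (pid_mx r : 'M[F]_n) = pid_mx r *m (pid_mx r' : 'M[F]_n).
  rewrite mul_pid_mx; have -> : minn n (minn r r') = minn n r by lia.
  by rewrite pid_mx_minv.
by rewrite -mulmxA submxMl.
Qed.

Lemma row_frowsE n N r (g : 'M[F]_(n, N)) (i : 'I_n) :
  row i (frows r g) = if (i < r)%N then row i g else 0.
Proof.
apply/rowP => j; rewrite !mxE (bigD1 i) //= big1 ?addr0.
  by rewrite mxE eqxx; case: ifP => _; rewrite !mxE ?mul1r ?mul0r.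
by move=> k ki; rewrite mxE; case: eqP => [/val_inj E|]; rewrite ?mul0r // E eqxx in ki *.
Qed.

Lemma row_frows n N r (g : 'M[F]_(n, N)) (i : 'I_n) : (i < r)%N -> (row i g <= frows r g)%MS.
Proof. by move=> ir; have := row_sub i (frows r g); rewrite row_frowsE ir. Qed.

Lemma frowsS n N r (g : 'M[F]_(n, N)) (ir : (r < n)%N) :
  (frows r.+1 g <= frows r g + row (Ordinal ir) g)%MS.
Proof.
apply/row_subP => i; rewrite row_frowsE ltnS; case: ltngtP => [ltir|gtir|eqir].
- by rewrite (submx_trans (row_frows _ ltir)) // addsmxSl.
- exact: sub0mx.
have -> : i = Ordinal ir by apply: val_inj.
exact: addsmxSr.
Qed.

Lemma rank_frows n N r (g : 'M[F]_(n, N)) : row_free g -> (r <= n)%N ->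
  \rank (frows r g) = r.
Proof. by move=> gf rn; rewrite mxrankMfree // rank_pid_mx. Qed.

Lemma frows_rect n N r (g : 'M[F]_(n, N)) : (r <= n)%N ->
  (frows r g :=: (pid_mx r : 'M[F]_(r, n)) *m g)%MS.
Proof.
move=> rn; apply/eqmxP/andP; split.
  have -> : frows r g = (pid_mx r : 'M_(n, r)) *m ((pid_mx r : 'M_(r, n)) *m g).
    by rewrite mulmxA pid_mx_id.
  exact: submxMl.
have -> : (pid_mx r : 'M_(r, n)) *m g = (pid_mx r : 'M_(r, n)) *m frows r g.
  by rewrite mulmxA pid_mx_id.
exact: submxMl.
Qed.

(** The echelon form of [s] common vectors, in terms of the first [s + l] rows, solves [s] of these
    rows: each is a combination of [K] corrected by the other [l] rows. The blocks [G2] and [G3]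
    stay free. *)
Lemma rel_param k s l e N (K : 'M[F]_(k, N)) (g : 'M[F]_(s + l + e, N)) :
  row_free g -> (s <= \rank (K :&: frows (s + l) g)%MS)%N ->
  exists (p : 'S_(s + l)) (S : 'M_(s, k)) (Y : 'M_(s, l)) (G2 : 'M_(l, N)) (G3 : 'M_(e, N)),
    g = col_mx (perm_mx p *m col_mx (S *m K - Y *m G2) G2) G3.
Proof.
move=> gfree /sub_of_rank[T Tfree]; rewrite sub_capmx => /andP[/submxP[S0 ES]].
rewrite frows_rect ?leq_addr // => /submxP[Z EZ].
have Zfree : row_free Z.
  rewrite -row_leq_rank; move: Tfree; rewrite -row_leq_rank => /leq_trans; apply.
  by rewrite EZ; apply: mxrankM_maxl.
have [U [Y [p [UU EU]]]] := echelon Zfree.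
set R := usubmx g; have ER : (pid_mx (s + l) : 'M_(s + l, s + l + e)) *m g = R.
  by rewrite pid_mx_row -[X in _ *m X]vsubmxK mul_row_col mul1mx mul0mx addr0.
set P := perm_mx p *m R.
exists p^-1%g, (U *m S0), Y, (dsubmx P), (dsubmx g).
have E1 : usubmx P + Y *m dsubmx P = U *m S0 *m K.
  have -> : U *m S0 *m K = row_mx 1%:M Y *m P.
    by rewrite -mulmxA -ES EZ ER !mulmxA EU.
  by rewrite -[X in _ = _ *m X]vsubmxK mul_row_col mul1mx.
rewrite -E1 addrK vsubmxK /P mulmxA -perm_mxM mulVg perm_mx1 mul1mx.
by rewrite vsubmxK.
Qed.

End FirstRows.

(** * Covers relative to a moving subspace *)

Section Fibered.
Variable F : numFieldType.

(* The [g] related to [K] lie in finitely many families with [m] parameters that depend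
   polynomially on [K]. *)
Definition fcov k n N (m : nat) (R : 'M[F]_(k, N) -> 'M[F]_(n, N) -> Prop) :=
  forall X (cX : coords F X) q (S : X -> Prop) (K : X -> 'M[F]_(k, N)), polymap K -> cov q S ->
  cov (q + m) (fun y : X * 'M[F]_(n, N) => S y.1 /\ R (K y.1) y.2).

Lemma fcov_le k n N m m' (R : 'M[F]_(k, N) -> 'M[F]_(n, N) -> Prop) :
  (m <= m')%N -> fcov m R -> fcov m' R.
Proof.
move=> le_m H X cX q S K HK HS; apply: (cov_le (k := q + m)%N); first by rewrite leq_add2l.
exact: H.
Qed.

Lemma fcov_sub k n N m (R R' : 'M[F]_(k, N) -> 'M[F]_(n, N) -> Prop) :
  (forall K g, R' K g -> R K g) -> fcov m R -> fcov m R'.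
Proof.
move=> H HR X cX q S K HK HS; apply: cov_sub (HR _ _ _ _ _ HK HS).
by move=> x [Sx /H].
Qed.

Lemma fcov_free k n N : fcov (n * N) (fun (_ : 'M[F]_(k, N)) (_ : 'M[F]_(n, N)) => True).
Proof. by move=> X cX q S K _ /(cov_free n N); apply: cov_sub => x []. Qed.

(** The three terms count the blocks of [rel_param]: coordinates in [K], corrections [Y], and the
    free rows. *)
Lemma fcov_rank k n N r s : (r <= n)%N ->
  fcov (s * k + s * (r - s) + (n - s) * N) (fun (K : 'M[F]_(k, N)) (g : 'M[F]_(n, N)) =>
    row_free g /\ (s <= \rank (K :&: frows r g)%MS)%N).
Proof.
move=> rn X cX q S K HK HS; case: (leqP s r) => [sr|rs]; last first.
  apply: cov_empty => -[x g] [_ [gf]] /=; rewrite leqNgt.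
  by rewrite (leq_ltn_trans (mxrankS (capmxSr _ _))) // rank_frows.
pose l := (r - s)%N; pose e := (n - r)%N.
have Er : r = (s + l)%N by rewrite subnKC.
have En : n = (s + l + e)%N by rewrite -Er subnKC.
have -> : ((n - s) * N = l * N + e * N)%N by rewrite -mulnDl; congr (_ * _)%N; lia.
clearbody l e; subst n r.
have H := cov_free e N (cov_free l N (cov_free s l (cov_free s k HS))).
pose psi (p : 'S_(s + l)) (x : X * 'M[F]_(s, k) * 'M[F]_(s, l) * 'M[F]_(l, N) * 'M[F]_(e, N)) :=
  (x.1.1.1.1, col_mx (perm_mx p *m col_mx (x.1.1.1.2 *m K x.1.1.1.1 - x.1.1.2 *m x.1.2) x.1.2) x.2).
have Hpsi p : polymap (psi p).
  have HK' : polymap (fun x : X * 'M[F]_(s, k) * 'M[F]_(s, l) * 'M[F]_(l, N) * 'M[F]_(e, N) => K x.1.1.1.1).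
    by apply: (polymap_comp (psi := K)) => //; pm.
  by rewrite /psi; pm.
have le_q : (q + s * k + s * l + l * N + e * N <= q + (s * k + (s * (s + l - s)) + (l * N + e * N)))%N.
  by rewrite addKn !addnA.
apply: cov_sub (cov_le le_q (cov_map Hpsi H)) => -[x g] [/= Sx [gf Hg]].
have [p [S1 [Y [G2 [G3 E]]]]] := rel_param gf Hg.
by exists p, (x, S1, Y, G2, G3); split=> //; rewrite /psi /= -E.
Qed.

Definition insert_row n N (p : 'I_n) (v : 'rV[F]_N) (g : 'M[F]_(n.-1, N)) : 'M[F]_(n, N) :=
  \matrix_(i, j) if unlift p i is Some i' then g i' j else v 0 j.

Lemma polymap_insert_row X (cX : coords F X) n N (p : 'I_n) (v : X -> 'rV[F]_N)
  (g : X -> 'M[F]_(n.-1, N)) :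
  polymap v -> polymap g -> polymap (fun x => insert_row p (v x) (g x)).
Proof.
move=> Hv Hg; apply: polymap_mx => i j; case E: (unlift p i) => [i'|].
  by apply: polyfun_ext (polymap_entry i' j Hg) => x; rewrite mxE E.
by apply: polyfun_ext (polymap_entry 0 j Hv) => x; rewrite mxE E.
Qed.

Lemma insert_rowK n N (p : 'I_n) (g : 'M[F]_(n, N)) :
  insert_row p (row p g) (row' p g) = g.
Proof.
by apply/matrixP => i j; rewrite mxE; case: unliftP => [i' ->|->]; rewrite !mxE.
Qed.

Lemma row'_free n N (p : 'I_n) (g : 'M[F]_(n, N)) : row_free g -> row_free (row' p g).
Proof.
move=> gf; rewrite -row_leq_rank.
have : (g <= row' p g + row p g)%MS.
  apply/row_subP => i; case: (unliftP p i) => [i' ->|->]; last exact: addsmxSr.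
  have -> : row (lift p i') g = row i' (row' p g) by apply/rowP => j; rewrite !mxE.
  exact: submx_trans (row_sub _ _) (addsmxSl _ _).
move=> /mxrankS; rewrite (eqP (gf : \rank g == n)) => H.
have := leq_trans H (mxrank_adds_leqif _ _); have := rank_leq_row (row p g); lia.
Qed.

Lemma frows_row' n N (p : 'I_n) r (g : 'M[F]_(n, N)) :
  (frows r (row' p g) <= frows r.+1 g)%MS.
Proof.
apply/row_subP => i; rewrite row_frowsE; case: ifP => ir; last exact: sub0mx.
have -> : row i (row' p g) = row (lift p i) g by apply/rowP => j; rewrite !mxE.
by apply: row_frows; rewrite /= /bump; case: (p <= i)%N; rewrite ?add1n ?add0n //; lia.
Qed.

(* Adds to [fcov_rank] a vector [x] of [K] in a smaller step of the flag: the row [p] of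
   [g] is solved from [x], and the remaining rows are covered by [fcov_rank]. *)
Lemma fcov_rank_vec k n N r r0 s : (r0 <= r.+1)%N -> (r.+1 <= n)%N ->
  fcov (s * k + s * (r - s) + (n.-1 - s) * N + k + r0.-1)
    (fun (K : 'M[F]_(k, N)) (g : 'M[F]_(n, N)) =>
      [/\ row_free g, (s.+1 <= \rank (K :&: frows r.+1 g)%MS)%N &
          exists x : 'rV_N, [/\ x != 0, (x <= K)%MS & (x <= frows r0 g)%MS]]).
Proof.
move=> r0r rn X cX q S K HK HS; have rn' : (r <= n.-1)%N by lia.
have H1 := fcov_rank s rn' HK HS.
have H := cov_free 1 r0.-1 (cov_free 1 k H1).
pose Z := (X * 'M[F]_(n.-1, N) * 'rV[F]_k * 'rV[F]_r0.-1)%type.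
pose psi (p : 'I_n) (x : Z) := (x.1.1.1, insert_row p
  (x.1.2 *m K x.1.1.1 - x.2 *m (pid_mx r0.-1 : 'M_(r0.-1, n.-1)) *m x.1.1.2) x.1.1.2).
have Hpsi p : polymap (psi p).
  have HK' : polymap (fun x : Z => K x.1.1.1) by apply: (polymap_comp (psi := K)) => //; pm.
  by apply: polymap_pair; first pm; apply: polymap_insert_row; pm.
have := cov_map Hpsi H; rewrite !mul1n !addnA; apply: cov_sub.
move=> -[x g] [/= Sx [gf Hg [v [v0 /submxP[u0 Eu] /submxP[w0 Ew]]]]].
pose w1 := w0 *m (pid_mx r0 : 'M_n).
have Ew1 : v = w1 *m g by rewrite Ew /w1 mulmxA.
have /rV0Pn[p w1p] : w1 != 0 by apply: contraNneq v0 => E; rewrite Ew1 E mul0mx.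
have w1E i : w1 0 i = if (i < r0)%N then w0 0 i else 0.
  rewrite mxE (bigD1 i) //= big1 ?addr0; first by rewrite mxE eqxx /=; case: ifP; rewrite ?mulr1 ?mulr0.
  by move=> j ji; rewrite mxE; case: eqP => [/val_inj E|]; rewrite ?mulr0 // E eqxx in ji *.
have pr0 : (p < r0)%N by move: w1p; rewrite w1E; case: ifP => //; rewrite eqxx.
(* Normalized to coordinate 1 at [p], the vector expresses row [p] through [K] and the other rows.
   Only [r0.-1] further coordinates can be nonzero, whence the last term of the count. *)
pose w := (w1 0 p)^-1 *: w1; pose u := (w1 0 p)^-1 *: u0.
have Ewu : w *m g = u *m K x by rewrite /w /u -!scalemxAl -Ew1 Eu.
have wp : w 0 p = 1 by rewrite mxE mulVf.
have w0E (i : 'I_n) : (r0 <= i)%N -> w 0 i = 0 by move=> ri; rewrite mxE (w1E i) ltnNge ri mulr0.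
pose w' := col' p w.
have Ew' : w' *m (pid_mx r0.-1 : 'M_(n.-1, r0.-1)) *m (pid_mx r0.-1 : 'M_(r0.-1, n.-1)) = w'.
  rewrite -mulmxA pid_mx_id //; apply/rowP => i; rewrite mxE (bigD1 i) //= big1 ?addr0.
    rewrite [pid_mx _ _ _]mxE eqxx /=; case: ltnP => [|ri]; first by rewrite mulr1.
    rewrite mulr0 [RHS]mxE w0E //= /bump; case: leqP; lia.
  by move=> j ji; rewrite [pid_mx _ _ _]mxE; case: eqP => [/val_inj E|]; rewrite ?mulr0 // E eqxx in ji *.
have Erow : row p g = u *m K x - w' *m row' p g.
  rewrite -Ewu !mulmx_sum_row (bigD1_ord p) //= wp scale1r.
  rewrite -[LHS]addr0 -addrA; congr (_ + _); apply/esym/eqP; rewrite subr_eq0; apply/eqP.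
  apply: eq_bigr => i _; rewrite [w' _ _]mxE; congr (_ *: _).
  by apply/rowP => j; rewrite !mxE.
exists p, (x, row' p g, u, w' *m (pid_mx r0.-1 : 'M_(n.-1, r0.-1))).
split; last by rewrite /psi /= Ew' -Erow insert_rowK.
split=> //=; split; first exact: row'_free.
(* The [r]-dimensional step left after deleting row [p] lies in the old step of dimension [r.+1], so
   the intersection with [K] loses at most one dimension. *)
have Hcap : (K x :&: frows r.+1 g :&: frows r (row' p g) <= K x :&: frows r (row' p g))%MS.
  by rewrite sub_capmx capmxSr (submx_trans (capmxSl _ _) (capmxSl _ _)).
apply: leq_trans (mxrankS Hcap).
have := mxrank_sum_cap (K x :&: frows r.+1 g)%MS (frows r (row' p g)).
rewrite [\rank (frows r _)]rank_frows ?row'_free //.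
have : (\rank (K x :&: frows r.+1 g + frows r (row' p g))%MS <= r.+1)%N.
  rewrite -[X in (_ <= X)%N](rank_frows gf rn) mxrankS // addsmx_sub capmxSr.
  exact: frows_row'.
lia.
Qed.

(** The standard affine charts of the Grassmannian of [a]-dimensional subspaces of the span of [R],
    one for each permutation; [C] completes [A] to that span. *)
Definition chart a b N (R : 'M[F]_(a + b, N)) (A : 'M[F]_(a, N)) (C : 'M[F]_(b, N)) :=
  exists (p : 'S_(a + b)) Y, A = row_mx 1%:M Y *m perm_mx p *m R /\
                             C = row_mx 0 1%:M *m perm_mx p *m R.

Lemma cov_chart X (cX : coords F X) q (S : X -> Prop) a b N (R : X -> 'M[F]_(a + b, N)) :
  polymap R -> cov q S ->
  cov (q + a * b) (fun y : X * 'M[F]_(a, N) * 'M[F]_(b, N) =>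
    S y.1.1 /\ chart (R y.1.1) y.1.2 y.2).
Proof.
move=> HR HS; have H := cov_free a b HS.
pose psi (p : 'S_(a + b)) (x : X * 'M[F]_(a, b)) :=
  (x.1, row_mx 1%:M x.2 *m perm_mx p *m R x.1, row_mx (0 : 'M_(b, a)) 1%:M *m perm_mx p *m R x.1).
have Hpsi p : polymap (psi p).
  have HR' : polymap (fun x : X * 'M[F]_(a, b) => R x.1) by apply: (polymap_comp (psi := R)) => //; pm.
  by rewrite /psi; pm.
apply: cov_sub (cov_map Hpsi H) => -[[x A] C] [/= Sx [p [Y [EA EC]]]].
by exists p, (x, Y); rewrite /psi /= EA EC.
Qed.

Lemma chart_exists a b m N (R : 'M[F]_(a + b, N)) (A : 'M[F]_(m, N)) :
  \rank A = a -> (A <= R)%MS ->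
  exists A' C, [/\ chart R A' C, (A' :=: A)%MS & (R <= A' + C)%MS].
Proof.
move=> rA AR; have [B Bf BA] : exists2 B : 'M_(a, N), row_free B & (B <= A)%MS.
  by apply: sub_of_rank; rewrite rA.
have EBA : (B :=: A)%MS.
  by apply/eqmxP; rewrite BA /= -(mxrank_leqif_sup BA) rA; exact: Bf.
have /submxP[Z EZ] : (B <= R)%MS by rewrite EBA.
have Zf : row_free Z.
  rewrite -row_leq_rank; move: Bf; rewrite -row_leq_rank => /leq_trans; apply.
  by rewrite EZ; apply: mxrankM_maxl.
have [U [Y [p [UU EU]]]] := echelon Zf.
exists (row_mx 1%:M Y *m perm_mx p *m R), (row_mx 0 1%:M *m perm_mx p *m R); split.
- by exists p, Y.
- rewrite -EU -mulmxA -EZ; apply: eqmx_trans EBA.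
  by apply: eqmxMfull; rewrite row_full_unit.
have RP : (R <= perm_mx p *m R)%MS.
  by rewrite -[X in (X <= _)%MS](mul1mx R) -perm_mx1 -(mulVg p) perm_mxM -mulmxA submxMl.
apply: (submx_trans RP); rewrite -!mulmxA.
rewrite -[perm_mx p *m R]vsubmxK; move: (usubmx _) (dsubmx _) => P Q.
rewrite !mul_row_col !mul1mx mul0mx add0r -addsmxE addsmx_sub addsmxSr andbT.
rewrite -[X in (X <= _)%MS](addrK (Y *m Q)); apply: addmx_sub; rewrite ?eqmx_opp.
  exact: addsmxSl.
by apply: submx_trans (submxMl _ _) (addsmxSr _ _).
Qed.

(** Points of the projective space of the span of [Q]. The coordinate normalized to 1 saves one
    parameter, and this saving makes the counts of extra vectors strict. *)
Definition monic_comb o N (Q : 'M[F]_(o, N)) (y : 'rV[F]_N) :=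
  exists (z : 'rV[F]_o) p, z 0 p = 1 /\ y = z *m Q.

Lemma cov_comb X (cX : coords F X) q (S : X -> Prop) o N (Q : X -> 'M[F]_(o, N)) :
  polymap Q -> cov q S ->
  cov (q + o.-1) (fun y : X * 'rV[F]_N => S y.1 /\ monic_comb (Q y.1) y.2).
Proof.
move=> HQ HS; have H := cov_free 1 o.-1 HS.
pose ins (p : 'I_o) (z : 'rV[F]_o.-1) : 'rV[F]_o :=
  \row_j if unlift p j is Some j' then z 0 j' else 1.
pose psi (p : 'I_o) (x : X * 'rV[F]_o.-1) := (x.1, ins p x.2 *m Q x.1).
have Hpsi p : polymap (psi p).
  have HQ' : polymap (fun x : X * 'rV[F]_o.-1 => Q x.1) by apply: (polymap_comp (psi := Q)) => //; pm.
  apply: polymap_pair; first pm; apply: polymap_mul => //.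
  apply: polymap_mx => i j; case E: (unlift p j) => [j'|].
    have Hx2 : polymap (fun x : X * 'rV[F]_o.-1 => x.2) by pm.
    by apply: polyfun_ext (polymap_entry 0 j' Hx2) => x; rewrite mxE E.
  by apply: polyfun_ext (polyfun_const 1) => x; rewrite mxE E.
have := cov_map Hpsi H; rewrite mul1n; apply: cov_sub => -[x y] [/= Sx [z [p [zp Ey]]]].
exists p, (x, col' p z); split=> //; rewrite /psi /= Ey; congr (_, _ *m _).
by apply/rowP => j; rewrite mxE; case: unliftP => [j' ->|->]; rewrite ?mxE.
Qed.

Lemma comb_exists k o N (K : 'M[F]_(k, N)) (Q : 'M[F]_(o, N)) (y : 'rV[F]_N) :
  (y <= K + Q)%MS -> ~~ (y <= K)%MS ->
  exists2 y', monic_comb Q y' & (K + y' :=: K + y)%MS /\ ~~ (y' <= K)%MS.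
Proof.
move=> /sub_addsmxP[[u z] /= Ey] yK.
have /rV0Pn[p zp] : z != 0.
  by apply: contraNneq yK => z0; rewrite Ey z0 mul0mx addr0 submxMl.
exists ((z 0 p)^-1 *: z *m Q).
  by exists ((z 0 p)^-1 *: z), p; split=> //; rewrite mxE mulVf.
have zK : (z *m Q :=: (z 0 p)^-1 *: z *m Q)%MS.
  by rewrite -scalemxAl; apply/eqmx_sym/eqmx_scale; rewrite invr_eq0.
split; last first.
  rewrite -zK; apply: contra yK => H; rewrite Ey addmx_sub ?submxMl //.
apply/eqmxP; rewrite !addsmx_sub !addsmxSl -zK /=; apply/andP; split; last first.
  by rewrite Ey addmx_sub ?(submx_trans (submxMl _ _) (addsmxSl _ _)) // zK addsmxSr.
have -> : z *m Q = y - u *m K by rewrite Ey addrAC subrr add0r.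
by rewrite addmx_sub ?addsmxSr // eqmx_opp (submx_trans (submxMl _ _) (addsmxSl _ _)).
Qed.

End Fibered.

(** * Generic non-degeneracy *)

Section GenericEvents.
Variable F : numFieldType.

(** [S] supplies [K] and the flags outside [ls]; the flags of [ls] are added one at a time, all
    related to the same [K]. *)
Lemma cov_fam k N (ls : seq nat) (m : nat -> nat)
  (R : nat -> 'M[F]_(k, N) -> 'M[F]_N -> Prop) q (S : fam F N * 'M[F]_(k, N) -> Prop) :
  uniq ls -> (forall l, l \in ls -> fcov (m l) (R l)) -> cov q S ->
  cov (q + \sum_(l <- ls) m l) (fun x : fam F N * 'M[F]_(k, N) => exists g' : fam F N,
    [/\ S (g', x.2), forall l : nat, l \notin ls -> x.1 l = g' l &
        forall l, l \in ls -> R l x.2 (x.1 l)]).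
Proof.
move=> + + HS; elim: ls => [|l ls IH] /=.
  move=> _ _; rewrite big_nil addn0; apply: cov_sub HS => -[g K] [g' /= [Sg E _]].
  have <- // : g' = g by apply: functional_extensionality => l; rewrite E.
move=> /andP[lls uls] H; have H1 := IH uls (fun l' Hl => H l' (mem_behead (s := l :: ls) Hl)).
have HK : polymap (fun x : fam F N * 'M[F]_(k, N) => x.2) by pm.
have H2 := H l (mem_head l ls) _ _ _ _ _ HK H1.
pose psi (x : fam F N * 'M[F]_(k, N) * 'M[F]_N) : fam F N * 'M[F]_(k, N) :=
  (fun l' => if l' == l then x.2 else x.1.1 l', x.1.2).
have Hpsi : polymap psi.
  apply: polymap_pair; last pm; apply: polymap_to_fam => l'; case: (l' == l); first pm.
  by apply: (polymap_fam (g := fun x : fam F N * 'M[F]_(k, N) * 'M[F]_N => x.1.1)); pm.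
rewrite big_cons addnA addnAC; apply: cov_sub (cov_map1 Hpsi H2).
move=> [g K] [g' /= [Sg E HR]].
exists (fun l' => if l' == l then g' l else g l', K, g l) => /=.
  split; last by apply: HR; rewrite mem_head.
  exists g'; split=> // l' Hl'; case: eqP => [E'|/eqP neq].
  - by rewrite E'.
  - by apply: E; rewrite in_cons negb_or neq.
  - by rewrite -E' Hl' in lls.
  by apply: HR; rewrite in_cons Hl' orbT.
rewrite /psi /=; congr (_, _); apply: functional_extensionality => l'.
by case: eqP => [->|].
Qed.

(** The common form of the exclusions below: [S] describes a configuration [K] together with the
    flags on which it depends, in [q] parameters, and each flag of [ls] then has the [m l]
    parameters left by its condition. *)
Lemma generic_event k N r (ls : seq nat) (m : nat -> nat)
  (R : nat -> 'M[F]_(k, N) -> 'M[F]_N -> Prop) q (S : fam F N * 'M[F]_(k, N) -> Prop) :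
  uniq ls -> (forall l, l \in ls -> fcov (m l) (R l)) -> cov q S ->
  (q + \sum_(l <- ls) m l < r * (N * N))%N ->
  generic (fun g : fam F N => forall g' K, S (g', K) ->
    (forall l, (l < r)%N -> l \notin ls -> g' l = g l) ->
    (forall l, l \in ls -> R l K (g l)) -> False).
Proof.
move=> uls HR HS lt_r; have H := cov_fam uls HR HS.
have P1 : polymap (fun x : fam F N * 'M[F]_(k, N) => x.1) by pm.
have := generic_cov P1 H lt_r; apply: generic_sub => g Hg g' K Sg E HRg.
apply: (Hg (fun l => if l \in ls then g l else g' l, K)) => /=.
  by exists g'; split=> // l; [move=> /negPf-> | move=> Hl; rewrite Hl; apply: HRg].
by move=> l lr; case: ifP => // /negbT Hl; apply: E.
Qed.

(** [s * w] is the expected codimension of the condition, since the second hypothesis says that [w]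
    is [N - k - r + s]. *)
Lemma fcov_defect k N r s w : (r <= N)%N -> (N + s = k + r + w)%N ->
  fcov (N * N - s * w) (fun (K : 'M[F]_(k, N)) (g : 'M[F]_N) =>
    g \in unitmx /\ (s <= \rank (K :&: frows r g)%MS)%N).
Proof.
move=> rN E; case: (leqP s r) => [sr|rs].
  apply: (fcov_sub (R := fun K g => row_free g /\ (s <= \rank (K :&: frows r g)%MS)%N)).
    by move=> K g; rewrite row_free_unit.
  apply: fcov_le (fcov_rank s rN).
  have -> : (N * N = s * N + (N - s) * N)%N by rewrite -mulnDl subnKC // (leq_trans sr).
  have -> : (s * N = s * k + s * (r - s) + s * w)%N by rewrite -!mulnDr; congr (_ * _)%N; lia.
  by lia.
move=> X cX q S K HK HS; apply: cov_empty => -[x g] [_ [/= gu]]; rewrite leqNgt.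
by rewrite (leq_ltn_trans (mxrankS (capmxSr _ _))) // rank_frows // row_free_unit.
Qed.

Lemma sum_defect (ls : seq nat) (M : nat) (x : nat -> nat) :
  (forall l, l \in ls -> x l <= M)%N ->
  (\sum_(l <- ls) (M - x l) + \sum_(l <- ls) x l = size ls * M)%N.
Proof.
move=> H; rewrite -big_split /= big_seq.
rewrite (eq_bigr (fun=> M)) => [|l Hl]; last by rewrite subnK // H.
by rewrite -big_seq big_const_seq count_predT iter_addn_0 mulnC.
Qed.

(** Here [M] is the number of parameters of a flag, [e] the number of flags already counted in [q],
    and [x l] the codimension of the condition on flag [l]. *)
Lemma sum_defect_lt (ls : seq nat) (M e q : nat) (x : nat -> nat) :
  (forall l, l \in ls -> x l <= M)%N -> (q < e * M + \sum_(l <- ls) x l)%N ->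
  (q + \sum_(l <- ls) (M - x l) < (e + size ls) * M)%N.
Proof. by move=> /sum_defect; rewrite mulnDl; lia. Qed.

(** * Dimension counts for the composed problem *)

Section Setting.
Variables (a1 a2 b1 b2 c d N r i0 i1 : nat) (ls : seq nat) (sf wf : nat -> nat).
Let a := (a1 + a2)%N.
Let b := (b1 + b2)%N.
Hypothesis HN : N = (a + b + c + d)%N.
Hypothesis Hperm : perm_eq [:: i0, i1 & ls] (iota 0 r).
Hypothesis Hs : forall l, l \in ls -> (sf l <= a)%N.
Hypothesis Hw : (\sum_(l <- ls) wf l = b)%N.
Hypothesis Hsw : (\sum_(l <- ls) sf l * wf l = a1 * b2 + a2 * b1)%N.

(** The dimension of [M_l]: the index in the Schubert condition for row [c + sf l], before a part of
    the fiber is subtracted. *)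
Definition mdim l := (b - wf l + c + d + sf l)%N.
Definition rows v (g : 'M[F]_N) : 'M[F]_(v, N) := (pid_mx v : 'M[F]_(v, N)) *m g.
Definition units (g : fam F N) := forall l, (l < r)%N -> g l \in unitmx.

Definition split_pair (g : fam F N) (A1 A2 : 'M[F]_N) :=
  [/\ \rank A1 = a1, \rank A2 = a2, (A1 <= frows (a1 + b2) (g i0))%MS &
      (A2 <= frows (a2 + b1) (g i1))%MS].

Definition meets_all (g : fam F N) (A1 A2 : 'M[F]_N) :=
  forall l, l \in ls -> (sf l <= \rank ((A1 + A2) :&: frows (mdim l) (g l))%MS)%N.

Let uall : uniq [:: i0, i1 & ls]. Proof. by rewrite (perm_uniq Hperm) iota_uniq. Qed.
Let uls : uniq ls. Proof. by case/and3P: uall. Qed.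
Let i0i1 : i0 != i1.
Proof. by move: uall => /=; rewrite in_cons negb_or => /andP[/andP[]]. Qed.
Let mem_all l : (l < r)%N = (l \in [:: i0, i1 & ls]).
Proof. by rewrite (perm_mem Hperm) mem_iota. Qed.
Let i0r : (i0 < r)%N. Proof. by rewrite mem_all !inE eqxx. Qed.
Let i1r : (i1 < r)%N. Proof. by rewrite mem_all !inE eqxx orbT. Qed.
Let lsr l : l \in ls -> (l < r)%N. Proof. by rewrite mem_all !inE => ->; rewrite !orbT. Qed.
Let size_r : r = (size ls).+2.
Proof. by have := perm_size Hperm; rewrite size_iota /= => ->. Qed.
Let notls l : (l < r)%N -> l \notin ls -> l = i0 \/ l = i1.
Proof. by rewrite mem_all !inE => /orP[/eqP->|/orP[/eqP->|->]]; auto. Qed.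
Let wfb l : l \in ls -> (wf l <= b)%N.
Proof. by move=> Hl; rewrite -Hw (big_rem l) //= leq_addr. Qed.
Let bound1 l : l \in ls -> (sf l * wf l <= N * N)%N.
Proof. by move=> Hl; apply: leq_mul; have := Hs Hl; have := wfb Hl; lia. Qed.
Let bound2 l : l \in ls -> ((sf l).+1 * wf l <= N * N)%N.
Proof.
move=> Hl; have := Hs Hl; have := wfb Hl; case: (posnP (wf l)) => [->|w0]; first by rewrite muln0.
by move=> ? ?; apply: leq_mul; lia.
Qed.
Let mdimN l : l \in ls -> (mdim l <= N)%N.
Proof. by move=> Hl; rewrite /mdim; have := Hs Hl; lia. Qed.
Let rank_defect l : l \in ls -> (N + sf l = a + mdim l + wf l)%N.
Proof. by move=> Hl; rewrite /mdim; have := wfb Hl; lia. Qed.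

(** The remaining entries can be set to 0, since [generic_event] compares families only outside its
    list of constrained flags. *)
Definition two_flags (g0 g1 : 'M[F]_N) : fam F N :=
  fun l => if l == i0 then g0 else if l == i1 then g1 else 0.

Lemma polymap_two_flags X (cX : coords F X) (g0 g1 : X -> 'M[F]_N) :
  polymap g0 -> polymap g1 -> polymap (fun x => two_flags (g0 x) (g1 x)).
Proof.
move=> H0 H1; apply: polymap_to_fam => l; rewrite /two_flags.
by case: (l == i0); [|case: (l == i1); pm].
Qed.

Let two_flagsE (g : fam F N) l : (l < r)%N -> l \notin ls ->
  two_flags (g i0) (g i1) l = g l.
Proof.
move=> lr /(notls lr)[->|->]; rewrite /two_flags eqxx //.
by rewrite eq_sym (negPf i0i1).
Qed.

Lemma rowsP v g : (v <= N)%N -> (rows v g :=: frows v g)%MS.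
Proof. by move=> vN; apply: eqmx_sym; apply: frows_rect. Qed.

(** The dimensions are complementary, so a nonzero intersection costs flag [i1] one parameter. For
    [N = 0] there is no parameter to lose, and the claim is immediate. *)
Lemma generic_V1_cap : generic (fun g : fam F N => units g ->
  \rank (frows (a1 + b2) (g i0) :&: frows (N - (a1 + b2)) (g i1))%MS = 0%N).
Proof.
case: (posnP N) => [N0|N0]; first by apply: generic_true => g _; apply/eqP; rewrite -leqn0 -N0 rank_leq_row.
have H0 := cov_free N N (cov_unit F).
pose psi (x : unit * 'M[F]_N) := (two_flags x.2 0, rows (a1 + b2) x.2).
have Hpsi : polymap psi by rewrite /psi /rows; apply: polymap_pair; [apply: polymap_two_flags|]; pm.
pose R l (K : 'M[F]_(a1 + b2, N)) (g : 'M[F]_N) := if l == i1 then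
  g \in unitmx /\ (1 <= \rank (K :&: frows (N - (a1 + b2)) g)%MS)%N else True.
have Hu : uniq (i1 :: ls) by case/andP: uall.
have HR l : l \in i1 :: ls -> fcov (N * N - (l == i1)) (R l).
  rewrite /R => _; case: eqP => _; last by rewrite subn0; apply: fcov_free.
  by rewrite -[(true : nat)]/(1 * 1)%N; apply: fcov_defect; lia.
have lt : (0 + N * N + \sum_(l <- i1 :: ls) (N * N - (l == i1)) < r * (N * N))%N.
  have N1 : (0 < N * N)%N by rewrite muln_gt0 N0.
  have -> : r = (1 + size (i1 :: ls))%N by rewrite size_r.
  apply: (@sum_defect_lt (i1 :: ls) _ 1 _ (fun l => l == i1)) => [l _|].
    exact: leq_trans (leq_b1 _) N1.
  by rewrite big_cons eqxx; lia.
have := generic_event Hu HR (cov_map1 Hpsi H0) lt; apply: generic_sub => g Hg ug; apply/eqP; rewrite -leqn0 leqNgt; apply/negP => H.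
apply: (Hg (two_flags (g i0) 0) (rows (a1 + b2) (g i0))).
- by exists (tt, g i0).
- move=> l lr; rewrite in_cons negb_or => /andP[l1 /(notls lr)[->|E]]; last by rewrite E eqxx in l1.
  by rewrite /two_flags eqxx.
move=> l _; rewrite /R; case: eqP => // ->; split; first exact: ug.
by rewrite (cap_eqmx (rowsP _ _) (eqmx_refl _)) //; lia.
Qed.

Lemma generic_V_cap l0 : l0 \in ls -> generic (fun g : fam F N => units g ->
  \rank ((frows (a1 + b2) (g i0) + frows (a2 + b1) (g i1)) :&: frows (c + d) (g l0))%MS = 0%N).
Proof.
move=> Hl0; case: (posnP N) => [N0|N0].
  by apply: generic_true => g _; apply/eqP; rewrite -leqn0 -N0 rank_leq_row.
have H0 := cov_free N N (cov_free N N (cov_unit F)).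
pose psi (x : unit * 'M[F]_N * 'M[F]_N) :=
  (two_flags x.1.2 x.2, col_mx (rows (a1 + b2) x.1.2) (rows (a2 + b1) x.2)).
have Hpsi : polymap psi by rewrite /psi /rows; apply: polymap_pair; [apply: polymap_two_flags|]; pm.
pose R l (K : 'M[F]_(a1 + b2 + (a2 + b1), N)) (g : 'M[F]_N) := if l == l0 then
  g \in unitmx /\ (1 <= \rank (K :&: frows (c + d) g)%MS)%N else True.
have HR l : l \in ls -> fcov (N * N - (l == l0)) (R l).
  rewrite /R => _; case: eqP => _; last by rewrite subn0; apply: fcov_free.
  by rewrite -[(true : nat)]/(1 * 1)%N; apply: fcov_defect; lia.
have lt : (0 + N * N + N * N + \sum_(l <- ls) (N * N - (l == l0)) < r * (N * N))%N.
  have N1 : (0 < N * N)%N by rewrite muln_gt0 N0.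
  have -> : r = (2 + size ls)%N by rewrite size_r.
  apply: (@sum_defect_lt ls _ 2 _ (fun l => l == l0)) => [l _|].
    exact: leq_trans (leq_b1 _) N1.
  by rewrite (big_rem l0) //= eqxx; lia.
have := generic_event uls HR (cov_map1 Hpsi H0) lt; apply: generic_sub => g Hg ug; apply/eqP; rewrite -leqn0 leqNgt; apply/negP => H.
apply: (Hg (two_flags (g i0) (g i1)) (col_mx (rows (a1 + b2) (g i0)) (rows (a2 + b1) (g i1)))).
- by exists (tt, g i0, g i1).
- exact: two_flagsE.
move=> l _; rewrite /R; case: eqP => // ->; split; first exact/ug/lsr.
rewrite -(cap_eqmx (addsmxE _ _) (eqmx_refl _)).
by rewrite (cap_eqmx (adds_eqmx (rowsP _ _) (rowsP _ _)) (eqmx_refl _)) //; lia.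
Qed.

Lemma split_pair_charts g A1 A2 : units g -> split_pair g A1 A2 ->
  exists A1' C1 A2' C2, [/\ chart (rows (a1 + b2) (g i0)) A1' C1 /\
      chart (rows (a2 + b1) (g i1)) A2' C2, (A1' :=: A1)%MS, (A2' :=: A2)%MS,
      (frows (a1 + b2) (g i0) <= A1' + C1)%MS & (frows (a2 + b1) (g i1) <= A2' + C2)%MS].
Proof.
move=> ug [r1 r2 s1 s2].
have E1 := @rowsP (a1 + b2) (g i0) ltac:(lia); have E2 := @rowsP (a2 + b1) (g i1) ltac:(lia).
have [|A1' [C1 [ch1 e1 R1]]] := chart_exists (R := rows (a1 + b2) (g i0)) r1; first by rewrite E1.
have [|A2' [C2 [ch2 e2 R2]]] := chart_exists (R := rows (a2 + b1) (g i1)) r2; first by rewrite E2.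
by exists A1', C1, A2', C2; split=> //; [rewrite -E1|rewrite -E2].
Qed.

(** The first two flags with a chart in each of [V1] and [V2]: [A1] and [A2] span the candidate for
    [h], and [C1], [C2] complete it to [V]. *)
Let Xh := (unit * 'M[F]_N * 'M[F]_N * 'M[F]_(a1, N) * 'M[F]_(b2, N)
           * 'M[F]_(a2, N) * 'M[F]_(b1, N))%type.
Let hg0 (x : Xh) := x.1.1.1.1.1.2.
Let hg1 (x : Xh) := x.1.1.1.1.2.
Let hA1 (x : Xh) := x.1.1.1.2.
Let hC1 (x : Xh) := x.1.1.2.
Let hA2 (x : Xh) := x.1.2.
Let hC2 (x : Xh) := x.2.
Let hK x := col_mx (hA1 x) (hA2 x).
Let Sh (x : Xh) := chart (rows (a1 + b2) (hg0 x)) (hA1 x) (hC1 x) /\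
                   chart (rows (a2 + b1) (hg1 x)) (hA2 x) (hC2 x).
Let hmk g A1 C1 A2 C2 : Xh := (tt, g i0, g i1, A1, C1, A2, C2).

Let cov_h : cov (2 * (N * N) + a1 * b2 + a2 * b1) Sh.
Proof.
have H0 := cov_free N N (cov_free N N (cov_unit F)).
have P1 : polymap (fun x : unit * 'M[F]_N * 'M[F]_N => rows (a1 + b2) x.1.2).
  by rewrite /rows; pm.
have H1 := cov_chart P1 H0.
have P2 : polymap (fun x : unit * 'M[F]_N * 'M[F]_N * 'M[F]_(a1, N) * 'M[F]_(b2, N) =>
  rows (a2 + b1) x.1.1.2) by rewrite /rows; pm.
have H2 := cov_chart P2 H1.
rewrite mul2n -addnn; apply: cov_sub H2 => -[[[[[[[] g0] g1] A1] C1] A2] C2] /= [? ?].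
by split.
Qed.

Let rel (s : nat -> nat) k l (K : 'M[F]_(k, N)) (g : 'M[F]_N) :=
  g \in unitmx /\ (s l <= \rank (K :&: frows (mdim l) g)%MS)%N.

Let fcov_rel l : l \in ls -> fcov (N * N - sf l * wf l) (@rel sf (a1 + a2) l).
Proof. by move=> Hl; apply: fcov_defect; [apply: mdimN | apply: rank_defect]. Qed.

Let fcov_relS l : l \in ls ->
  fcov (N * N - (sf l).+1 * wf l) (@rel (fun l => (sf l).+1) (a1 + a2 + 1) l).
Proof.
move=> Hl; apply: fcov_defect; first exact: mdimN.
by have := rank_defect Hl; rewrite /a; lia.
Qed.

Let pair_eqmx m1 m2 n (A1 : 'M[F]_(m1, N)) (A2 : 'M[F]_(m2, N)) (B1 B2 : 'M[F]_(n, N)) :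
  (A1 :=: B1)%MS -> (A2 :=: B2)%MS -> (col_mx A1 A2 :=: B1 + B2)%MS.
Proof. by move=> E1 E2; apply: eqmx_trans (eqmx_sym (addsmxE _ _)) (adds_eqmx E1 E2). Qed.

(** The rows of [Q] are [b] directions that may depend on the flags and charts, so [y] adds [b - 1]
    parameters, while the raised conditions cost [b] more than the conditions on the pair itself. *)
Lemma generic_no_extra (Q : Xh -> 'M[F]_(b2 + b1, N)) : polymap Q ->
  generic (fun g : fam F N => units g -> forall A1 C1 A2 C2 y,
    Sh (hmk g A1 C1 A2 C2) -> monic_comb (Q (hmk g A1 C1 A2 C2)) y ->
    (forall l, l \in ls ->
      ((sf l).+1 <= \rank (col_mx (col_mx A1 A2) y :&: frows (mdim l) (g l))%MS)%N) -> False).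
Proof.
move=> HQ; case: (posnP (b2 + b1)) => [b0|b_gt0].
  apply: generic_true => g _ A1 C1 A2 C2 y _ [z [p _]].
  by case: p => p; rewrite b0.
have H := cov_comb HQ cov_h.
pose psi (x : Xh * 'rV[F]_N) := (two_flags (hg0 x.1) (hg1 x.1), col_mx (hK x.1) x.2).
have Hpsi : polymap psi.
  by rewrite /psi /hK /hg0 /hg1 /hA1 /hA2; apply: polymap_pair; [apply: polymap_two_flags|]; pm.
have lt : (2 * (N * N) + a1 * b2 + a2 * b1 + (b2 + b1).-1 +
    \sum_(l <- ls) (N * N - (sf l).+1 * wf l) < r * (N * N))%N.
  have -> : r = (2 + size ls)%N by rewrite size_r.
  apply: (@sum_defect_lt ls _ 2 _ (fun l => (sf l).+1 * wf l)%N bound2).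
  have -> : (\sum_(l <- ls) (sf l).+1 * wf l = b + (a1 * b2 + a2 * b1))%N.
    by rewrite -Hw -Hsw -big_split /=; apply: eq_bigr => l _; rewrite mulSn.
  by rewrite /b; lia.
have := generic_event uls fcov_relS (cov_map1 Hpsi H) lt; apply: generic_sub.
move=> g Hg ug A1 C1 A2 C2 y Sx Hy HR.
apply: (Hg (two_flags (g i0) (g i1)) (col_mx (col_mx A1 A2) y)).
- by exists (hmk g A1 C1 A2 C2, y).
- exact: two_flagsE.
by move=> l Hl; split; [apply/ug/lsr | apply: HR].
Qed.

Lemma no_extra_V : generic (fun g : fam F N => units g -> forall A1 A2 (y : 'rV_N),
  split_pair g A1 A2 -> (y <= frows (a1 + b2) (g i0) + frows (a2 + b1) (g i1))%MS ->
  ~~ (y <= A1 + A2)%MS ->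
  (forall l, l \in ls -> ((sf l).+1 <= \rank ((A1 + A2 + y) :&: frows (mdim l) (g l))%MS)%N) ->
  False).
Proof.
pose Q x := col_mx (hC1 x) (hC2 x).
have HQ : polymap Q by rewrite /Q /hC1 /hC2; pm.
apply: generic_sub (generic_no_extra HQ) => g Hg ug A1 A2 y sp yV yA HR.
have [A1' [C1 [A2' [C2 [[ch1 ch2] e1 e2 R1 R2]]]]] := split_pair_charts ug sp.
have EA := pair_eqmx e1 e2.
have [||y' Hy' [Ey _]] := @comb_exists F _ _ _ (col_mx A1' A2') (col_mx C1 C2) y.
- rewrite (adds_eqmx (eqmx_sym (addsmxE A1' A2')) (eqmx_sym (addsmxE C1 C2))).
  apply: (submx_trans yV); apply: (submx_trans (addsmxS R1 R2)).
  rewrite !addsmx_sub (submx_trans (addsmxSl A1' A2') (addsmxSl _ _)).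
  rewrite (submx_trans (addsmxSr A1' A2') (addsmxSl _ _)).
  by rewrite (submx_trans (addsmxSl C1 C2) (addsmxSr _ _)) (submx_trans (addsmxSr C1 C2) (addsmxSr _ _)).
- by rewrite EA.
apply: (Hg ug A1' C1 A2' C2 y') => // l Hl.
have E : (col_mx (col_mx A1' A2') y' :=: A1 + A2 + y)%MS.
  apply: eqmx_trans (eqmx_sym (addsmxE _ _)) _; apply: (eqmx_trans Ey).
  exact: adds_eqmx EA (eqmx_refl _).
by rewrite (cap_eqmx E (eqmx_refl _)) HR.
Qed.

(* [F_{a1+b}] of the first flag is spanned by its first [a1 + b2] rows, which the chart
   splits into [A1] and [C1], and the next [b1] rows. *)
Lemma no_extra_first : generic (fun g : fam F N => units g -> forall A1 A2 (y : 'rV_N),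
  split_pair g A1 A2 -> (y <= frows (a1 + b) (g i0))%MS -> ~~ (y <= A1 + A2)%MS ->
  (forall l, l \in ls -> ((sf l).+1 <= \rank ((A1 + A2 + y) :&: frows (mdim l) (g l))%MS)%N) ->
  False).
Proof.
pose nxt (g : 'M[F]_N) : 'M[F]_(b1, N) :=
  (row_mx 0 1%:M : 'M[F]_(b1, a1 + b2 + b1)) *m rows (a1 + b2 + b1) g.
pose Q x := col_mx (hC1 x) (nxt (hg0 x)).
have HQ : polymap Q by rewrite /Q /hC1 /nxt /rows /hg0; pm.
apply: generic_sub (generic_no_extra HQ) => g Hg ug A1 A2 y sp yV yA HR.
have [A1' [C1 [A2' [C2 [[ch1 ch2] e1 e2 R1 R2]]]]] := split_pair_charts ug sp.
have EA := pair_eqmx e1 e2.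
have [||y' Hy' [Ey _]] := @comb_exists F _ _ _ (col_mx A1' A2') (col_mx C1 (nxt (g i0))) y.
- apply: (submx_trans yV); have -> : (a1 + b = a1 + b2 + b1)%N by rewrite /b; lia.
  rewrite -rowsP; last by rewrite HN /b /a; lia.
  apply: (@submx_trans _ _ _ _ _ _ (frows (a1 + b2) (g i0) + nxt (g i0))%MS).
    set P := rows _ _; have -> : P = col_mx (usubmx P) (dsubmx P) by rewrite vsubmxK.
    rewrite -addsmxE addsmxS //.
      rewrite -rowsP; last by rewrite HN /b /a; lia.
      have -> : usubmx P = rows (a1 + b2) (g i0).
        have -> : usubmx P = (row_mx 1%:M 0 : 'M_(a1 + b2, a1 + b2 + b1)) *m P.
          by rewrite -[X in _ *m X]vsubmxK mul_row_col mul1mx mul0mx addr0.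
        rewrite -pid_mx_row /P /rows mulmxA mul_pid_mx; congr (_ *m _).
        by have -> : minn (a1 + b2 + b1) (minn (a1 + b2) (a1 + b2 + b1)) = (a1 + b2)%N by lia.
      exact: submx_refl.
    by rewrite /nxt -/P -[X in (_ <= _ *m X)%MS]vsubmxK mul_row_col mul1mx mul0mx add0r.
  rewrite (adds_eqmx (eqmx_sym (addsmxE A1' A2')) (eqmx_sym (addsmxE C1 (nxt (g i0))))).
  rewrite addsmx_sub; apply/andP; split.
    apply: (submx_trans R1); rewrite addsmx_sub; apply/andP; split.
      exact: submx_trans (addsmxSl _ _) (addsmxSl _ _).
    exact: submx_trans (addsmxSl _ _) (addsmxSr _ _).
  exact: submx_trans (addsmxSr _ _) (addsmxSr _ _).
- by rewrite EA.
apply: (Hg ug A1' C1 A2' C2 y') => // l Hl.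
have E : (col_mx (col_mx A1' A2') y' :=: A1 + A2 + y)%MS.
  apply: eqmx_trans (eqmx_sym (addsmxE _ _)) _; apply: (eqmx_trans Ey).
  exact: adds_eqmx EA (eqmx_refl _).
by rewrite (cap_eqmx E (eqmx_refl _)) HR.
Qed.

(** Here [y] depends on flag [l0], which therefore joins the parameters and keeps only its cost
    [sf l0 * wf l0]. The other flags cost [b - wf l0] more, against [b - wf l0 - 1] parameters of
    [y]; this fixes the dimension of the step that can be treated. *)
Lemma no_extra_step l0 : l0 \in ls ->
  generic (fun g : fam F N => units g -> forall A1 A2 (y : 'rV_N),
  split_pair g A1 A2 -> meets_all g A1 A2 -> (y <= frows (b - wf l0) (g l0))%MS ->
  ~~ (y <= A1 + A2)%MS ->
  (forall l, l \in ls -> ((sf l).+1 <= \rank ((A1 + A2 + y) :&: frows (mdim l) (g l))%MS)%N) ->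
  False).
Proof.
move=> Hl0; case: (posnP (b - wf l0)) => [o0|o_gt0].
  apply: generic_true => g _ A1 A2 y _ _; rewrite o0 /frows pid_mx_0 mul0mx submx0 => /eqP->.
  by rewrite sub0mx.
have PK : polymap hK by rewrite /hK /hA1 /hA2; pm.
have H1 := fcov_rel Hl0 PK cov_h.
pose Q (x : Xh * 'M[F]_N) := rows (b - wf l0) x.2.
have HQ : polymap Q by rewrite /Q /rows; pm.
have H := cov_comb HQ H1.
pose psi (x : Xh * 'M[F]_N * 'rV[F]_N) : fam F N * 'M[F]_(a1 + a2 + 1, N) :=
  (fun l => if l == l0 then x.1.2 else two_flags (hg0 x.1.1) (hg1 x.1.1) l, col_mx (hK x.1.1) x.2).
have Hpsi : polymap psi.
  apply: polymap_pair; last by rewrite /hK /hA1 /hA2; pm.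
  apply: polymap_to_fam => l; case: (l == l0); first by pm.
  rewrite /two_flags; case: (l == i0); first by rewrite /hg0; pm.
  by case: (l == i1); rewrite /hg1; pm.
have ur : uniq (rem l0 ls) by apply: rem_uniq.
have rls l : l \in rem l0 ls -> l \in ls by apply: mem_rem.
have lt : (2 * (N * N) + a1 * b2 + a2 * b1 + (N * N - sf l0 * wf l0) + (b - wf l0).-1 +
    \sum_(l <- rem l0 ls) (N * N - (sf l).+1 * wf l) < r * (N * N))%N.
  have -> : r = (3 + size (rem l0 ls))%N.
    by rewrite size_rem // size_r; case: (ls) Hl0.
  apply: (@sum_defect_lt _ _ 3 _ (fun l => (sf l).+1 * wf l)%N (fun l Hl => bound2 (rls l Hl))).
  have : (\sum_(l <- ls) (sf l).+1 * wf l = b + (a1 * b2 + a2 * b1))%N.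
    by rewrite -Hw -Hsw -big_split /=; apply: eq_bigr => l _; rewrite mulSn.
  rewrite (big_rem l0) //= mulSn; have := wfb Hl0; have := bound1 Hl0; lia.
have := generic_event ur (fun l Hl => fcov_relS (rls l Hl)) (cov_map1 Hpsi H) lt.
apply: generic_sub => g Hg ug A1 A2 y sp ma yV yA HR.
have [A1' [C1 [A2' [C2 [[ch1 ch2] e1 e2 R1 R2]]]]] := split_pair_charts ug sp.
have EA := pair_eqmx e1 e2.
have oN : (b - wf l0 <= N)%N by lia.
have [||y' Hy' [Ey _]] := @comb_exists F _ _ _ (col_mx A1' A2') (rows (b - wf l0) (g l0)) y.
- by apply: (submx_trans yV); rewrite -rowsP // addsmxSr.
- by rewrite EA.
have E : (col_mx (col_mx A1' A2') y' :=: A1 + A2 + y)%MS.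
  apply: eqmx_trans (eqmx_sym (addsmxE _ _)) _; apply: (eqmx_trans Ey).
  exact: adds_eqmx EA (eqmx_refl _).
apply: (Hg (fun l => if l == l0 then g l0 else two_flags (g i0) (g i1) l)
  (col_mx (col_mx A1' A2') y')).
- exists (hmk g A1' C1 A2' C2, g l0, y') => //; split=> //; split=> //.
  by split; [apply/ug/lsr | rewrite (cap_eqmx EA (eqmx_refl _)); apply: ma].
- move=> l lr; case: eqP => [->//|/eqP ll0] lrem; apply: two_flagsE => //.
  by apply: contra lrem => Hl; rewrite mem_rem_uniq // inE ll0.
move=> l /rls Hl; split; first exact/ug/lsr.
by rewrite (cap_eqmx E (eqmx_refl _)) HR.
Qed.

(** The conditions on all [M_l] already use up the dimension of the family of pairs, and a common
    vector with this smaller step costs at least one parameter more. *)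
Lemma trivial_step l0 : l0 \in ls ->
  generic (fun g : fam F N => units g -> forall A1 A2,
  split_pair g A1 A2 -> meets_all g A1 A2 ->
  \rank ((A1 + A2) :&: frows (b - wf l0 + c + d) (g l0))%MS = 0%N).
Proof.
move=> Hl0; set o := (b - wf l0 + c + d)%N; case: (posnP o) => [o0|o_gt0].
  apply: generic_true => g _ A1 A2 _ _.
  by apply/eqP; rewrite -leqn0 (leq_trans (mxrankS (capmxSr _ _))) // o0 /frows pid_mx_0 mul0mx mxrank0.
pose R l (K : 'M[F]_(a1 + a2, N)) (g : 'M[F]_N) := rel sf l K g /\ (l = l0 ->
  exists x : 'rV_N, [/\ x != 0, (x <= K)%MS & (x <= frows o g)%MS]).
have s0 := Hs Hl0; have w0 := wfb Hl0.
have HR l : l \in ls -> fcov (N * N - (sf l * wf l + (l == l0))) (R l).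
  move=> Hl; case: eqP => [->|_]; last first.
    by rewrite addn0; apply: fcov_sub (fcov_rel Hl) => K g [].
  (* If [sf l0 = 0], the vector is the only condition, of codimension [wf l0 + 1]. Otherwise it
     refines an intersection of dimension [sf l0], and [fcov_rank_vec] loses exactly one parameter
     more than [sf l0 * wf l0]. *)
  case Es : (sf l0) => [|s].
    have D : (N + 1 = a1 + a2 + o + (wf l0).+1)%N by rewrite HN /o /a /b; lia.
    have oN : (o <= N)%N by rewrite HN /o; lia.
    apply: (@fcov_le _ _ _ _ (N * N - 1 * (wf l0).+1)); first by rewrite mul0n; lia.
    apply: fcov_sub (fcov_defect oN D) => K g [[gu _] /(_ erefl)[x [x0 xK xo]]]; split=> //.
    rewrite lt0n mxrank_eq0; apply: contraNneq x0 => cap0; rewrite -submx0 -cap0.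
    by rewrite sub_capmx xK.
  have Em : mdim l0 = (o + s).+1 by rewrite /mdim Es /o; lia.
  have le1 : (o <= (o + s).+1)%N by lia.
  have le2 : ((o + s).+1 <= N)%N by rewrite -Em; apply: mdimN.
  have := @fcov_rank_vec F (a1 + a2) _ N _ _ s le1 le2; move=> G.
  apply: (@fcov_le _ _ _ _ (s * (a1 + a2) + s * (o + s - s) + (N.-1 - s) * N + (a1 + a2) + o.-1)).
    have -> : (N * N = (s.+1) * N + (N.-1 - s) * N)%N by rewrite -mulnDl; congr (_ * _)%N; lia.
    have EN : (N = a1 + a2 + o + wf l0)%N by rewrite HN /o /a /b; lia.
    have -> : (s.+1 * N = s * (a1 + a2) + s * o + s * wf l0 + (a1 + a2) + o + wf l0)%N.
      by rewrite mulSn {1 2}EN !mulnDr; lia.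
    by rewrite addnK mulSn; lia.
  apply: fcov_sub G => K g [[gu Hr] /(_ erefl) Hx]; split=> //; first by rewrite row_free_unit.
  by rewrite -Em -Es.
have PK : polymap hK by rewrite /hK /hA1 /hA2; pm.
pose psi (x : Xh) := (two_flags (hg0 x) (hg1 x), hK x).
have Hpsi : polymap psi.
  by rewrite /psi; apply: polymap_pair => //; apply: polymap_two_flags; rewrite /hg0 /hg1; pm.
have N0 : (0 < N)%N by lia.
have lt : (2 * (N * N) + a1 * b2 + a2 * b1 +
    \sum_(l <- ls) (N * N - (sf l * wf l + (l == l0))) < r * (N * N))%N.
  have -> : r = (2 + size ls)%N by rewrite size_r.
  apply: (@sum_defect_lt ls _ 2 _ (fun l => sf l * wf l + (l == l0))%N).
    move=> l Hl; have := Hs Hl; have := wfb Hl => w1 s1.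
    have : (sf l * wf l <= a * b)%N by apply: leq_mul.
    have : (a * b < N * N)%N by rewrite HN; nia.
    by case: (_ == _); lia.
  rewrite big_split /= Hsw; have -> : (\sum_(l <- ls) (l == l0) = 1)%N; last by lia.
  rewrite (big_rem l0) //= eqxx big_seq big1 // => l; rewrite mem_rem_uniq // inE.
  by case/andP => /negPf->.
have := generic_event uls HR (cov_map1 Hpsi cov_h) lt.
apply: generic_sub => g Hg ug A1 A2 sp ma; apply/eqP; rewrite -leqn0 leqNgt lt0n mxrank_eq0.
apply/negP => cap0.
have [A1' [C1 [A2' [C2 [[ch1 ch2] e1 e2 R1 R2]]]]] := split_pair_charts ug sp.
have EA := pair_eqmx e1 e2.
have [x xc x0] := rowV0Pn cap0.
apply: (Hg (two_flags (g i0) (g i1)) (col_mx A1' A2')).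
- by exists (hmk g A1' C1 A2' C2).
- exact: two_flagsE.
move=> l Hl; split.
  by split; [apply/ug/lsr | rewrite (cap_eqmx EA (eqmx_refl _)); apply: ma].
move: xc; rewrite sub_capmx => /andP[xA xo] El; exists x; split=> //; first by rewrite EA.
by rewrite El.
Qed.

(** The order of the choices matters: flag [i1] and [A2] come first, so that meeting [A2] costs flag
    [i0] one parameter, and only then is [A1] chosen in a step of flag [i0]. *)
Lemma trivial_second : generic (fun g : fam F N => units g -> forall A1 A2,
  split_pair g A1 A2 -> meets_all g A1 A2 ->
  \rank (A2 :&: frows (N - a2) (g i0))%MS = 0%N).
Proof.
case: (posnP N) => [N0|N0].
  by apply: generic_true => g _ A1 A2 _ _; apply/eqP; rewrite -leqn0 -N0 rank_leq_row.
have H0 := cov_free N N (cov_unit F).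
have P1 : polymap (fun x : unit * 'M[F]_N => rows (a2 + b1) x.2) by rewrite /rows; pm.
have H1 := cov_chart P1 H0.
have P2 : polymap (fun x : unit * 'M[F]_N * 'M[F]_(a2, N) * 'M[F]_(b1, N) => x.1.2) by pm.
have D1 : (N - a2 <= N)%N by lia.
have D2 : (N + 1 = a2 + (N - a2) + 1)%N by lia.
have H2 := fcov_defect D1 D2 P2 H1.
pose X2 := (unit * 'M[F]_N * 'M[F]_(a2, N) * 'M[F]_(b1, N) * 'M[F]_N)%type.
have P3 : polymap (fun x : X2 => rows (a1 + b2) x.2) by rewrite /rows; pm.
have H3 := cov_chart P3 H2.
pose psi (x : X2 * 'M[F]_(a1, N) * 'M[F]_(b2, N)) :=
  (two_flags x.1.1.2 x.1.1.1.1.1.2, col_mx x.1.2 x.1.1.1.1.2).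
have Hpsi : polymap psi by apply: polymap_pair; [apply: polymap_two_flags|]; pm.
have N1 : (0 < N * N)%N by rewrite muln_gt0 N0.
have lt : (0 + N * N + a2 * b1 + (N * N - 1 * 1) + a1 * b2 +
    \sum_(l <- ls) (N * N - sf l * wf l) < r * (N * N))%N.
  have -> : r = (2 + size ls)%N by rewrite size_r.
  by apply: (@sum_defect_lt ls _ 2 _ (fun l => sf l * wf l)%N bound1); lia.
have := generic_event uls fcov_rel (cov_map1 Hpsi H3) lt.
apply: generic_sub => g Hg ug A1 A2 sp ma; apply/eqP; rewrite -leqn0 leqNgt; apply/negP => cap0.
have [A1' [C1 [A2' [C2 [[ch1 ch2] e1 e2 R1 R2]]]]] := split_pair_charts ug sp.
have EA := pair_eqmx e1 e2.
apply: (Hg (two_flags (g i0) (g i1)) (col_mx A1' A2')).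
- exists (tt, g i1, A2', C2, g i0, A1', C1) => //=; split=> //; split=> //; split; first exact: ug.
  by rewrite (cap_eqmx e2 (eqmx_refl _)).
- exact: two_flagsE.
by move=> l Hl; split; [apply/ug/lsr | rewrite (cap_eqmx EA (eqmx_refl _)); apply: ma].
Qed.

End Setting.
End GenericEvents.

(** * The fibration for nondegenerate flags *)

Section Subspaces.
Variables (F : fieldType) (N : nat).
Implicit Types A B C X : 'M[F]_N.

Definition full_flag (f : nat -> 'M[F]_N) :=
  (forall i, (i <= N)%N -> \rank (f i) = i) /\ forall i j, (i <= j)%N -> (f i <= f j)%MS.

Lemma flag_cap_step f X i j : full_flag f -> (i <= j)%N -> (j <= N)%N ->
  (\rank (X :&: f j)%MS <= \rank (X :&: f i)%MS + (j - i))%N.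
Proof.
move=> [rf mf] ij jN; have := mxrank_sum_cap (X :&: f j)%MS (f i).
have : (\rank (X :&: f j + f i)%MS <= j)%N.
  by rewrite -{2}(rf j jN) mxrankS // addsmx_sub capmxSr mf.
have : (\rank (X :&: f j :&: f i)%MS <= \rank (X :&: f i)%MS)%N.
  by rewrite mxrankS // capmxS // capmxSl.
rewrite [\rank (f i)]rf ?(leq_trans ij) //; lia.
Qed.

(** An intersection grows by at most one dimension per step, so a growth of [u] within [u] steps
    leaves no freedom in between. *)
Lemma flag_cap_interp f X r k u i : full_flag f -> (r + u <= N)%N ->
  (\rank (X :&: f r)%MS <= k)%N -> (k + u <= \rank (X :&: f (r + u)%N)%MS)%N ->
  (i <= u)%N -> \rank (X :&: f (r + i)%N)%MS = (k + i)%N.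
Proof.
move=> ff rN lo hi iu.
have H1 := @flag_cap_step f X r (r + i) ff ltac:(lia) ltac:(lia).
have H2 := @flag_cap_step f X (r + i) (r + u) ff ltac:(lia) ltac:(lia).
lia.
Qed.

Lemma rank_capmx_ge A B : (\rank A + \rank B <= N + \rank (A :&: B)%MS)%N.
Proof. by rewrite -mxrank_sum_cap leq_add2r rank_leq_col. Qed.

Lemma rank_capmx_le A B C : (A <= C)%MS -> (B <= C)%MS ->
  (\rank A + \rank B <= \rank C + \rank (A :&: B)%MS)%N.
Proof. by move=> sAC sBC; rewrite -mxrank_sum_cap leq_add2r mxrankS // addsmx_sub sAC. Qed.

Lemma eqmx_of_rank m1 m2 (A : 'M[F]_(m1, N)) (B : 'M[F]_(m2, N)) :
  (A <= B)%MS -> (\rank B <= \rank A)%N -> (A :=: B)%MS.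
Proof.
move=> AB rBA; apply/eqmxP; rewrite AB /= -(mxrank_leqif_sup AB) eqn_leq rBA.
by rewrite mxrankS.
Qed.

Lemma sub_of_rankN X s : (s <= \rank X)%N -> exists2 A : 'M[F]_N, \rank A = s & (A <= X)%MS.
Proof.
move=> /sub_of_rank[T Tf TX]; exists <<T>>%MS; rewrite genmxE //.
exact/eqP.
Qed.

Lemma rank_bigcap (I : finType) (P : pred I) (B : I -> 'M[F]_N) (w : I -> nat) :
  (forall i, P i -> (N <= \rank (B i) + w i)%N) ->
  (N <= \rank (\bigcap_(i | P i) B i)%MS + \sum_(i | P i) w i)%N.
Proof.
move=> H; apply: (big_rec2 (fun (X : 'M[F]_N) s => N <= \rank X + s)%N).
  by rewrite mxrank1 addn0.
move=> i X s Pi IH; have := rank_capmx_ge (B i) X; have := H i Pi; lia.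
Qed.

Lemma rank_add_vec A (y : 'rV[F]_N) : ~~ (y <= A)%MS -> \rank (A + y)%MS = (\rank A).+1.
Proof.
move=> yA; apply/eqP; rewrite eqn_leq; apply/andP; split.
  apply: leq_trans (mxrank_adds_leqif _ _) _.
  by have := rank_leq_row y; lia.
rewrite ltn_neqAle mxrankS ?addsmxSl // andbT.
rewrite (mxrank_leqif_sup (addsmxSl A y)) addsmx_sub submx_refl /=.
exact: yA.
Qed.

Lemma cap_modl A B C : (A <= C)%MS -> (C :&: (A + B) :=: A + (C :&: B))%MS.
Proof.
by move=> sAC; rewrite capmxC [(C :&: B)%MS]capmxC; apply/eqmx_sym/matrix_modl.
Qed.

Lemma capmxAC (X Y Z : 'M[F]_N) : (X :&: Y :&: Z = X :&: Z :&: Y)%MS.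
Proof.
by rewrite -!capmxA [(Y :&: Z)%MS]capmxC.
Qed.

End Subspaces.

(** * The bijection deduced from nondegeneracy alone *)

Section Deterministic.
Variables (F : fieldType) (a1 a2 b1 b2 c d N r : nat).
Variables (sf wf : nat -> nat) (rho : nat -> nat -> nat) (fl : nat -> nat -> 'M[F]_N).
Let a := (a1 + a2)%N.
Let b := (b1 + b2)%N.
Hypothesis HN : N = (a + b + c + d)%N.
Hypothesis r2 : (1 < r)%N.
Hypothesis Hs : forall l, (l < r)%N -> (sf l <= a)%N.
Hypothesis Hw : (\sum_(l < r | (1 < l)%N) wf l = b)%N.
Hypothesis Hrho : forall l i, (rho l i <= d)%N.
Hypothesis Hfl : forall l, (l < r)%N -> full_flag (fl l).

Let md l := (b - wf l + c + d + sf l)%N.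
(** The place where the flag induced on the fiber starts: its step [t] comes from step [off l + t].
    The number [eh l] below is the dimension in which [h] already meets these steps. *)
Definition off l := if l == 0%N then (a1 + b)%N else if l == 1%N then (a2 + b)%N else (b - wf l)%N.
Definition eh l := if l == 0%N then a1 else if l == 1%N then a2 else 0%N.

Let V1 := fl 0 (a1 + b2).
Let V2 := fl 1 (a2 + b1).
Let V := (V1 + V2)%MS.

Definition good_pair (A1 A2 : 'M[F]_N) :=
  [/\ \rank A1 = a1, \rank A2 = a2, (A1 <= V1)%MS, (A2 <= V2)%MS &
   forall l, (1 < l < r)%N -> (sf l <= \rank ((A1 + A2) :&: fl l (md l))%MS)%N].

Definition has_extra (h : 'M[F]_N) (y : 'rV[F]_N) := ~~ (y <= h)%MS /\
  forall l, (1 < l < r)%N -> ((sf l).+1 <= \rank ((h + y) :&: fl l (md l))%MS)%N.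

(** The interface between the two halves of the argument: these are the only consequences of
    genericity used in this section, the rest being linear algebra over any field. *)
Record good_flags := GoodFlags {
  good_V1 : \rank (V1 :&: fl 1 (N - (a1 + b2)))%MS = 0%N;
  good_V2 : \rank (V2 :&: fl 0 (N - (a2 + b1)))%MS = 0%N;
  good_V : forall l, (1 < l < r)%N -> \rank (V :&: fl l (c + d))%MS = 0%N;
  good_A1 : forall A1 A2, good_pair A1 A2 -> \rank (A1 :&: fl 1 (N - a1))%MS = 0%N;
  good_A2 : forall A1 A2, good_pair A1 A2 -> \rank (A2 :&: fl 0 (N - a2))%MS = 0%N;
  good_A : forall A1 A2 l, good_pair A1 A2 -> (1 < l < r)%N ->
    \rank ((A1 + A2) :&: fl l (b - wf l + c + d))%MS = 0%N;
  good_extra_V : forall A1 A2 y, good_pair A1 A2 -> has_extra (A1 + A2)%MS y -> ~~ (y <= V)%MS;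
  good_extra : forall A1 A2 y l, good_pair A1 A2 -> has_extra (A1 + A2)%MS y -> (l < r)%N ->
    ~~ (y <= fl l (off l))%MS }.

Hypothesis good : good_flags.

(** The Schubert conditions with only the corner of each rectangle kept; [base_condP] recovers the
    others. *)
Definition base_cond (h : 'M[F]_N) :=
  [/\ \rank h = a, (h <= V)%MS, (a1 <= \rank (h :&: V1)%MS)%N, (a2 <= \rank (h :&: V2)%MS)%N &
   forall l, (1 < l < r)%N -> (sf l <= \rank (h :&: fl l (md l))%MS)%N].

(** The conditions of the composition, sorted into the corners of the rectangles and the rows that
    come from the fiber; see [total_condP]. *)
Definition total_cond (H : 'M[F]_N) :=
  [/\ \rank H = (a + c)%N, (a1 <= \rank (H :&: V1)%MS)%N, (a2 <= \rank (H :&: V2)%MS)%N,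
   forall l, (1 < l < r)%N -> (sf l + c <= \rank (H :&: fl l (md l))%MS)%N &
   forall l i, (l < r)%N -> (i < c)%N ->
     (eh l + i.+1 <= \rank (H :&: fl l (off l + (d + i.+1 - rho l i)))%MS)%N].

Definition Lam (h : 'M[F]_N) := (\bigcap_(l < r | (1 < l)%N) (h + fl l (md l)))%MS.

Definition fiber_flag h l t := ((Lam h :&: fl l (off l + t)%N) + V)%MS.

Definition fiber_cond (h K : 'M[F]_N) :=
  [/\ \rank K = (a + b + c)%N, (V <= K)%MS & forall l i, (l < r)%N -> (i < c)%N ->
     (a + b + i.+1 <= \rank (K :&: fiber_flag h l (d + i.+1 - rho l i))%MS)%N].

Let r0 : (0 < r)%N. Proof. exact: ltnW. Qed.

Lemma rankV1 : \rank V1 = (a1 + b2)%N.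
Proof. by apply: (Hfl r0).1; rewrite HN /a /b; lia. Qed.
Lemma rankV2 : \rank V2 = (a2 + b1)%N.
Proof. by apply: (Hfl r2).1; rewrite HN /a /b; lia. Qed.

Lemma V1V2 : \rank (V1 :&: V2)%MS = 0%N.
Proof.
apply/eqP; rewrite -leqn0 -(good_V1 good) mxrankS // capmxS //.
by apply: (Hfl r2).2; rewrite HN /a /b; lia.
Qed.

Lemma rankV : \rank V = (a + b)%N.
Proof.
have := mxrank_sum_cap V1 V2; rewrite V1V2 addn0 rankV1 rankV2 -/V => ->.
by rewrite /a /b; lia.
Qed.

Lemma wf_le l : (1 < l < r)%N -> (wf l <= b)%N.
Proof.
case/andP=> l1 lr; rewrite -Hw (bigD1 (Ordinal lr)) //=; exact: leq_addr.
Qed.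

Lemma good_pair_rank (A1 A2 : 'M[F]_N) : \rank A1 = a1 -> \rank A2 = a2 -> (A1 <= V1)%MS -> (A2 <= V2)%MS ->
  \rank (A1 + A2)%MS = a.
Proof.
move=> e1 e2 s1 s2; have := mxrank_sum_cap A1 A2; rewrite e1 e2.
have -> : \rank (A1 :&: A2)%MS = 0%N; last by rewrite addn0.
by apply/eqP; rewrite -leqn0 -V1V2 mxrankS // capmxS.
Qed.

Lemma base_pair h : base_cond h -> exists A1 A2, good_pair A1 A2 /\ (A1 + A2 :=: h)%MS.
Proof.
move=> [rh hV /sub_of_rankN[A1 e1 s1] /sub_of_rankN[A2 e2 s2] Hl].
move: s1 s2; rewrite !sub_capmx => /andP[h1 s1] /andP[h2 s2].
have E : (A1 + A2 :=: h)%MS.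
  by apply: eqmx_of_rank; rewrite ?addsmx_sub ?h1 // good_pair_rank // rh.
exists A1, A2; split=> //; split=> // l Hlr.
by rewrite (cap_eqmx E (eqmx_refl _)) Hl.
Qed.

Lemma base_extra h y : base_cond h -> has_extra h y ->
  ~~ (y <= V)%MS /\ forall l, (l < r)%N -> ~~ (y <= fl l (off l))%MS.
Proof.
move=> /base_pair[A1 [A2 [gp E]]] [yh He].
have He' : has_extra (A1 + A2)%MS y.
  split; first by rewrite E.
  by move=> l Hl; rewrite (cap_eqmx (adds_eqmx E (eqmx_refl _)) (eqmx_refl _)) He.
by split; [apply: good_extra_V He' | move=> l lr; apply: good_extra He' lr].
Qed.

Lemma off_le l : (l < r)%N -> (off l + c + d <= N)%N.
Proof. by rewrite /off HN /a; case: eqP => _; last case: eqP => _; lia. Qed.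

(** On the first two flags the modular law splits off the summand of [h] that lies in the step, and
    nondegeneracy kills what remains of the other summand. *)
Lemma base_cap_hi h l : base_cond h -> (l < r)%N ->
  (\rank (h :&: fl l (off l + c + d)%N)%MS <= eh l)%N.
Proof.
move=> /base_pair[A1 [A2 [gp E]]] lr; rewrite -(cap_eqmx E (eqmx_refl _)).
have [e1 e2 s1 s2 _] := gp.
rewrite /off /eh; case: eqP => [->|l0].
  have -> : (a1 + b + c + d = N - a2)%N by rewrite HN /a; lia.
  have sA : (A1 <= fl 0 (N - a2))%MS.
    by apply: submx_trans s1 _; apply: (Hfl r0).2; rewrite HN /a /b; lia.
  rewrite (eqmx_sym (matrix_modl _ sA)) (leq_trans (mxrank_adds_leqif _ _)) //.
  by rewrite e1 (good_A2 good gp) addn0.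
case: eqP => [->|l1].
  have -> : (a2 + b + c + d = N - a1)%N by rewrite HN /a; lia.
  have sA : (A2 <= fl 1 (N - a1))%MS.
    by apply: submx_trans s2 _; apply: (Hfl r2).2; rewrite HN /a /b; lia.
  rewrite [(A1 + A2)%MS]addsmxC (eqmx_sym (matrix_modl _ sA)).
  by rewrite (leq_trans (mxrank_adds_leqif _ _)) // e2 (good_A1 good gp) addn0.
by rewrite leqn0; apply/eqP/(good_A good gp); lia.
Qed.

Lemma base_cap_lo h l : base_cond h -> (l < r)%N ->
  (eh l <= \rank (h :&: fl l (off l))%MS)%N.
Proof.
move=> [_ _ h1 h2 _] lr; rewrite /off /eh; case: eqP => [->|l0].
  apply: leq_trans h1 (mxrankS _); rewrite capmxS //; apply: (Hfl r0).2.
  by rewrite /b; lia.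
case: eqP => [->|//]; apply: leq_trans h2 (mxrankS _); rewrite capmxS //.
by apply: (Hfl r2).2; rewrite /b; lia.
Qed.

(** The lower bound holds at the start of the range and the upper bound at its end. This constancy
    is what lets the fiber flags grow by one at every step. *)
Lemma base_cap h l t : base_cond h -> (l < r)%N -> (t <= c + d)%N ->
  \rank (h :&: fl l (off l + t)%N)%MS = eh l.
Proof.
move=> bh lr tcd; apply/eqP; rewrite eqn_leq.
rewrite (leq_trans _ (base_cap_hi bh lr)); last first.
  by rewrite mxrankS // capmxS //; apply: (Hfl lr).2; lia.
rewrite (leq_trans (base_cap_lo bh lr)) // mxrankS // capmxS //.
by apply: (Hfl lr).2; lia.
Qed.

(** The step [sf l] places below [M_l] meets [h] trivially, which bounds the intersection with [M_l]
    from above. *)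
Lemma rank_sum_md h l : base_cond h -> (1 < l < r)%N ->
  \rank (h :&: fl l (md l))%MS = sf l /\ \rank (h + fl l (md l))%MS = (N - wf l)%N.
Proof.
move=> bh Hl; have [l1 lr] := andP Hl; have [rh _ _ _ Hm] := bh.
have mN : (md l <= N)%N by rewrite HN /md; have := Hs lr; lia.
have E : \rank (h :&: fl l (md l))%MS = sf l.
  apply/eqP; rewrite eqn_leq Hm // andbT.
  have offE : off l = (b - wf l)%N by rewrite /off !gtn_eqF // ltnW.
  have mdE : md l = (off l + c + d + sf l)%N by rewrite offE.
  have ehE : eh l = 0%N by rewrite /eh !gtn_eqF // ltnW.
  have le : (off l + c + d <= md l)%N by rewrite mdE leq_addr.
  have := flag_cap_step h (Hfl lr) le mN; have := base_cap_hi bh lr; rewrite ehE {2}mdE; lia.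
split=> //; have := mxrank_sum_cap h (fl l (md l)); rewrite E rh (Hfl lr).1 // /md.
have := wf_le Hl; lia.
Qed.

Lemma Lam_sub h l : (1 < l < r)%N -> (Lam h <= h + fl l (md l))%MS.
Proof. by case/andP=> l1 lr; apply: (bigcapmx_inf (Ordinal lr)). Qed.

Lemma base_sub_Lam h : (h <= Lam h)%MS.
Proof. by apply/sub_bigcapmxP => l _; apply: addsmxSl. Qed.

(** Adding [y] to [h] does not enlarge [h + M_l], so it must enlarge the intersection with [M_l]. *)
Lemma Lam_extra h y : base_cond h -> (y <= Lam h)%MS -> ~~ (y <= h)%MS -> has_extra h y.
Proof.
move=> bh yL yh; split=> // l Hl; have [l1 lr] := andP Hl.
have [_ rS] := rank_sum_md bh Hl.
have := mxrank_sum_cap (h + y)%MS (fl l (md l)).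
have mN : (md l <= N)%N by rewrite HN /md; have := Hs lr; lia.
have : (\rank (h + y + fl l (md l))%MS <= N - wf l)%N.
  rewrite -rS mxrankS // !addsmx_sub addsmxSl addsmxSr !andbT /=.
  exact: submx_trans yL (Lam_sub h Hl).
rewrite rank_add_vec // (Hfl lr).1 //; have [-> _ _ _ _] := bh.
have := wf_le Hl; rewrite /md; lia.
Qed.

Lemma Lam_cap_V h : base_cond h -> (Lam h :&: V :=: h)%MS.
Proof.
move=> bh; have [_ hV _ _ _] := bh; apply/eqmxP/andP; split; last first.
  by rewrite sub_capmx base_sub_Lam.
apply: contraT => /row_subPn[i]; set y := row i _ => yh.
have : (y <= Lam h :&: V)%MS by apply: row_sub.
rewrite sub_capmx => /andP[yL yV].
by have [/negP[]] := base_extra bh (Lam_extra bh yL yh).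
Qed.

(** The codimension of [Lam h] is at most the sum [b] of the [wf l]. As [Lam h] meets [V] only in
    [h], its dimension cannot exceed [a + c + d] either, and equality makes [Lam h + V] the whole
    space. *)
Lemma rank_Lam h : base_cond h -> \rank (Lam h) = (a + c + d)%N /\ \rank (Lam h + V)%MS = N.
Proof.
move=> bh; have [rh _ _ _ _] := bh.
have : (N <= \rank (Lam h) + \sum_(l < r | (1 < l)%N) wf l)%N.
  apply: rank_bigcap => l l1; have Hl : (1 < l < r)%N by rewrite l1 ltn_ord.
  by rewrite (rank_sum_md bh Hl).2; have := wf_le Hl; lia.
rewrite Hw; have := mxrank_sum_cap (Lam h) V; rewrite (Lam_cap_V bh) rh rankV.
have := rank_leq_col (Lam h + V)%MS; have := HN; lia.
Qed.

Lemma Lam_cap h l t : base_cond h -> (l < r)%N -> (t <= c + d)%N ->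
  \rank (Lam h :&: fl l (off l + t)%N)%MS = (eh l + t)%N.
Proof.
move=> bh lr tcd; have [rL _] := rank_Lam bh.
apply: (flag_cap_interp (u := (c + d)%N) (Hfl lr)) => //.
- by have := off_le lr; lia.
(* If the intersection were larger than that of [h], it would contain an extra vector in the step
   [off l]. *)
- rewrite leqNgt; apply/negP => Hlt.
  have : ~~ (Lam h :&: fl l (off l) <= h)%MS.
    apply/negP => sub; have := leq_trans Hlt (mxrankS (_ : _ <= h :&: fl l (off l + 0)%N)%MS).
    by rewrite base_cap // ltnn addn0 sub_capmx sub capmxSr => /(_ isT).
  case/row_subPn => i; set y := row i _ => yh.
  have : (y <= Lam h :&: fl l (off l))%MS by apply: row_sub.
  rewrite sub_capmx => /andP[yL yV].
  by have [_ /(_ l lr) /negP[]] := base_extra bh (Lam_extra bh yL yh).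
have oN := off_le lr.
have -> : (off l + (c + d) = off l + c + d)%N by rewrite addnA.
case: (ltnP 1 l) => l1; last first.
  have := rank_capmx_ge (Lam h) (fl l (off l + c + d)); rewrite (Hfl lr).1 // rL.
  have := HN; rewrite /off /eh /a; case: l l1 {lr oN} => [|[|//]] _ /=; lia.
have Hl : (1 < l < r)%N by rewrite l1.
have [_ rS] := rank_sum_md bh Hl.
have offE : off l = (b - wf l)%N by rewrite /off !gtn_eqF // ltnW.
have le : (off l + c + d <= md l)%N by rewrite offE leq_addr.
(* Both [Lam h] and the step lie in [h + M_l]; counting there instead of in the whole space gains
   the [wf l] dimensions that would be missing. *)
have := rank_capmx_le (Lam_sub h Hl) (submx_trans ((Hfl lr).2 _ _ le) (addsmxSr h _)).
rewrite rS rL (Hfl lr).1 // /eh !gtn_eqF ?(ltnW l1) // => H.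
have := wf_le Hl; move: H; rewrite offE; have := HN; lia.
Qed.

Lemma fiber_flag_rank h l t : base_cond h -> (l < r)%N -> (t <= c + d)%N ->
  \rank (fiber_flag h l t) = (a + b + t)%N.
Proof.
move=> bh lr tcd; have := mxrank_sum_cap (Lam h :&: fl l (off l + t)%N)%MS V.
rewrite Lam_cap // rankV -/(fiber_flag h l t).
have -> : \rank (Lam h :&: fl l (off l + t)%N :&: V)%MS = eh l; last by lia.
rewrite -(base_cap bh lr tcd) -(cap_eqmx (Lam_cap_V bh) (eqmx_refl (fl l (off l + t)%N))).
by rewrite capmxAC.
Qed.

Lemma fiber_index l i : (i < c)%N -> (d + i.+1 - rho l i <= c + d)%N.
Proof. lia. Qed.

Lemma total_base H : total_cond H -> base_cond (H :&: V)%MS.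
Proof.
move=> [rH /sub_of_rankN[A1 e1] + /sub_of_rankN[A2 e2] + Hm _].
rewrite !sub_capmx => /andP[h1 s1] /andP[h2 s2].
have rA := good_pair_rank e1 e2 s1 s2.
(* A subspace of codimension [c - k] in [H] loses at most that many dimensions of the intersection
   with [M_l]. It serves for [A1 + A2] with [k = 0], and with [k = 1] after a vector is added. *)
have meet (X : 'M[F]_N) k l : (X <= H)%MS -> \rank X = (a + k)%N -> (1 < l < r)%N ->
    (sf l + k <= \rank (X :&: fl l (md l))%MS)%N.
  move=> XH rX Hl; have := rank_capmx_le XH (capmxSl H (fl l (md l))).
  rewrite rX rH; have := Hm l Hl.
  have : (\rank (X :&: (H :&: fl l (md l)))%MS <= \rank (X :&: fl l (md l))%MS)%N.
    by rewrite mxrankS // capmxS // capmxSr.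
  lia.
have AH : (A1 + A2 <= H)%MS by rewrite addsmx_sub h1.
have AHV : (A1 + A2 <= H :&: V)%MS by rewrite sub_capmx AH addsmxS.
have gp : good_pair A1 A2.
  by split=> // l Hl; have := @meet _ 0%N l AH; rewrite !addn0; apply.
have E : (A1 + A2 :=: H :&: V)%MS.
  apply/eqmxP/andP; split=> //; apply: contraT => /row_subPn[i]; set y := row i _ => yA.
  have : (y <= H :&: V)%MS by apply: row_sub.
  rewrite sub_capmx => /andP[yH yV].
  suff ex : has_extra (A1 + A2)%MS y by have /negP[] := good_extra_V good gp ex.
  split=> // l Hl; rewrite -addn1; apply: meet => //; first by rewrite addsmx_sub AH.
  by rewrite rank_add_vec // rA addn1.
split.
- by rewrite -E.
- exact: capmxSr.
- by rewrite -e1 mxrankS // sub_capmx s1 (submx_trans (addsmxSl _ _) AHV).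
- by rewrite -e2 mxrankS // sub_capmx s2 (submx_trans (addsmxSr _ _) AHV).
by have [_ _ _ _ Hp] := gp; move=> l Hl; rewrite -(cap_eqmx E (eqmx_refl _)) Hp.
Qed.

(** [H] meets [M_l] in at least [c] dimensions more than [h] does, and [c] is the difference of
    their dimensions; hence [H + M_l] is no larger than [h + M_l]. *)
Lemma total_sub_Lam (H h : 'M[F]_N) : total_cond H -> base_cond h -> (h <= H)%MS -> (H <= Lam h)%MS.
Proof.
move=> [rH _ _ Hm _] bh hH; apply/sub_bigcapmxP => l l1.
have Hl : (1 < l < r)%N by rewrite l1 ltn_ord.
have mN : (md l <= N)%N by rewrite HN /md; have := Hs (ltn_ord l); lia.
have E : (h + fl l (md l) :=: H + fl l (md l))%MS.
  apply: eqmx_of_rank; first by rewrite addsmxS.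
  rewrite (rank_sum_md bh Hl).2; have := mxrank_sum_cap H (fl l (md l)).
  rewrite rH (Hfl (ltn_ord l)).1 //; have := Hm l Hl; have := wf_le Hl.
  by rewrite /md; have := HN; lia.
by rewrite E addsmxSl.
Qed.

Lemma rank_cap_add_V (H h : 'M[F]_N) l t : base_cond h -> (H :&: V :=: h)%MS -> (l < r)%N -> (t <= c + d)%N ->
  \rank ((H :&: fl l (off l + t)%N) + V)%MS =
    (\rank (H :&: fl l (off l + t)%N)%MS + (a + b) - eh l)%N.
Proof.
move=> bh E lr tcd; have := mxrank_sum_cap (H :&: fl l (off l + t)%N)%MS V.
by rewrite rankV capmxAC (cap_eqmx E (eqmx_refl _)) base_cap // => <-; rewrite addnK.
Qed.

Lemma total_fiber (H h : 'M[F]_N) : total_cond H -> base_cond h -> (H :&: V :=: h)%MS ->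
  fiber_cond h (H + V)%MS.
Proof.
move=> tH bh E; have [rH _ _ _ Hi] := tH.
have hH : (h <= H)%MS by rewrite -E capmxSl.
have HL := total_sub_Lam tH bh hH.
split; [|exact: addsmxSr|].
  by have := mxrank_sum_cap H V; rewrite E rankV rH; have [-> _ _ _ _] := bh; lia.
move=> l i lr ic; have tcd := fiber_index l ic.
set t := (d + _ - _)%N in tcd *.
have S : ((H :&: fl l (off l + t)%N) + V <= (H + V) :&: fiber_flag h l t)%MS.
  by rewrite sub_capmx !addsmxS // ?capmxSl // capmxS.
apply: leq_trans (mxrankS S); rewrite (rank_cap_add_V bh E lr tcd).
have := Hi l i lr ic; rewrite -/t; lia.
Qed.

Lemma total_inj (H1 H2 : 'M[F]_N) : total_cond H1 -> total_cond H2 ->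
  (H1 :&: V == H2 :&: V)%MS -> (H1 + V == H2 + V)%MS -> (H1 == H2)%MS.
Proof.
suff main (X Y : 'M[F]_N) : total_cond X -> total_cond Y -> (X :&: V :=: Y :&: V)%MS ->
    (X + V :=: Y + V)%MS -> (X <= Y)%MS.
  by move=> t1 t2 /eqmxP E1 /eqmxP E2; rewrite !main //; apply: eqmx_sym.
move=> tX tY E1 E2; have bY := total_base tY.
have YL := total_sub_Lam tY bY (capmxSl _ _).
have XL : (X <= Lam (Y :&: V)%MS)%MS by apply: total_sub_Lam => //; rewrite -E1 capmxSl.
(* By the modular law this intersection is [Y] plus the intersection of [Lam] with [V], which is
   contained in [Y]. *)
have : (X <= Lam (Y :&: V)%MS :&: (Y + V))%MS by rewrite sub_capmx XL -E2 addsmxSl.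
rewrite (cap_modl _ YL) => /submx_trans; apply.
by rewrite addsmx_sub submx_refl (Lam_cap_V bY) capmxSl.
Qed.

Lemma total_exists h K : base_cond h -> fiber_cond h K ->
  exists H, [/\ total_cond H, (H :&: V == h)%MS & (H + V == K)%MS].
Proof.
move=> bh [rK VK HK]; have [rL rLV] := rank_Lam bh; have [rh hV h1 h2 _] := bh.
have LV : (1%:M <= Lam h + V)%MS by rewrite sub1mx /row_full rLV.
pose H := (Lam h :&: K)%MS.
have EV : (H :&: V :=: h)%MS.
  rewrite /H capmxAC; apply: (eqmx_trans _ (Lam_cap_V bh)).
  by apply/capmx_idPl; apply: submx_trans (capmxSr _ _) VK.
have EK : (H + V :=: K)%MS.
  rewrite /H addsmxC capmxC.
  apply: eqmx_trans (eqmx_sym (cap_modl _ VK)) _.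
  apply/eqmxP; rewrite capmxSl sub_capmx submx_refl /= addsmxC.
  exact: submx_trans (submx1 _) LV.
have rH : \rank H = (a + c)%N.
  have := mxrank_sum_cap H V; rewrite EV EK rK rh rankV; lia.
have hH : (h <= H)%MS by rewrite -EV capmxSl.
exists H; split; [|exact/eqmxP|exact/eqmxP].
split=> //.
- by apply: leq_trans h1 (mxrankS _); rewrite capmxS.
- by apply: leq_trans h2 (mxrankS _); rewrite capmxS.
- move=> l Hl; have [l1 lr] := andP Hl.
  have mN : (md l <= N)%N by rewrite HN /md; have := Hs lr; lia.
  have := rank_capmx_le (submx_trans (capmxSl _ _ : (H <= _)%MS) (Lam_sub h Hl)) (addsmxSr h (fl l (md l))).
  rewrite (rank_sum_md bh Hl).2 rH (Hfl lr).1 //; have := wf_le Hl; rewrite /md; have := HN; lia.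
move=> l i lr ic; have tcd := fiber_index l ic; have := HK l i lr ic.
set t := (d + _ - _)%N in tcd *.
have E : (K :&: fiber_flag h l t :=: (H :&: fl l (off l + t)%N) + V)%MS.
  rewrite /fiber_flag addsmxC; apply: eqmx_trans (cap_modl _ VK) _.
  by rewrite addsmxC capmxC capmxAC; apply: eqmx_refl.
rewrite E (rank_cap_add_V bh EV lr tcd).
have : (eh l <= \rank (H :&: fl l (off l + t)%N)%MS)%N.
  by rewrite -(base_cap bh lr tcd) mxrankS // capmxS.
lia.
Qed.

(** The trace of a flag on [V]. As [V1] lies in [V], the first flag traces its own steps up to [V1],
    then nothing new for [c + d] steps; the second behaves alike with [V2]. The other flags meet [V]
    trivially for their first [c + d] steps. *)
Definition base_flag l i := if (l == 0%N) && (i <= a1 + b2)%N || (l == 1%N) && (i <= a2 + b1)%N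
  then fl l i else (fl l (i + c + d)%N :&: V)%MS.

Lemma rank_cap_full (X : 'M[F]_N) l : (l < r)%N -> (X :&: fl l N :=: X)%MS.
Proof.
move=> lr; apply/capmx_idPl; apply: submx_trans (submx1 _) _.
by rewrite sub1mx /row_full (Hfl lr).1.
Qed.

Lemma rank_V_cap l k u i : (l < r)%N -> (\rank (V :&: fl l (k + c + d)%N)%MS <= k)%N ->
  (k + u = a + b)%N -> (k <= i <= k + u)%N -> \rank (fl l (i + c + d)%N :&: V)%MS = i.
Proof.
move=> lr Hk Eku /andP[ki iku]; rewrite capmxC.
have -> : (i + c + d = k + c + d + (i - k))%N by lia.
rewrite (flag_cap_interp (u := u) (k := k) (Hfl lr)) //; first by lia.
- by have := HN; lia.
- have -> : (k + c + d + u = N)%N by have := HN; lia.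
  by rewrite (rank_cap_full _ lr) rankV Eku.
by lia.
Qed.

Lemma base_flag_rank l i : (l < r)%N -> (i <= a + b)%N -> \rank (base_flag l i) = i.
Proof.
move=> lr iab; have iN : (i <= N)%N by have := HN; lia.
rewrite /base_flag; case: ifP => [_|]; first by rewrite (Hfl lr).1.
case: (ltngtP l 1) => [l0|l1|l1]; last first.
- subst l; rewrite /= => /negbT; rewrite -ltnNge => iv.
  apply: (@rank_V_cap _ (a2 + b1) (a1 + b2)) => //; try by rewrite /a /b; lia.
  have -> : (a2 + b1 + c + d = N - (a1 + b2))%N by have := HN; rewrite /a /b; lia.
  have sV : (V2 <= fl 1 (N - (a1 + b2)))%MS.
    by apply: (Hfl r2).2; have := HN; rewrite /a /b; lia.
  rewrite /V addsmxC (eqmx_sym (matrix_modl _ sV)) (leq_trans (mxrank_adds_leqif _ _)) //.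
  by rewrite rankV2 (good_V1 good) addn0.
- move=> _; apply: (@rank_V_cap _ 0 (a + b)) => //.
  by rewrite add0n (good_V good) // l1.
have {l0}E : l = 0%N by lia.
subst l; rewrite /= orbF => /negbT; rewrite -ltnNge => iv.
apply: (@rank_V_cap _ (a1 + b2) (a2 + b1)) => //; try by rewrite /a /b; lia.
have -> : (a1 + b2 + c + d = N - (a2 + b1))%N by have := HN; rewrite /a /b; lia.
have sV : (V1 <= fl 0 (N - (a2 + b1)))%MS.
  by apply: (Hfl r0).2; have := HN; rewrite /a /b; lia.
rewrite /V (eqmx_sym (matrix_modl _ sV)) (leq_trans (mxrank_adds_leqif _ _)) //.
by rewrite rankV1 (good_V2 good) addn0.
Qed.

Lemma base_flag_sub l i : (base_flag l i <= V)%MS.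
Proof.
rewrite /base_flag; case: ifP => [|_]; last exact: capmxSr.
case/orP => /andP[/eqP-> iv].
  by apply: submx_trans (addsmxSl _ _); apply: (Hfl r0).2.
by apply: submx_trans (addsmxSr _ _); apply: (Hfl r2).2.
Qed.

Lemma base_flag_is_flag l : (l < r)%N -> is_flag 0 V (base_flag l).
Proof.
move=> lr; rewrite /is_flag mxrank0 subn0 rankV; apply/andP; split.
  apply/forallP => j; rewrite sub0mx base_flag_sub add0n /=.
  by rewrite base_flag_rank // -ltnS.
apply/forallP => j; rewrite /base_flag; case: ifP => H1; case: ifP => H2.
- by apply: (Hfl lr).2.
- rewrite sub_capmx (Hfl lr).2 /=; last by lia.
  by have := base_flag_sub l j; rewrite /base_flag H1.
- by move: H1 H2; case: eqP; case: eqP => /=; lia.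
by rewrite capmxS // (Hfl lr).2 //; lia.
Qed.

(** * Schubert conditions as rank conditions *)

Definition lam_s l := if l == 0%N then a1 else if l == 1%N then a2 else sf l.
Definition lam_w l := if l == 0%N then b1 else if l == 1%N then b2 else wf l.
Definition key_dim l :=
  if l == 0%N then (a1 + b2)%N else if l == 1%N then (a2 + b1)%N else md l.

Lemma lam_sE l : (l < r)%N -> (lam_s l <= a)%N.
Proof. by rewrite /lam_s /a => lr; case: eqP => _; [|case: eqP => _]; try lia; apply: Hs. Qed.

Lemma key_dim_le l : (l < r)%N -> (key_dim l <= N)%N.
Proof.
have := HN; rewrite /key_dim /a /b => E lr; case: eqP => _; [|case: eqP => _]; try lia.
by rewrite /md; have := Hs lr; rewrite /a /b; lia.
Qed.

Lemma base_flag_key (h : 'M[F]_N) l j : (l < r)%N -> (h <= V)%MS -> (j <= lam_s l)%N ->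
  (h :&: base_flag l (b + j - lam_w l)%N :=: h :&: fl l (key_dim l - (lam_s l - j))%N)%MS.
Proof.
move=> lr hV; rewrite /base_flag /lam_s /lam_w /key_dim.
case: (ltngtP l 1) => [l0|l1|->] /=.
- have -> : l = 0%N by lia.
  rewrite /= orbF /b => ja; have -> : (b1 + b2 + j - b1 <= a1 + b2)%N by lia.
  have -> // : (b1 + b2 + j - b1 = a1 + b2 - (a1 - j))%N by lia.
- have -> : (l == 0%N) = false by lia.
  move=> /= js; have Hl : (1 < l < r)%N by rewrite l1.
  have -> : (b + j - wf l + c + d = md l - (sf l - j))%N.
    by rewrite /md; have := wf_le Hl; lia.
  rewrite capmxA capmxAC; apply: cap_eqmx (eqmx_refl _); exact/capmx_idPl.
rewrite /b => ja; have -> : (b1 + b2 + j - b2 <= a2 + b1)%N by lia.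
have -> // : (b1 + b2 + j - b2 = a2 + b1 - (a2 - j))%N by lia.
Qed.

(** Rows before the corner of a rectangle follow from the corner, because one step changes an
    intersection by at most one; rows after it hold by dimension. Flags from [nl] on belong to the
    fiber only, and there [sf l = 0] makes the condition trivial. *)
Lemma base_condP nl (h : 'M[F]_N) : (1 < nl <= r)%N -> (forall l, (nl <= l)%N -> sf l = 0%N) ->
  \rank h = a -> (h <= V)%MS ->
  (forall l i, (l < nl)%N -> (i < a)%N -> (i.+1 <= \rank (h :&:
     base_flag l (b + i.+1 - (if (i < lam_s l)%N then lam_w l else 0))%N)%MS)%N) <-> base_cond h.
Proof.
move=> /andP[nl1 nlr] Hsf rh hV.
have key l : (l < r)%N ->
    (\rank (h :&: base_flag l (b + lam_s l - lam_w l)%N)%MS = \rank (h :&: fl l (key_dim l))%MS)%N.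
  by move=> lr; rewrite (base_flag_key lr hV (leqnn _)) subnn subn0.
split=> [H|bh l i lnl ia].
  have K l : (l < nl)%N -> (lam_s l <= \rank (h :&: fl l (key_dim l))%MS)%N.
    move=> lnl; have lr := leq_trans lnl nlr; case E: (lam_s l) => [//|i]; rewrite -key // E.
    have := H l i lnl; rewrite E ltnSn; apply.
    by have := lam_sE lr; rewrite E.
  split=> //; [exact: (K 0%N (ltnW nl1))|exact: (K 1%N nl1)|].
  move=> l /andP[l1 lr]; case: (ltnP l nl) => lnl; last by rewrite Hsf.
  by have := K l lnl; rewrite /lam_s /key_dim !gtn_eqF // ltnW.
have lr := leq_trans lnl nlr.
case: (ltnP i (lam_s l)) => [il|il]; last first.
  have sub : (h <= V)%MS by [].
  have iab : (b + i.+1 <= a + b)%N by lia.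
  rewrite subn0; have := rank_capmx_le sub (base_flag_sub l (b + i.+1)).
  by rewrite rh rankV base_flag_rank //; lia.
rewrite (base_flag_key lr hV il).
have K : (lam_s l <= \rank (h :&: fl l (key_dim l))%MS)%N.
  have [_ _ h1 h2 h3] := bh; rewrite /lam_s /key_dim; case: eqP => [->//|l0]; case: eqP => [->//|l1].
  by apply: h3; lia.
have := flag_cap_step h (Hfl lr) (leq_subr (lam_s l - i.+1) (key_dim l)) (key_dim_le lr).
lia.
Qed.

(** Part [i], counted from 0, of partition [l] of the composition; see [nth_kappa]. *)
Definition kap l i := if l == 0%N then (if (i < a1)%N then (b1 + d)%N else rho 0 (i - a1))
  else if l == 1%N then (if (i < a2)%N then (b2 + d)%N else rho 1 (i - a2))
  else ((if (i < c + sf l)%N then wf l else 0) + rho l i)%N.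

Lemma cap_codim (H : 'M[F]_N) l k j : (l < r)%N -> \rank H = k -> (j <= N)%N ->
  (k + j - N <= \rank (H :&: fl l j)%MS)%N.
Proof. by move=> lr <- jN; have := rank_capmx_ge H (fl l j); rewrite (Hfl lr).1 //; lia. Qed.

(** A rectangle contributes only its corner, the rows of the fiber give the shifted conditions, and
    a row whose part is 0 holds by codimension. *)
Lemma total_condP (H : 'M[F]_N) : (forall l i, (c <= i)%N -> rho l i = 0%N) ->
  \rank H = (a + c)%N ->
  (forall l i, (l < r)%N -> (i < a + c)%N ->
     (i.+1 <= \rank (H :&: fl l (b + d + i.+1 - kap l i)%N)%MS)%N) <-> total_cond H.
Proof.
move=> Hrc rH; have EN := HN; split=> [HH|[_ h1 h2 hm hi] l i lr iac].
  split=> //.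
  - case E: (a1) => [//|e].
    have := HH 0%N e r0 ltac:(rewrite /a; lia); rewrite /kap /= E ltnSn.
    by have -> : (b + d + e.+1 - (b1 + d) = a1 + b2)%N by rewrite /b E; lia.
  - case E: (a2) => [//|e].
    have := HH 1%N e r2 ltac:(rewrite /a; lia); rewrite /kap /= E ltnSn.
    by have -> : (b + d + e.+1 - (b2 + d) = a2 + b1)%N by rewrite /b E; lia.
  - move=> l Hl; have [l1 lr] := andP Hl; case E: (sf l + c)%N => [//|e].
    have e_ac : (e < a + c)%N by have := Hs lr; lia.
    have := HH l e lr e_ac; rewrite /kap !gtn_eqF ?(ltnW l1) // => /leq_trans; apply.
    (* For [sf l = 0] the row [e] also carries a part of the fiber; the condition then concerns a
       smaller step and is only stronger. *)
    rewrite mxrankS // capmxS //; apply: (Hfl lr).2; rewrite addnC in E.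
    by rewrite E ltnSn /md; have := wf_le Hl; lia.
  move=> l i lr ic; rewrite /eh /off; case: eqP => [->|l0].
    have := HH 0%N (a1 + i)%N r0 ltac:(rewrite /a; lia).
    rewrite /kap /= [(a1 + i < a1)%N]ltnNge leq_addr /= addKn.
    have -> : (b + d + (a1 + i).+1 - rho 0 i = a1 + b + (d + i.+1 - rho 0 i))%N.
      by have := Hrho 0 i; lia.
    by rewrite [(a1 + i.+1)%N]addnS.
  case: eqP => [->|l1].
    have := HH 1%N (a2 + i)%N r2 ltac:(rewrite /a; lia).
    rewrite /kap /= [(a2 + i < a2)%N]ltnNge leq_addr /= addKn.
    have -> : (b + d + (a2 + i).+1 - rho 1 i = a2 + b + (d + i.+1 - rho 1 i))%N.
      by have := Hrho 1 i; lia.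
    by rewrite [(a2 + i.+1)%N]addnS.
  have Hl : (1 < l < r)%N by lia.
  have iac : (i < a + c)%N by lia.
  have := HH l i lr iac; rewrite /kap; do 2 (case: eqP => [//|_]).
  have -> : (i < c + sf l)%N by lia.
  have -> // : (b + d + i.+1 - (wf l + rho l i) = b - wf l + (d + i.+1 - rho l i))%N.
  by have := Hrho l i; have := wf_le Hl; lia.
have tail : (i.+1 <= \rank (H :&: fl l (b + d + i.+1)%N)%MS)%N.
  by apply: leq_trans (cap_codim lr rH _); [lia|have := HN; lia].
rewrite /kap; case: eqP => [E|l0].
  subst l; case: (ltnP i a1) => [ia|ia].
    have le : (b + d + i.+1 - (b1 + d) <= a1 + b2)%N by rewrite /b; lia.
    have := flag_cap_step H (Hfl lr) le ltac:(have := HN; rewrite /a /b; lia).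
    rewrite /b -/V1; lia.
  case: (ltnP (i - a1) c) => ic; last by rewrite Hrc // subn0.
  have := hi 0%N (i - a1)%N lr ic; rewrite /eh /off /=.
  have -> : (a1 + b + (d + (i - a1).+1 - rho 0 (i - a1)) = b + d + i.+1 - rho 0 (i - a1))%N.
    by have := Hrho 0 (i - a1); lia.
  by have -> : (a1 + (i - a1).+1 = i.+1)%N by lia.
case: eqP => [E|l1].
  subst l; case: (ltnP i a2) => [ia|ia].
    have le : (b + d + i.+1 - (b2 + d) <= a2 + b1)%N by rewrite /b; lia.
    have := flag_cap_step H (Hfl lr) le ltac:(have := HN; rewrite /a /b; lia).
    rewrite /b -/V2; lia.
  case: (ltnP (i - a2) c) => ic; last by rewrite Hrc // subn0.
  have := hi 1%N (i - a2)%N lr ic; rewrite /eh /off /=.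
  have -> : (a2 + b + (d + (i - a2).+1 - rho 1 (i - a2)) = b + d + i.+1 - rho 1 (i - a2))%N.
    by have := Hrho 1 (i - a2); lia.
  by have -> : (a2 + (i - a2).+1 = i.+1)%N by lia.
have Hl : (1 < l < r)%N by lia.
case: (ltnP i c) => ic.
  have -> : (i < c + sf l)%N by lia.
  have := hi l i lr ic; rewrite /eh /off; do 2 (case: eqP => [//|_]).
  have -> // : (b - wf l + (d + i.+1 - rho l i) = b + d + i.+1 - (wf l + rho l i))%N.
  by have := Hrho l i; have := wf_le Hl; lia.
rewrite Hrc // addn0; case: (ltnP i (c + sf l)) => [ics|_]; last by rewrite subn0.
have mN : (md l <= N)%N by have := HN; rewrite /md; have := Hs lr; lia.
have le : (b + d + i.+1 - wf l <= md l)%N by rewrite /md; have := wf_le Hl; lia.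
have := flag_cap_step H (Hfl lr) le mN; have := hm l Hl.
have -> : (md l - (b + d + i.+1 - wf l) = c + sf l - i.+1)%N.
  by rewrite /md; have := wf_le Hl; lia.
lia.
Qed.

Lemma fiber_flag_is_flag h l : base_cond h -> (l < r)%N -> is_flag V 1%:M (fiber_flag h l).
Proof.
move=> bh lr; rewrite /is_flag mxrank1 rankV; have -> : (N - (a + b) = c + d)%N by have := HN; lia.
apply/andP; split; apply/forallP => j.
  by rewrite addsmxSr submx1 /= fiber_flag_rank // -ltnS.
by rewrite /fiber_flag addsmxS // capmxS // (Hfl lr).2 // leq_add2l.
Qed.

End Deterministic.

(** * The partitions of the composition *)

Section Combinatorics.
Local Open Scope nat_scope.
Variables (a1 a2 b1 b2 c d : nat) (ms ns : seq nat) (alphas betas gammas : seq (seq nat)).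
Let rhos := alphas ++ betas ++ gammas.

(** The value 0 on the flags of the [gammas], matched by the default value in [col_w], lets all
    flags after the first two be treated alike. *)
Definition col_s l := if l < 2 + size ms then a2 else if l < 2 + (size ms + size ns) then a1 else 0.
Definition col_w l := nth 0 (ms ++ ns) (l - 2).
Definition rho_part l i := nth 0 (nth [::] rhos l) i.

Lemma geq_trans : transitive geq.
Proof. by move=> y x z /= xy yz; apply: leq_trans yz xy. Qed.

Lemma pconc_sorted s t : sorted geq s -> sorted geq t -> allrel geq s t -> pconc s t = s ++ t.
Proof.
move=> ss st st'; apply: sorted_sort; first exact: geq_trans.
by rewrite (sorted_pairwise geq_trans) pairwise_cat st' -!(sorted_pairwise geq_trans) ss.
Qed.

Lemma sorted_nseq n x : sorted geq (nseq n x).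
Proof.
rewrite (sorted_pairwise geq_trans); apply/(pairwiseP 0) => i j; rewrite !inE size_nseq => hi hj _.
by rewrite !nth_nseq hi hj /=.
Qed.

Lemma nth_padd s t i : nth 0 (padd s t) i = nth 0 s i + nth 0 t i.
Proof.
rewrite /padd; case: (ltnP i (maxn (size s) (size t))) => Hi; first by rewrite nth_mkseq.
rewrite nth_default ?size_mkseq //; move: Hi; rewrite geq_max => /andP[h1 h2].
by rewrite !nth_default.
Qed.

Lemma padd_box n x y : padd (box n x) (box n y) = nseq n (x + y).
Proof.
apply: (@eq_from_nth _ 0); first by rewrite size_mkseq !size_nseq maxnn.
rewrite size_mkseq !size_nseq maxnn => i Hi.
by rewrite nth_padd !nth_nseq Hi.
Qed.

Lemma in_box_nth x : in_box c d x ->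
  [/\ sorted geq x, forall i, nth 0 x i <= d & forall i, c <= i -> nth 0 x i = 0].
Proof.
case/and3P => /andP[sx _] szx /allP dx; split=> // [i|i ci].
  case: (ltnP i (size x)) => Hi; first by apply: dx; apply: mem_nth.
  by rewrite nth_default.
by rewrite nth_default // (leq_trans szx).
Qed.

Let kappa := compose c d [:: box a1 b1; box a2 b2] (map (box a2) ms ++ map (box a1) ns)
             [:: a1; a2] (ms ++ ns) alphas betas gammas.

Lemma size_kappa : size kappa = 2 + (size ms + size ns) + size gammas.
Proof. by rewrite /kappa /compose !(size_cat, size_map, size_iota) /=; lia. Qed.

Lemma size_block_column : size (block_column a1 a2 b1 b2 ms ns) = 2 + (size ms + size ns).
Proof. by rewrite /block_column /= size_cat !size_map. Qed.

(** The concatenation is already sorted: the parts of the rectangle are at least [d], which bounds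
    those of [al]. *)
Lemma first_part n x al i : in_box c d al ->
  nth 0 (pconc (padd (box n d) (box n x)) al) i = if i < n then x + d else nth 0 al (i - n).
Proof.
move=> /in_box_nth[sal le_d _]; rewrite padd_box pconc_sorted //; last first.
- apply/allrelP => y z; rewrite mem_nseq => /andP[_ /eqP->] /(nthP 0)[j _ <-] /=.
  by apply: leq_trans (le_d j) _; rewrite leq_addr.
- exact: sorted_nseq.
rewrite nth_cat size_nseq nth_nseq addnC; by case: (i < n).
Qed.

Lemma cols_nth l : 2 <= l < 2 + (size ms + size ns) ->
  nth [::] (map (box a2) ms ++ map (box a1) ns) (l - 2) = nseq (col_s l) (col_w l).
Proof.
move=> /andP[l2 lmn]; rewrite /col_s /col_w lmn !nth_cat size_map.
case: (ltnP l (2 + size ms)) => Hl.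
  have Hl2 : l - 2 < size ms by lia.
  by rewrite Hl2 (nth_map 0).
have -> : l - 2 < size ms = false by lia.
by rewrite (nth_map 0) //; lia.
Qed.

Lemma nth_block_column l : l < 2 + (size ms + size ns) ->
  nth [::] (block_column a1 a2 b1 b2 ms ns) l =
    nseq (lam_s a1 a2 col_s l) (lam_w b1 b2 col_w l).
Proof.
case: l => [|[|l]] Hl //; rewrite /lam_s /lam_w /= -cols_nth //.
by rewrite -[l.+2]addn2 addnK.
Qed.

Lemma sum_cols (f : nat -> nat -> nat) n : (forall s, f s 0 = 0) ->
  \sum_(l <- iota 2 (size ms + size ns + n)) f (col_s l) (col_w l) =
  \sum_(m <- ms) f a2 m + \sum_(m <- ns) f a1 m.
Proof.
move=> f0; rewrite iotaD !big_cat iotaD big_cat /= [X in _ + X]big_seq [X in _ + X = _]big1 ?addn0; last first.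
  move=> l; rewrite mem_iota => Hl; rewrite /col_w nth_default ?f0 // size_cat; lia.
congr (_ + _).
  rewrite -[in RHS](mkseq_nth 0 ms) /mkseq big_map -[2]addn0 iotaDl big_map.
  rewrite big_seq [RHS]big_seq; apply: eq_bigr => l; rewrite mem_iota /= => Hl.
  by rewrite /col_s /col_w addKn nth_cat ltn_add2l Hl.
rewrite -[in RHS](mkseq_nth 0 ns) /mkseq big_map -[2 + _]addn0 iotaDl big_map.
rewrite big_seq [RHS]big_seq; apply: eq_bigr => l; rewrite mem_iota /= => Hl.
have -> : col_s (2 + size ms + l) = a1.
  rewrite /col_s; have -> : (2 + size ms + l < 2 + size ms) = false by lia.
  by have -> : 2 + size ms + l < 2 + (size ms + size ns) by lia.
rewrite /col_w nth_cat; have -> : (2 + size ms + l - 2 < size ms) = false by lia.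
by congr (f _ (nth _ _ _)); lia.
Qed.

Hypothesis Hal : size alphas = 2.
Hypothesis Hbe : size betas = size ms + size ns.
Hypothesis Hbox : all (in_box c d) rhos.

Lemma rho_box l : in_box c d (nth [::] rhos l).
Proof.
case: (ltnP l (size rhos)) => Hl; first by apply: (allP Hbox); apply: mem_nth.
by rewrite nth_default.
Qed.

Lemma rho_part_le l i : rho_part l i <= d.
Proof. by have [_ H _] := in_box_nth (rho_box l); apply: H. Qed.

Lemma rho_part0 l i : c <= i -> rho_part l i = 0.
Proof. by move=> ci; have [_ _ H] := in_box_nth (rho_box l); apply: H. Qed.

Lemma size_rhos : size rhos = size kappa.
Proof. by rewrite size_kappa /rhos !size_cat Hal Hbe addnA. Qed.

Lemma nth_kappa l i : l < size kappa ->
  nth 0 (nth [::] kappa l) i = kap a1 a2 b1 b2 c d col_s col_w rho_part l i.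
Proof.
rewrite size_kappa; case: l => [|[|l]] Hl.
- rewrite /kap /= first_part //; last by have := rho_box 0; rewrite /rhos nth_cat Hal.
  by rewrite /rho_part /rhos nth_cat Hal.
- rewrite /kap /= first_part //; last by have := rho_box 1; rewrite /rhos nth_cat Hal.
  by rewrite /rho_part /rhos nth_cat Hal.
rewrite /kap -[kappa]/([:: _; _] ++ (_ ++ _)) /=.
rewrite /rho_part /rhos [nth [::] (alphas ++ _) _]nth_cat Hal /= subSS subSS subn0.
rewrite !nth_cat !size_map size_iota size_cat !size_map Hbe.
case: (ltnP l (size ms + size ns)) => Hlm; last first.
  have -> : col_w l.+2 = 0 by rewrite /col_w nth_default // size_cat; lia.
  by rewrite if_same.
rewrite (nth_map 0) ?size_iota ?size_cat ?size_map // nth_iota ?size_cat ?size_map // add0n.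
rewrite nth_padd; congr (_ + _); have := @cols_nth l.+2; rewrite -[l.+2]addn2 addnK => ->; last by lia.
have -> : nth 0 (ms ++ ns) l = col_w (l + 2) by rewrite /col_w addnK.
rewrite pconc_sorted ?sorted_nseq //.
  by rewrite /box -nseqD nth_nseq.
by apply/allrelP => x y; rewrite !mem_nseq => /andP[_ /eqP->] /andP[_ /eqP->] /=.
Qed.

End Combinatorics.

(** * Nondegeneracy of general flags *)

Section GenericGood.
Variables (F : numFieldType) (a1 a2 b1 b2 c d N r : nat) (sf wf : nat -> nat).
Hypothesis HN : N = (a1 + a2 + (b1 + b2) + c + d)%N.
Hypothesis r2 : (1 < r)%N.
Hypothesis Hs : forall l, (l < r)%N -> (sf l <= a1 + a2)%N.
Hypothesis Hw : (\sum_(l <- iota 2 (r - 2)) wf l = b1 + b2)%N.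
Hypothesis Hsw : (\sum_(l <- iota 2 (r - 2)) sf l * wf l = a1 * b2 + a2 * b1)%N.

(** [fl] is fixed only up to equality of row spaces, because [flag_of_rel] replaces each step by a
    canonical generating matrix. *)
Lemma generic_good : generic (fun g : fam F N => units r g -> forall fl : nat -> nat -> 'M[F]_N,
  (forall l i, (l < r)%N -> (fl l i :=: frows i (g l))%MS) ->
  good_flags a1 a2 b1 b2 c d r sf wf fl).
Proof.
set ls := iota 2 (r - 2); have memls l : (l \in ls) = (1 < l < r)%N by rewrite mem_iota; lia.
have P01 : perm_eq [:: 0%N, 1%N & ls] (iota 0 r).
  by rewrite /ls; case: (r) r2 => [|[|n]] //= _; rewrite subSS subSS subn0.
(* Exchanging the first two flags, together with [a1], [a2] and [b1], [b2], turns each count about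
   one of them into the mirror statement. *)
have P10 : perm_eq [:: 1%N, 0%N & ls] (iota 0 r).
  by apply: perm_trans P01; apply/seq.permP => x /=; rewrite addnCA.
have Hs' l : l \in ls -> (sf l <= a1 + a2)%N by rewrite memls => /andP[_ /Hs].
have HN' : N = (a2 + a1 + (b2 + b1) + c + d)%N by rewrite HN; lia.
have Hs'' l : l \in ls -> (sf l <= a2 + a1)%N by rewrite addnC => /Hs'.
have Hw' : (\sum_(l <- ls) wf l = b2 + b1)%N by rewrite addnC.
have Hsw' : (\sum_(l <- ls) sf l * wf l = a2 * b1 + a1 * b2)%N by rewrite addnC.
have G := generic_and (generic_V1_cap F HN P01 Hw Hsw) (generic_V1_cap F HN' P10 Hw' Hsw').
have {}G := generic_and G (generic_all (fun l Hl => generic_V_cap F HN P01 Hw Hsw (l0 := l) Hl)).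
have {}G := generic_and G (trivial_second F HN P01 Hs' Hw Hsw).
have {}G := generic_and G (trivial_second F HN' P10 Hs'' Hw' Hsw').
have {}G := generic_and G (generic_all (fun l Hl => trivial_step F HN P01 Hs' Hw Hsw (l0 := l) Hl)).
have {}G := generic_and G (no_extra_V F HN P01 Hs' Hw Hsw).
have {}G := generic_and G (no_extra_first F HN P01 Hs' Hw Hsw).
have {}G := generic_and G (no_extra_first F HN' P10 Hs'' Hw' Hsw').
have {}G := generic_and G (generic_all (fun l Hl => no_extra_step F HN P01 Hs' Hw Hsw (l0 := l) Hl)).
apply: generic_sub G => g [[[[[[[[[e1 e1'] e3] e4] e4'] e5] e6] e6f] e6f'] e7] ug fl Efl.
have r0 : (0 < r)%N by lia.
have cE X l i : (l < r)%N -> \rank (X :&: fl l i)%MS = \rank (X :&: frows i (g l))%MS.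
  by move=> lr; rewrite (cap_eqmx (eqmx_refl X) (Efl l i lr)).
have mdE l : mdim b2 b1 c d sf wf l = mdim b1 b2 c d sf wf l by rewrite /mdim [(b2 + b1)%N]addnC.
have gp_sp A1 A2 : good_pair a1 a2 b1 b2 c d r sf wf fl A1 A2 ->
    [/\ split_pair a1 a2 b1 b2 0 1 g A1 A2, split_pair a2 a1 b2 b1 1 0 g A2 A1,
        meets_all b1 b2 c d ls sf wf g A1 A2 & meets_all b2 b1 c d ls sf wf g A2 A1].
  move=> [rA1 rA2 s1 s2 Hm]; rewrite !Efl // in s1 s2; split=> // l; rewrite memls => Hl.
    by have [_ lr] := andP Hl; rewrite -cE //; apply: Hm.
  by have [_ lr] := andP Hl; rewrite mdE addsmxC -cE //; apply: Hm.
have he A y : has_extra b1 b2 c d r sf wf fl A y -> ~~ (y <= A)%MS /\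
    forall l, l \in ls -> ((sf l).+1 <= \rank ((A + y) :&: frows (mdim b1 b2 c d sf wf l) (g l))%MS)%N.
  move=> [yA Hl]; split=> // l; rewrite memls => Hlr; have [_ lr] := andP Hlr.
  by rewrite -cE //; apply: Hl.
split.
- by rewrite cE // (cap_eqmx (Efl 0%N _ r0) (eqmx_refl _)); apply: e1.
- by rewrite cE // (cap_eqmx (Efl 1%N _ r2) (eqmx_refl _)); apply: e1'.
- move=> l Hl; have [_ lr] := andP Hl; rewrite cE //.
  rewrite (cap_eqmx (adds_eqmx (Efl 0%N _ r0) (Efl 1%N _ r2)) (eqmx_refl _)).
  by apply: e3 => //; rewrite memls.
- by move=> A1 A2 /gp_sp[_ sp _ ma]; rewrite cE //; apply: e4' sp ma.
- by move=> A1 A2 /gp_sp[sp _ ma _]; rewrite cE //; apply: e4 sp ma.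
- move=> A1 A2 l /gp_sp[sp _ ma _] Hl; have [_ lr] := andP Hl; rewrite cE //.
  by apply: e5 sp ma; rewrite ?memls.
- move=> A1 A2 y /gp_sp[sp _ ma _] /he[yA Hx]; apply/negP => yV.
  apply: (e6 ug A1 A2 y sp _ yA Hx); apply: submx_trans yV _.
  by rewrite (adds_eqmx (Efl 0%N _ r0) (Efl 1%N _ r2)).
move=> A1 A2 y l /gp_sp[sp sp' ma ma'] /he[yA Hx] lr; apply/negP; rewrite Efl // /off.
case: eqP => [->|l0] yf; first exact: (e6f ug A1 A2 y sp yf yA Hx).
move: yf; case: eqP => [->|l1] yf.
  apply: (e6f' ug A2 A1 y sp').
  - by rewrite [(b2 + b1)%N]addnC.
  - by rewrite addsmxC.
  by move=> l' Hl'; rewrite mdE [(A2 + A1)%MS]addsmxC; apply: Hx.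
by apply: (e7 l _ ug A1 A2 y sp ma yf yA Hx); rewrite memls; lia.
Qed.

End GenericGood.

(** * Automorphisms that move flags *)

Section Theta.
Variables (F : fieldType) (m N : nat) (L : 'M[F]_(m, N)) (L' : 'M[F]_(N, m)).
Hypothesis LL' : L *m L' = 1%:M.

(* Given [L *m L' = 1], this acts as [u] on the span of [L] and trivially on the kernel of [L']. *)
Definition theta (u : 'M[F]_m) : 'M[F]_N := 1%:M + L' *m (u - 1%:M) *m L.

Lemma theta1 : theta 1%:M = 1%:M.
Proof. by rewrite /theta subrr mulmx0 mul0mx addr0. Qed.

Lemma theta_mul u v : theta u *m theta v = theta (u *m v).
Proof.
rewrite /theta mulmxDl mul1mx mulmxDr mulmx1 -addrA; congr (_ + _).
have -> : L' *m (u - 1%:M) *m L *m (L' *m (v - 1%:M) *m L) =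
          L' *m ((u - 1%:M) *m (v - 1%:M)) *m L.
  by rewrite !mulmxA -[_ *m L *m L']mulmxA LL' mulmx1 -!mulmxA.
rewrite -!mulmxDl -!mulmxDr; congr (_ *m _ *m _).
have -> : (u - 1%:M) *m (v - 1%:M) = u *m v - u - (v - 1%:M).
  by rewrite mulmxBl mul1mx mulmxBr mulmx1.
by rewrite addrCA [v - _ + _]addrC subrK addrC subrKA.
Qed.

Lemma theta_unit u : u \in unitmx -> theta u \in unitmx.
Proof.
move=> uu; have : theta u *m theta (invmx u) = 1%:M by rewrite theta_mul mulmxV // theta1.
by case/mulmx1_unit.
Qed.

Lemma theta_L u : L *m theta u = u *m L.
Proof. by rewrite /theta mulmxDr mulmx1 !mulmxA LL' mul1mx mulmxBl mul1mx addrC subrK. Qed.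

Lemma theta_fix k (X : 'M[F]_(k, N)) u : X *m L' = 0 -> X *m theta u = X.
Proof. by move=> X0; rewrite /theta mulmxDr mulmx1 !mulmxA X0 !mul0mx addr0. Qed.

Lemma theta_stable k (X : 'M[F]_(k, N)) u : u \in unitmx -> (L <= X)%MS ->
  (X *m theta u :=: X)%MS.
Proof.
move=> uu LX; apply: eqmx_of_rank; last by rewrite mxrankMfree // row_free_unit theta_unit.
rewrite /theta mulmxDr mulmx1 addmx_sub // !mulmxA.
exact: submx_trans (submxMl _ _) LX.
Qed.

End Theta.

Section FlagAction.
Variables (F : fieldType) (N : nat).

Lemma cap_mul_unit (A B C : 'M[F]_N) : C \in unitmx ->
  ((A *m C) :&: (B *m C) :=: (A :&: B) *m C)%MS.
Proof.
move=> uC; apply/eqmxP/andP; split; last exact: capmxMr.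
have -> : (A *m C :&: B *m C)%MS = (A *m C :&: B *m C)%MS *m invmx C *m C.
  by rewrite -mulmxA mulVmx // mulmx1.
rewrite submxMr //; apply: submx_trans (capmxMr _ _ _) _.
by rewrite -!mulmxA mulmxV // !mulmx1.
Qed.

(** Each step contains a vector outside the preceding one; its coordinates along [B], taken modulo
    [U], form the next row of [g]. *)
Lemma flag_adapted m (U S : 'M[F]_N) (B : 'M[F]_(m, N)) f :
  (B + U == S)%MS -> (\rank S = \rank U + m)%N -> is_flag U S f ->
  exists2 g : 'M[F]_m, g \in unitmx &
    forall j, (j <= m)%N -> (f j :=: frows j g *m B + U)%MS.
Proof.
move=> /eqmxP ES rS; rewrite /is_flag {}rS addKn => /andP[/forallP f1 /forallP f2].
have fP j : (j <= m)%N -> [/\ (U <= f j)%MS, (f j <= S)%MS & \rank (f j) = (\rank U + j)%N].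
  by rewrite -ltnS => jm; have /and3P[? ? /eqP ?] := f1 (Ordinal jm).
have /fin_all_exists[w Hw] : forall j : 'I_m, exists w : 'rV[F]_m, (f j.+1 :=: f j + w *m B)%MS.
  move=> j; have [Uj _ rj] := fP j (ltnW (ltn_ord j)); have [_ Sj rj1] := fP j.+1 (ltn_ord j).
  have : ~~ (f j.+1 <= f j)%MS.
    by apply/negP => /mxrankS; rewrite rj rj1 addnS ltnn.
  case/row_subPn => i; set y := row i _ => yf.
  have yS : (y <= B + U)%MS by rewrite ES; apply: submx_trans (row_sub _ _) Sj.
  have [[w v] /= Ey] := sub_addsmxP yS; exists w.
  have Ef : (f j + y :=: f j.+1)%MS.
    apply: eqmx_of_rank; first by rewrite addsmx_sub (f2 j) row_sub.
    by rewrite rank_add_vec // rj rj1 addnS.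
  apply: eqmx_trans (eqmx_sym Ef) _; apply/eqmxP; rewrite !addsmx_sub !addsmxSl /=.
  have vU : (v *m U <= f j)%MS by apply: submx_trans (submxMl _ _) Uj.
  apply/andP; split.
    by rewrite Ey addmx_sub ?addsmxSr // (submx_trans vU) // addsmxSl.
  have -> : w *m B = y - v *m U by rewrite Ey addrK.
  by rewrite addmx_sub ?addsmxSr // eqmx_opp (submx_trans vU) // addsmxSl.
pose g := \matrix_j w j.
have Hg j : (j <= m)%N -> (f j :=: frows j g *m B + U)%MS.
  elim: j => [_|j IH jm].
    have [U0 _ r0] := fP 0%N (leq0n _).
    rewrite /frows pid_mx_0 !mul0mx; apply: eqmx_trans (eqmx_sym (adds0mx _ _)).
    by apply/eqmx_sym/eqmx_of_rank; rewrite // r0 addn0.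
  have {}IH := IH (ltnW jm); apply: eqmx_trans (Hw (Ordinal jm)) _ => /=.
  apply: eqmx_trans (adds_eqmx IH (eqmx_refl _)) _.
  have Erow : row (Ordinal jm) g = w (Ordinal jm) by rewrite rowK.
  rewrite -Erow; apply/eqmxP/andP; split; rewrite !addsmx_sub.
    rewrite (submx_trans (submxMr B (frows_le g (leqnSn j))) (addsmxSl _ _)) addsmxSr /=.
    by apply: submx_trans (addsmxSl _ _); apply: submxMr; apply: row_frows.
  rewrite (submx_trans (addsmxSr (frows j g *m B) U) (addsmxSl _ _)) andbT.
  apply: submx_trans (submxMr B (frowsS g jm)) _.
  rewrite addsmxMr addsmx_sub addsmxSr andbT.
  exact: submx_trans (addsmxSl _ _) (addsmxSl _ _).
exists g => //; rewrite -row_free_unit -row_leq_rank.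
have [_ _ rm] := fP m (leqnn m); move: rm; rewrite (Hg m (leqnn m)) frows_full // => rm.
have := leq_trans (eq_leq (esym rm)) (mxrank_adds_leqif _ _).
by have := mxrankM_maxl g B; lia.
Qed.

End FlagAction.

(** * The fibration *)

Lemma in_omegaE (F : fieldType) N (U S : 'M[F]_N) k L Fs X :
  in_omega U S k L Fs X <-> in_gr U S k X /\ forall l i, (l < size L)%N -> (i < k)%N ->
    (\rank U + i.+1 <= \rank (X :&: nth (@nulflag F N) Fs l
       (\rank S - \rank U - k + i.+1 - nth 0 (nth [::] L l) i)%N)%MS)%N.
Proof.
rewrite /in_omega; split=> [/andP[gr /forallP H]|[gr H]].
  split=> // l i lL ik; have /andP[_ /forallP] := H (Ordinal lL).
  by move=> /(_ (Ordinal ik)).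
rewrite gr; apply/forallP => l; rewrite /in_schubert gr; apply/forallP => i.
exact: H.
Qed.

Lemma nat_all_exists (T : Type) (x0 : T) n (P : nat -> T -> Prop) :
  (forall l, (l < n)%N -> exists x, P l x) -> exists f, forall l, (l < n)%N -> P l (f l).
Proof.
move=> H; have /fin_all_exists[f Hf] : forall l : 'I_n, exists x, P l x by move=> l; apply: H.
exists (fun l => if insub l is Some l' then f l' else x0) => l ln.
by rewrite insubT; apply: (Hf (Ordinal ln)).
Qed.

(** [L'] reads off the coordinates along [L] in the decomposition into the spans of [L] and [V], so
    that [theta L L'] fixes [V] pointwise. *)
Lemma complement_dual (F : fieldType) m N (V : 'M[F]_N) (L : 'M[F]_(m, N)) :
  (m + \rank V)%N = N -> (1%:M <= L + V)%MS ->
  exists2 L' : 'M[F]_(N, m), L *m L' = 1%:M & V *m L' = 0.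
Proof.
move=> EN full.
have : row_free (col_mx L (row_base V)).
  rewrite -row_leq_rank -(addsmxE L (row_base V)) EN.
  rewrite (adds_eqmx (eqmx_refl L) (eq_row_base V)).
  by move/mxrankS: full; rewrite mxrank1.
case/row_freeP => Q; rewrite -[Q]hsubmxK mul_col_row scalar_mx_block.
move=> /eq_block_mx[E1 _ E2 _]; exists (lsubmx Q) => //.
have /submxP[D ED] : (V <= row_base V)%MS by rewrite eq_row_base.
by rewrite [X in X *m _]ED -mulmxA E2 mulmx0.
Qed.

Section Main.
Variables (F : numFieldType) (a1 a2 b1 b2 c d : nat) (ms ns : seq nat).
Variables (alphas betas gammas : seq (seq nat)).
Hypothesis Hms : sumn ms = b1.
Hypothesis Hns : sumn ns = b2.
Hypothesis Hal : size alphas = 2%N.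
Hypothesis Hbe : size betas = (size ms + size ns)%N.
Let rhos := alphas ++ betas ++ gammas.
Hypothesis Hbox : all (in_box c d) rhos.
Let a := (a1 + a2)%N.
Let b := (b1 + b2)%N.
Let N := (a + b + c + d)%N.
Let kappa := compose c d [:: box a1 b1; box a2 b2] (map (box a2) ms ++ map (box a1) ns)
             [:: a1; a2] (ms ++ ns) alphas betas gammas.
Let lam := block_column a1 a2 b1 b2 ms ns.
Let r := size kappa.
Let nl := (2 + (size ms + size ns))%N.
Let sf := col_s a1 a2 ms ns.
Let wf := col_w ms ns.
Let rho := rho_part alphas betas gammas.

Let szl : size lam = nl. Proof. exact: size_block_column. Qed.
Let szr : size rhos = r. Proof. exact: (size_rhos a1 a2 b1 b2 c d gammas Hal Hbe). Qed.
Let HN : N = (a1 + a2 + (b1 + b2) + c + d)%N. Proof. by []. Qed.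
Let rE : r = (nl + size gammas)%N. Proof. exact: size_kappa. Qed.
Let nl1 : (1 < nl <= r)%N. Proof. by rewrite rE /nl; lia. Qed.
Let r2 : (1 < r)%N. Proof. by case/andP: nl1 => h1 h2; apply: leq_trans h2. Qed.
Let Hs l : (l < r)%N -> (sf l <= a)%N.
Proof. by rewrite /sf /col_s /a => _; case: ifP => _; [|case: ifP => _]; lia. Qed.
Let Hs0 l : (nl <= l)%N -> sf l = 0%N.
Proof.
rewrite /nl /sf /col_s => Hl; have -> : (l < 2 + size ms)%N = false by lia.
by have -> : (l < 2 + (size ms + size ns))%N = false by lia.
Qed.
Let Hwi : (\sum_(l <- iota 2 (r - 2)) wf l = b1 + b2)%N.
Proof.
have -> : (r - 2 = size ms + size ns + size gammas)%N by rewrite rE /nl; lia.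
by rewrite (@sum_cols a1 a2 ms ns (fun _ w => w)) // -Hms -Hns !sumnE.
Qed.
Let Hswi : (\sum_(l <- iota 2 (r - 2)) sf l * wf l = a1 * b2 + a2 * b1)%N.
Proof.
have -> : (r - 2 = size ms + size ns + size gammas)%N by rewrite rE /nl; lia.
rewrite (@sum_cols a1 a2 ms ns muln) => [|s]; last by rewrite muln0.
by rewrite -!big_distrr /= -Hms -Hns !sumnE addnC.
Qed.
Let Hw : (\sum_(l < r | (1 < l)%N) wf l = b)%N.
Proof.
rewrite -[b]Hwi -(big_mkord (fun l => 1 < l)%N wf) -/(index_iota 2 r).
by rewrite [RHS](big_nat_widenl 2 0) //; apply: eq_bigl => l; rewrite andbC.
Qed.
Let Hrho l i : (rho l i <= d)%N. Proof. exact: (rho_part_le Hbox). Qed.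
Let Hrho0 l i : (c <= i)%N -> rho l i = 0%N. Proof. exact: (rho_part0 Hbox). Qed.

Let flags := seq (nat -> 'M[F]_N).
Definition step (Fs : flags) : nat -> nat -> 'M[F]_N := nth (@nulflag F N) Fs.
Definition Vf (Fs : flags) : 'M[F]_N := (step Fs 0 (a1 + b2) + step Fs 1 (a2 + b1))%MS.
Definition Ef (Fs : flags) : flags := mkseq (base_flag a1 a2 b1 b2 c d (step Fs)) nl.
Definition Ff (Fs : flags) (h : 'M[F]_N) : flags :=
  mkseq (fiber_flag a1 a2 b1 b2 c d r sf wf (step Fs) h) r.

Section Instance.
Variable Fs : flags.
Hypothesis Hfl : forall l, (l < r)%N -> full_flag (step Fs l).
Hypothesis good : good_flags a1 a2 b1 b2 c d r sf wf (step Fs).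

Let rV : \rank (Vf Fs) = (a + b)%N. Proof. exact: rankV HN r2 Hw Hfl good. Qed.

Lemma omega_total H : in_omega 0 1%:M (a + c) kappa Fs H <->
  total_cond a1 a2 b1 b2 c d r sf wf rho (step Fs) H.
Proof.
rewrite in_omegaE /in_gr sub0mx submx1 mxrank0 mxrank1 /= add0n.
have EN : (N - 0 - (a + c) = b + d)%N by rewrite /N; lia.
split=> [[/eqP rH HH]|tH].
  apply/(total_condP HN r2 Hs Hw Hrho Hfl Hrho0 rH) => l i lr iac.
  by have := HH l i lr iac; rewrite add0n EN nth_kappa.
have [rH _ _ _ _] := tH; split; first exact/eqP.
move=> l i lr iac; rewrite add0n EN nth_kappa //.
exact: (total_condP HN r2 Hs Hw Hrho Hfl Hrho0 rH).2.
Qed.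

Lemma omega_base h : in_omega 0 (Vf Fs) a lam (Ef Fs) h <->
  base_cond a1 a2 b1 b2 c d r sf wf (step Fs) h.
Proof.
rewrite in_omegaE szl /in_gr sub0mx mxrank0 rV andTb.
have EN : (a + b - 0 - a = b)%N by lia.
have E l i : (l < nl)%N -> nth (@nulflag F N) (Ef Fs) l (a + b - 0 - a + i.+1 - nth 0 (nth [::] lam l) i)%N =
    base_flag a1 a2 b1 b2 c d (step Fs) l
      (b + i.+1 - (if (i < lam_s a1 a2 sf l)%N then lam_w b1 b2 wf l else 0))%N.
  by move=> lnl; rewrite EN nth_mkseq // nth_block_column // nth_nseq.
split=> [[/andP[hV /eqP rh] HH]|bh].
  apply/(base_condP HN r2 Hs Hw Hfl good nl1 Hs0 rh hV) => l i lnl ia.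
  by have := HH l i lnl ia; rewrite add0n E.
have [rh hV _ _ _] := bh; split; first by rewrite hV rh add0n eqxx.
move=> l i lnl ia; rewrite add0n E //.
exact: (base_condP HN r2 Hs Hw Hfl good nl1 Hs0 rh hV).2.
Qed.

Lemma omega_fiber h K : in_omega (Vf Fs) 1%:M c rhos (Ff Fs h) K <->
  fiber_cond a1 a2 b1 b2 c d r sf wf rho (step Fs) h K.
Proof.
rewrite in_omegaE /in_gr submx1 mxrank1 rV /=.
have EN : (N - (a + b) - c = d)%N by rewrite /N; lia.
rewrite szr EN; split=> [[/andP[VK /eqP rK] HH]|[rK VK HH]].
  by split=> // l i lr ic; have := HH l i lr ic; rewrite nth_mkseq.
split; first by rewrite VK rK eqxx.
by move=> l i lr ic; rewrite nth_mkseq //; apply: HH.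
Qed.

Lemma Ef_inst : is_inst 0 (Vf Fs) lam (Ef Fs).
Proof.
rewrite /is_inst size_mkseq szl eqxx andTb; apply/(all_nthP (@nulflag F N)).
move=> l; rewrite size_mkseq => lnl; rewrite nth_mkseq //.
apply: (base_flag_is_flag HN r2 Hw Hfl good).
by case/andP: nl1 => _; apply: leq_trans.
Qed.

Lemma Ff_inst h : base_cond a1 a2 b1 b2 c d r sf wf (step Fs) h ->
  is_inst (Vf Fs) 1%:M rhos (Ff Fs h).
Proof.
move=> bh; rewrite /is_inst size_mkseq szr eqxx andTb.
apply/(all_nthP (@nulflag F N)) => l; rewrite size_mkseq => lr; rewrite nth_mkseq //.
exact: (fiber_flag_is_flag HN r2 Hs Hw Hfl good bh).
Qed.

End Instance.

Let Fl (gs : seq 'M[F]_N) : flags := map (@std_flag F N) gs.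
Let allu m (gs : seq 'M[F]_m) := all (fun g => g \in unitmx) gs.

Lemma allu_nth m (gs : seq 'M[F]_m) l : allu gs -> (l < size gs)%N -> nth 0 gs l \in unitmx.
Proof. by move=> /allP H Hl; apply: H; apply: mem_nth. Qed.

Lemma step_Fl gs l i : (l < size gs)%N -> (step (Fl gs) l i :=: frows i (nth 0 gs l))%MS.
Proof.
move=> Hl; rewrite /step (nth_map 0) // /std_flag /flag_of_rel mulmx1.
by apply: eqmx_trans (genmxE _) _; apply: addsmx0.
Qed.

Lemma Fl_full gs l : size gs = r -> allu gs -> (l < r)%N -> full_flag (step (Fl gs) l).
Proof.
move=> sz ua lr; have lz : (l < size gs)%N by rewrite sz.
split=> [i iN|i j ij]; last by rewrite !step_Fl // frows_le.
by rewrite step_Fl // rank_frows // row_free_unit allu_nth.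
Qed.

Lemma exists_good_open : exists p : pexpr F N,
  (exists gs, [/\ size gs = r, allu gs & peval gs p != 0]) /\
  forall gs, [/\ size gs = r, allu gs & peval gs p != 0] ->
    good_flags a1 a2 b1 b2 c d r sf wf (step (Fl gs)).
Proof.
have [P [Ppf [g0 Pg0]] HP] := generic_good F HN r2 Hs Hwi Hswi.
(* [P] may involve matrices of index [r] or more, which a tuple of length [r] does not supply; they
   are frozen at the values of [g0], a point where [P] does not vanish. *)
pose tr (g : fam F N) : fam F N := fun l => if (l < r)%N then g l else g0 l.
have ptr : polymap tr.
  apply: polymap_to_fam => l; rewrite /tr; case: (l < r)%N; last by pm.
  exact: (polymap_fam (g := id) l (@polymap_id _ _ _)).
have pP : polyfun (fun g => P (tr g)) by apply: polyfun_comp Ppf.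
(* The determinants are multiplied in so that the point found off the zero set consists of
   invertible matrices. *)
have pD : polyfun (fun g : fam F N => \prod_(l < r) \det (g l)).
  apply: polyfun_prod => l _; apply: polyfun_det.
  exact: (polymap_fam (g := id) l (@polymap_id _ _ _)).
have [||g Hg] := polyfun_mul_nonvanish pP pD.
- exists g0; have -> : tr g0 = g0 => //.
  by apply: functional_extensionality => l; rewrite /tr if_same.
- by exists (fun=> 1%:M); rewrite prodr_const det1 expr1n oner_neq0.
have [p Hp] := polyfun_pexpr (polyfun_mul pP pD).
exists p; split; last first.
  move=> gs [sz ua]; rewrite Hp mulf_eq0 negb_or => /andP[/HP HQ _].
  apply: HQ => [l lr|l i lr]; rewrite /tr lr; first by apply: allu_nth => //; rewrite sz.
  by apply: step_Fl; rewrite sz.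
have trE (g1 : fam F N) : tr (nth 0 (mkseq g1 r)) = tr g1.
  by apply: functional_extensionality => l; rewrite /tr; case: ifP => // lr; rewrite nth_mkseq.
have Ep : peval (mkseq g r) p = P (tr g) * \prod_(l < r) \det (g l).
  rewrite Hp trE; congr (_ * _); apply: eq_bigr => l _; by rewrite nth_mkseq.
exists (mkseq g r); split; [by rewrite size_mkseq| |by rewrite Ep].
move: Hg; rewrite mulf_eq0 negb_or => /andP[_ /prodf_neq0 Hd].
apply/(all_nthP 0) => l; rewrite size_mkseq => lr; rewrite nth_mkseq //.
by have := Hd (Ordinal lr) isT; rewrite unitmxE unitfE.
Qed.

(** * General instances of the base and of the fiber arise *)

Section Open.
Variable p : pexpr F N.
Let O gs := [/\ size gs = r, allu gs & peval gs p != 0].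
Hypothesis Ogood : forall gs, O gs -> good_flags a1 a2 b1 b2 c d r sf wf (step (Fl gs)).

Let Ofull gs : O gs -> forall l, (l < r)%N -> full_flag (step (Fl gs) l).
Proof. by move=> [sz ua _] l; apply: Fl_full. Qed.

Let OrV gs (Og : O gs) : \rank (Vf (Fl gs)) = (a + b)%N.
Proof. exact: rankV HN r2 Hw (Ofull Og) (Ogood Og). Qed.

Section Action.
Variables (m n : nat) (L : 'M[F]_(m, N)) (L' : 'M[F]_(N, m)) (gs : seq 'M[F]_N).
Variable g0 : nat -> 'M[F]_m.
Hypothesis LL' : L *m L' = 1%:M.
Hypothesis Og : O gs.
Hypothesis ug0 : forall l, (l < n)%N -> g0 l \in unitmx.

(** [g0 l] will be a matrix of the flag currently induced, which this automorphism carries to the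
    flag of entry [l] of [gE]. Only [g0 l] is inverted, so the result is polynomial in [gE]. *)
Definition act_mx (gE : seq 'M[F]_m) l : 'M[F]_N :=
  if (l < n)%N then theta L L' (invmx (g0 l) *m nth 0 gE l) else 1%:M.
Definition act (gE : seq 'M[F]_m) := mkseq (fun l => nth 0 gs l *m act_mx gE l) r.

Lemma act_mx_unit gE l : size gE = n -> allu gE -> act_mx gE l \in unitmx.
Proof.
move=> sz ua; rewrite /act_mx; case: ifP => [ln|_]; last exact: unitmx1.
by apply: theta_unit; rewrite // unitmx_mul unitmx_inv ug0 // allu_nth // sz.
Qed.

Lemma act_generic : exists p' : pexpr F m,
  (exists gE, [/\ size gE = n, allu gE & peval gE p' != 0]) /\
  forall gE, size gE = n -> allu gE -> peval gE p' != 0 -> O (act gE).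
Proof.
have [f pf Hf] := pexpr_polyfun p; have [szg ug pg] := Og.
pose phi (e : fam F m) : fam F N := fun l => if (l < r)%N then nth 0 gs l *m
  (if (l < n)%N then theta L L' (invmx (g0 l) *m e l) else 1%:M) else 0.
have pphi : polymap phi.
  apply: polymap_to_fam => l; rewrite /phi; case: (l < r)%N; last by pm.
  case: (l < n)%N; rewrite /theta; pm.
  exact: (polymap_fam (g := id) l (@polymap_id _ _ _)).
have [p' Hp'] := polyfun_pexpr (polyfun_comp pphi pf).
have E gE : peval gE p' = peval (act gE) p.
  rewrite Hp' Hf; congr (f _); apply: functional_extensionality => l; rewrite /phi /act.
  case: (ltnP l r) => lr; first by rewrite nth_mkseq.
  by rewrite nth_default // size_mkseq.
exists p'; split; last first.
  move=> gE sz ua; rewrite E => Hpe; split=> //; first by rewrite size_mkseq.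
  apply/(all_nthP 0) => l; rewrite size_mkseq => lr; rewrite nth_mkseq //.
  by rewrite unitmx_mul act_mx_unit // allu_nth // szg.
(* The tuple [g0] itself gives back [gs], so the open set is nonempty. *)
exists (mkseq g0 n); split; first by rewrite size_mkseq.
  by apply/(all_nthP 0) => l; rewrite size_mkseq => ln; rewrite nth_mkseq // ug0.
rewrite E; suff -> : act (mkseq g0 n) = gs by [].
apply: (@eq_from_nth _ 0); rewrite size_mkseq ?szg // => l lr; rewrite nth_mkseq //.
rewrite /act_mx; case: ifP => [ln|_]; last by rewrite mulmx1.
by rewrite nth_mkseq // mulVmx ?ug0 // theta1 mulmx1.
Qed.

Lemma step_act gE l i : (l < r)%N ->
  (step (Fl (act gE)) l i :=: step (Fl gs) l i *m act_mx gE l)%MS.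
Proof.
have [szg ug pg] := Og; move=> lr; apply: eqmx_trans (step_Fl _ _) _; first by rewrite size_mkseq.
rewrite nth_mkseq // /frows mulmxA; apply: eqmxMr; apply/eqmx_sym/step_Fl.
by rewrite szg.
Qed.

Lemma base_flag_act gE l i : size gE = n -> allu gE -> (l < r)%N ->
  (Vf (Fl (act gE)) :=: Vf (Fl gs))%MS -> (Vf (Fl gs) *m act_mx gE l :=: Vf (Fl gs))%MS ->
  (base_flag a1 a2 b1 b2 c d (step (Fl (act gE))) l i :=:
   base_flag a1 a2 b1 b2 c d (step (Fl gs)) l i *m act_mx gE l)%MS.
Proof.
move=> sz ua lr EV EVt; rewrite /base_flag -/(Vf _) -/(Vf (Fl gs)); case: ifP => _; first exact: step_act.
apply: eqmx_trans _ (cap_mul_unit _ _ (act_mx_unit l sz ua)).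
exact: cap_eqmx (step_act _ _ lr) (eqmx_trans EV (eqmx_sym EVt)).
Qed.

End Action.

Lemma arise_base gs (B : 'M[F]_(\rank (Vf (Fl gs)), N)) : O gs -> (B == Vf (Fl gs))%MS ->
  generic_rel 0 B (size lam) (fun E => exists gs', O gs' /\ (Vf (Fl gs') == Vf (Fl gs))%MS /\
    flags_eq (\rank (Vf (Fl gs))) E (Ef (Fl gs'))).
Proof.
move=> Og EB; set V := Vf (Fl gs) in B EB *; set m := \rank V in B EB *; have /eqmxP EB' := EB.
have Bf : row_free B by rewrite -row_leq_rank EB'.
(* The kernel of the right inverse [B'] is the complement of [V] that the automorphisms fix
   pointwise. *)
have [B' BB'] := row_freeP Bf.
have nlr : (nl <= r)%N by case/andP: nl1.
have [|g0 Hg0] := @nat_all_exists 'M[F]_m 1%:M nl (fun l g => g \in unitmx /\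
   forall j, (j <= m)%N -> (base_flag a1 a2 b1 b2 c d (step (Fl gs)) l j :=: frows j g *m B + (0 : 'M[F]_N))%MS).
  move=> l lnl; have lr := leq_trans lnl nlr.
  have [||g gu Hg] := @flag_adapted F N m 0 V B _ _ _
    (base_flag_is_flag HN r2 Hw (Ofull Og) (Ogood Og) lr); last by exists g.
    by apply/eqmxP; apply: eqmx_trans (addsmx0 _ _) EB'.
  by rewrite mxrank0.
have ug0 l : (l < nl)%N -> g0 l \in unitmx by case/Hg0.
have [p' [ne Hp']] := act_generic BB' Og ug0.
exists p'; split; first by rewrite szl.
rewrite szl => gE sz ua Hpe; have Oa := Hp' gE sz ua Hpe.
have EVt l : (V *m act_mx nl B B' g0 gE l :=: V)%MS.
  rewrite /act_mx; case: ifP => ln; last by rewrite mulmx1.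
  apply: (theta_stable BB'); last by rewrite EB'.
  by rewrite unitmx_mul unitmx_inv ug0 // allu_nth // sz.
have EV : (Vf (Fl (act nl B B' gs g0 gE)) :=: V)%MS.
  apply: eqmx_of_rank; last by rewrite (OrV Oa) /V (OrV Og).
  rewrite addsmx_sub; apply/andP; split.
    rewrite (step_act nl B B' g0 Og) ?(ltnW r2) // -(EVt 0%N) submxMr //.
    exact: addsmxSl.
  by rewrite (step_act nl B B' g0 Og) // -(EVt 1%N) submxMr // addsmxSr.
exists (act nl B B' gs g0 gE); split=> //; split; first exact/eqmxP.
split; first by rewrite size_map size_mkseq.
move=> l j jm; case: (ltnP l nl) => ln; last first.
  rewrite nth_default ?size_map ?sz // nth_default ?size_mkseq //.
  by rewrite submx_refl.
have lr := leq_trans ln nlr.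
rewrite (nth_map 0) ?sz // nth_mkseq //; apply/eqmxP.
apply: eqmx_trans (genmxE _) _; apply/eqmx_sym.
apply: eqmx_trans (base_flag_act BB' Og ug0 j sz ua lr EV (EVt l)) _.
have [_ /(_ j jm) Eb] := Hg0 l ln.
apply: eqmx_trans (eqmxMr _ Eb) _; apply: eqmx_trans (addsmxMr _ _ _) _.
rewrite mul0mx; apply: adds_eqmx (eqmx_refl _).
rewrite /act_mx ln -mulmxA (theta_L BB') /frows -!mulmxA [g0 l *m _]mulmxA.
by rewrite mulmxV ?ug0 // mul1mx; apply: eqmx_refl.
Qed.

(** [V] is fixed pointwise, and every space containing [L] is stable, in particular [Lam h] and each
    [h + M_l]. Hence [V], its flags and [Lam h] survive, and only the fiber flags move. *)
Lemma arise_fiber gs (V h : 'M[F]_N) (B : 'M[F]_(N - \rank V, N)) :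
  O gs -> (Vf (Fl gs) :=: V)%MS -> base_cond a1 a2 b1 b2 c d r sf wf (step (Fl gs)) h ->
  (B + V == 1%:M)%MS ->
  generic_rel V B (size rhos) (fun G => exists gs', [/\ O gs', (Vf (Fl gs') == V)%MS,
     flags_eq (\rank V) (Ef (Fl gs)) (Ef (Fl gs')) & flags_eq (N - \rank V) G (Ff (Fl gs') h)]).
Proof.
move=> Og EV bh /eqmxP EB; set m := (N - \rank V)%N in B EB *.
have rV : \rank V = (a + b)%N by rewrite -EV OrV.
have hV : (h <= V)%MS by rewrite -EV; case: bh.
pose La := Lam b1 b2 c d r sf wf (step (Fl gs)) h.
have [_ rLV] := rank_Lam HN r2 Hs Hw (Ofull Og) (Ogood Og) bh.
have BLV : (B <= La + V)%MS.
  apply: submx_trans (submx1 _) _; rewrite sub1mx /row_full.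
  by rewrite -(adds_eqmx (eqmx_refl La) EV) rLV.
(* [L] is the component of [B] in [Lam h]. It agrees with [B] modulo [V], so the prescribed flags of
   the quotient can be written with [L]. *)
have [[D1 D2] /= EBD] := sub_addsmxP BLV; pose L := D1 *m La.
have LLa : (L <= La)%MS by apply: submxMl.
have LB k (X : 'M[F]_(k, m)) : (X *m B + V :=: X *m L + V)%MS.
  apply/eqmxP; rewrite !addsmx_sub !addsmxSr !andbT EBD mulmxDr; apply/andP; split.
    by rewrite addmx_sub ?addsmxSl // mulmxA (submx_trans (submxMl _ _) (addsmxSr _ _)).
  rewrite -[X in (X <= _)%MS](addrK (X *m (D2 *m V))) addmx_sub ?addsmxSl // eqmx_opp mulmxA.
  by rewrite (submx_trans (submxMl _ _) (addsmxSr _ _)).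
have LV1 : (1%:M <= L + V)%MS by rewrite -[L]mul1mx -LB mul1mx EB.
have Em : (m + \rank V)%N = N by rewrite subnK // rank_leq_col.
have [L' LL' VL'] := complement_dual Em LV1.
have [|g0 Hg0] := @nat_all_exists 'M[F]_m 1%:M r (fun l g => g \in unitmx /\
   forall j, (j <= m)%N -> (fiber_flag a1 a2 b1 b2 c d r sf wf (step (Fl gs)) h l j :=: frows j g *m L + V)%MS).
  move=> l lr.
  have [||g gu Hg] := @flag_adapted F N m (Vf (Fl gs)) 1%:M L _ _ _
    (fiber_flag_is_flag HN r2 Hs Hw (Ofull Og) (Ogood Og) bh lr).
  - by rewrite submx1 (adds_eqmx (eqmx_refl L) EV).
  - by rewrite mxrank1 EV addnC Em.
  by exists g; split=> // j jm; apply: eqmx_trans (Hg j jm) (adds_eqmx (eqmx_refl _) EV).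
have ug0 l : (l < r)%N -> g0 l \in unitmx by case/Hg0.
have [p' [ne Hp']] := act_generic LL' Og ug0.
exists p'; split; first by rewrite szr.
rewrite szr => gE sz ua Hpe; have Oa := Hp' gE sz ua Hpe.
set gs' := act r L L' gs g0 gE in Oa; set th := act_mx r L L' g0 gE.
have thu l : th l \in unitmx by apply: act_mx_unit.
have fixV k (X : 'M[F]_(k, N)) l : (X <= V)%MS -> X *m th l = X.
  move=> /submxP[D ->]; rewrite /th /act_mx; case: ifP => _; last by rewrite mulmx1.
  by apply: theta_fix; rewrite -mulmxA VL' mulmx0.
have stab k (X : 'M[F]_(k, N)) l : (L <= X)%MS -> (X *m th l :=: X)%MS.
  move=> LX; rewrite /th /act_mx; case: ifP => ln; last by rewrite mulmx1.
  by apply: (theta_stable LL') => //; rewrite unitmx_mul unitmx_inv ug0 // allu_nth // sz.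
have r0 : (0 < r)%N by apply: ltnW.
have stE l i : (l < r)%N -> (step (Fl gs') l i :=: step (Fl gs) l i *m th l)%MS.
  by move=> lr; apply: step_act.
have EV' : (Vf (Fl gs') :=: Vf (Fl gs))%MS.
  apply: adds_eqmx.
    by apply: eqmx_trans (stE _ _ r0) _; rewrite fixV // -EV addsmxSl.
  by apply: eqmx_trans (stE _ _ r2) _; rewrite fixV // -EV addsmxSr.
have EVt l : (Vf (Fl gs) *m th l :=: Vf (Fl gs))%MS by rewrite fixV // EV.
exists gs'; split=> //.
- by apply/eqmxP; apply: eqmx_trans EV' EV.
- split; first by rewrite !size_mkseq.
  move=> l j jm; case: (ltnP l nl) => ln; last first.
    rewrite nth_default ?size_mkseq // nth_default ?size_mkseq //.
    by rewrite submx_refl.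
  have lr : (l < r)%N by case/andP: nl1 => _; apply: leq_trans.
  rewrite !nth_mkseq //; apply/eqmxP/eqmx_sym.
  apply: eqmx_trans (base_flag_act LL' Og ug0 j sz ua lr EV' (EVt l)) _.
  by rewrite fixV // -EV; apply: base_flag_sub (Ofull Og) _ _.
have ELa : (Lam b1 b2 c d r sf wf (step (Fl gs')) h :=: La)%MS.
  have Ec (l : 'I_r) i : (1 < l)%N -> i = (b1 + b2 - wf l + c + d + sf l)%N ->
      (h + step (Fl gs') l i :=: h + step (Fl gs) l i)%MS.
    move=> l1 Ei; apply: eqmx_trans (adds_eqmx (eqmx_refl h) (stE l i (ltn_ord l))) _.
    rewrite -[X in (X + _ *m _ :=: _)%MS](fixV _ h l hV).
    apply: eqmx_trans (eqmx_sym (addsmxMr _ _ _)) _; apply: stab.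
    by apply: submx_trans LLa _; rewrite Ei; apply: Lam_sub; rewrite l1 /=.
  apply/eqmxP/andP; split; apply/sub_bigcapmxP => l l1; apply: (bigcapmx_inf l) => //.
    by rewrite (Ec l _ l1 erefl).
  by rewrite (Ec l _ l1 erefl).
split; first by rewrite size_map size_mkseq sz.
move=> l j jm; case: (ltnP l r) => lr; last first.
  rewrite nth_default ?size_map ?sz // nth_default ?size_mkseq //.
  by rewrite submx_refl.
rewrite (nth_map 0) ?sz // nth_mkseq //; apply/eqmxP.
apply: eqmx_trans (genmxE _) _; apply: eqmx_trans (LB _ _) _; apply/eqmx_sym.
have [_ /(_ j jm) Eb] := Hg0 l lr.
have E1 : (fiber_flag a1 a2 b1 b2 c d r sf wf (step (Fl gs')) h l j :=:
           fiber_flag a1 a2 b1 b2 c d r sf wf (step (Fl gs)) h l j *m th l)%MS.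
  apply: eqmx_trans _ (eqmx_sym (addsmxMr _ _ _)).
  apply: adds_eqmx; last by apply: eqmx_trans EV' (eqmx_sym (EVt l)).
  apply: eqmx_trans _ (cap_mul_unit _ _ (thu l)).
  exact: cap_eqmx (eqmx_trans ELa (eqmx_sym (stab _ _ l LLa))) (stE _ _ lr).
apply: eqmx_trans E1 _; apply: eqmx_trans (eqmxMr _ Eb) _.
apply: eqmx_trans (addsmxMr _ _ _) _; rewrite (fixV _ V) //; apply: adds_eqmx (eqmx_refl _).
rewrite /th /act_mx lr -mulmxA (theta_L LL') /frows -!mulmxA [g0 l *m _]mulmxA.
by rewrite mulmxV ?ug0 // mul1mx; apply: eqmx_refl.
Qed.

End Open.

Lemma flags_eq_trans k (E1 E2 E3 : flags) :
  flags_eq k E1 E2 -> flags_eq k E2 E3 -> flags_eq k E1 E3.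
Proof.
move=> [s12 H12] [s23 H23]; split=> [|l j jk]; first by rewrite s12.
by apply/eqmxP; apply: eqmx_trans (eqmxP (H12 l j jk)) (eqmxP (H23 l j jk)).
Qed.

Lemma omega_base_eq (V V' h : 'M[F]_N) (E E' : flags) : (V' :=: V)%MS -> \rank V = (a + b)%N ->
  flags_eq (\rank V) E E' -> in_omega 0 V a lam E h -> in_omega 0 V' a lam E' h.
Proof.
move=> EV rV [_ HE]; rewrite !in_omegaE /in_gr EV => -[gr H]; split=> // l i lL ia.
have idx : (\rank V - \rank (0%R : 'M[F]_N) - a + i.+1 - nth 0 (nth [::] lam l) i <= \rank V)%N.
  by rewrite rV; lia.
by rewrite EV -(cap_eqmx (eqmx_refl h) (eqmxP (HE l _ idx))); apply: H.
Qed.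

Lemma block_column_fibered : fibered F a b c d kappa lam rhos.
Proof.
have [p [ne Ogood]] := exists_good_open.
exists p, Vf, Ef, Ff; split; first exact: ne.
split=> gs Og /=.
  have [sz ua _] := Og; have Gd := Ogood gs Og.
  have Full l : (l < r)%N -> full_flag (step (Fl gs) l) by apply: Fl_full.
  have rV := rankV HN r2 Hw Full Gd.
  have oT := omega_total Full Gd; have oB := omega_base Full Gd; have oF := omega_fiber Full Gd.
  split; [split=> //|split; [|split]].
  - exact: Ef_inst.
  - by move=> H /oT tH; apply/oB; apply: (total_base HN r2 Hw Full Gd tH).
  - move=> h /oB bh; split; first exact: Ff_inst.
    by move=> H /oT tH /eqmxP E; apply/oF; apply: (total_fiber HN r2 Hs Hw Full Gd tH bh E).
  - by move=> H1 H2 /oT t1 /oT t2; apply: (total_inj HN r2 Hs Hw Full Gd t1 t2).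
  move=> h K /oB bh /oF fK; have [H [tH EV EK]] := total_exists HN r2 Hs Hw Full Gd bh fK.
  by exists H; split=> //; apply/oT.
split; first by move=> B EB; apply: (arise_base Ogood).
move=> B EB; have [p' [ne' Hp']] := arise_base Ogood Og EB.
exists p'; split=> // gE sz ua Hpe h Hh B' EB'.
(* The prescribed flags of [V] are realized by [gs1], and the fiber flags are then adjusted starting
   from [gs1], which leaves the flags of [V] in place. *)
have [gs1 [O1 [/eqmxP EV1 HE]]] := Hp' gE sz ua Hpe.
have [sz1 ua1 _] := O1; have Gd1 := Ogood gs1 O1.
have Full1 l : (l < r)%N -> full_flag (step (Fl gs1) l) by apply: Fl_full.
have [sz0 ua0 _] := Og; have Gd0 := Ogood gs Og.
have Full0 l : (l < r)%N -> full_flag (step (Fl gs) l) by apply: Fl_full.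
have rV := rankV HN r2 Hw Full0 Gd0.
have /(omega_base Full1 Gd1) bh := omega_base_eq EV1 rV HE Hh.
have [p2 [ne2 Hp2]] := arise_fiber Ogood O1 EV1 bh EB'.
exists p2; split=> // gG szG uaG HpG.
have [gs2 [O2 EV2 HE2 HG]] := Hp2 gG szG uaG HpG.
by exists gs2; split=> //; apply: flags_eq_trans HE HE2.
Qed.

End Main.

Local Close Scope ring_scope.
Unset Implicit Arguments.

Theorem theorem3p8 (F : numClosedFieldType) (a1 a2 b1 b2 c d : nat)
  (ms ns : seq nat) (alphas betas gammas : seq (seq nat)) :
  sumn ms = b1 -> sumn ns = b2 ->
  size alphas = 2 -> size betas = (size ms + size ns)%N ->
  schubert_problem c d (alphas ++ betas ++ gammas) ->
  fibered F (a1 + a2) (b1 + b2) c d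
    (compose c d [:: box a1 b1; box a2 b2] (map (box a2) ms ++ map (box a1) ns)
             [:: a1; a2] (ms ++ ns) alphas betas gammas)
    (block_column a1 a2 b1 b2 ms ns)
    (alphas ++ betas ++ gammas).
Proof. by move=> Hms Hns Hal Hbe /andP[Hbox _]; apply: block_column_fibered. Qed.
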